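(* Let $\Omega\subset\mathbb{R}^N$ be a bounded convex domain, let $\varepsilon>0$, and let $\mu,\nu$ be probability measures on $\Omega$ with smooth positive densities $f$ and $g$ with respect to Lebesgue measure: $d\mu=f\,dx$, $d\nu=g\,dx$. Assume that $g(x)=(1+\varepsilon u(x))f(x)$, where $u$ is a smooth function. Let $\varphi(x)=\frac{|x|^2}{2}+\varepsilon\psi(x)$, where $\psi$ is a smooth function satisfying $\partial_n\psi=0$ on $\partial\Omega$, and assume that $\varphi$ is convex with $\nabla\varphi_{\#}\mu=\nu$ and that $\varphi$ satisfies the nonlinear equation $$f(x)=g(\nabla\varphi(x))\det D^2\varphi(x)\quad\text{in }\Omega.$$ Let $L:=-\Delta-\nabla(\log f)\cdot\nabla$ and let $\Psi$ be the solution to the elliptic boundary value problem $$L\Psi=u\ \text{ in }\Omega,\qquad \partial_n\Psi=0\ \text{ on }\partial\Omega.$$ Then $$\left|W_2(\mu,\nu)-\varepsilon\|u\|_{\dot H^{-1}(d\mu)}\right|\le C\,\varepsilon^2,$$ where the constant $C=C_{\Omega,f,\psi,u}$ can be chosen in terms of almost everywhere upper bounds on $$|\nabla f|,\ |H_f|,\ |\nabla\psi|,\ |H_\psi|,\ |u|,\ |\nabla u|,\ |\Omega|,\ \text{ and }\ \lambda_1(L)^{-1}.$$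
   Context: ''Smooth'' means smooth up to the boundary, and positive means positive on $\overline\Omega$. $n$ is the exterior unit normal on $\partial\Omega$ and $\partial_n\psi=n\cdot\nabla\psi$. The quadratic Wasserstein distance is $W_2(\mu,\nu)^2=\inf_\pi\int_{\Omega\times\Omega}|x-y|^2\,d\pi(x,y)$, the infimum being over all probability measures $\pi$ on $\Omega\times\Omega$ with first marginal $\mu$ and second marginal $\nu$. The push-forward $T_{\#}\mu$ is defined by $(T_{\#}\mu)(A)=\mu(T^{-1}(A))$ for measurable $A$. For functions $u$ with $\int_\Omega u\,d\mu=0$, $$\|u\|_{\dot H^{-1}(d\mu)}:=\sup\left\{\int_\Omega u\,\phi\,d\mu:\ \|\phi\|_{\dot H^1(d\mu)}=1\right\},\qquad \|\phi\|_{\dot H^1(d\mu)}^2:=\int_\Omega|\nabla\phi|^2\,d\mu,$$ where the supremum is over (continuously differentiable on $\overline\Omega$) functions $\phi$. (In the claim, $\int_\Omega u\,d\mu=0$ holds automatically because $\mu,\nu$ are probability measures.) $|\nabla f|$ denotes the magnitude of the gradient, $H_f$ the Hessian of $f$ and $|H_f|$ its operator norm (similarly for $\psi$ and $u$), $|\Omega|$ is the Lebesgue measure of $\Omega$, and $\lambda_1(L)$ is the smallest positive eigenvalue of $L$ with Neumann boundary conditions $\partial_n\cdot=0$ on $\partial\Omega$. *)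

(* Defs.v *)
From HB Require Import structures.
From mathcomp Require Import all_boot all_order all_algebra.
From mathcomp Require Import all_classical all_reals all_analysis.

Set Implicit Arguments.
Unset Strict Implicit.
Unset Printing Implicit Defensive.

Import Order.TTheory GRing.Theory Num.Theory.
Import numFieldNormedType.Exports.

Local Open Scope classical_set_scope.
Local Open Scope ring_scope.

(* The sigma-algebra on R^n generated by the coordinates (= the Borel sets). *)
Definition rV_display : measure_display -> measure_display.
Proof. exact. Qed.

Section measurable_rV.
Variables (R : realType) (n : nat).

Definition rV_coord (i : 'I_n) (x : 'rV[R]_n) : R := x ord0 i.

Let rV_set0 : g_sigma_preimage rV_coord set0.
Proof. exact: sigma_algebra0. Qed.

Let rV_setC A : g_sigma_preimage rV_coord A -> g_sigma_preimage rV_coord (~` A).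
Proof. exact: sigma_algebraC. Qed.

Let rV_bigcup (F : _^nat) : (forall i, g_sigma_preimage rV_coord (F i)) ->
  g_sigma_preimage rV_coord (\bigcup_i (F i)).
Proof. exact: sigma_algebra_bigcup. Qed.

HB.instance Definition _ := @isMeasurable.Build (rV_display default_measure_display)
  'rV[R]_n (g_sigma_preimage rV_coord) rV_set0 rV_setC rV_bigcup.

Lemma measurable_rV_coord i : measurable_fun [set: 'rV[R]_n] (rV_coord i).
Proof.
move=> _ Y mY; rewrite setTI; apply: sub_sigma_algebra => /=.
rewrite -bigcup_seq/=; exists i => /=; first by rewrite mem_index_enum.
by exists Y => //; rewrite setTI.
Qed.

Lemma measurable_fun_rV d (T : measurableType d) (h : T -> 'rV[R]_n) :
  (forall i, measurable_fun [set: T] (rV_coord i \o h)) ->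
  measurable_fun [set: T] h.
Proof.
move=> mh _ A mA.
have sub : g_sigma_preimage (fun i => rV_coord i \o h) `<=` measurable.
  apply: smallest_sub; first exact: sigma_algebra_measurable.
  rewrite -bigcup_seq => B [i /= _ [Y mY <-]]; exact: mh.
by apply: sub; rewrite g_sigma_preimage_comp; exists A.
Qed.

End measurable_rV.

Section lebesgue_rV.
Variable R : realType.

Definition rV_cons n (p : R * 'rV[R]_n) : 'rV[R]_n.+1 :=
  \row_i (if unlift ord0 i is Some j then p.2 ord0 j else p.1).

Lemma measurable_rV_cons n : measurable_fun setT (@rV_cons n).
Proof.
apply: measurable_fun_rV => i.
have -> : rV_coord i \o @rV_cons n =
    if unlift ord0 i is Some j then rV_coord j \o snd else fst.
  by apply/funext => p; rewrite /= /rV_coord mxE; case: unlift.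
case: (unlift ord0 i) => [j|]; last exact: measurable_fst.
by apply: measurableT_comp; [exact: measurable_rV_coord|exact: measurable_snd].
Qed.

Definition rV_uncons n (x : 'rV[R]_n.+1) : R * 'rV[R]_n :=
  (x ord0 ord0, \row_j x ord0 (lift ord0 j)).

Lemma measurable_rV_uncons n : measurable_fun setT (@rV_uncons n).
Proof.
apply: measurable_fun_pair; first exact: (@measurable_rV_coord R n.+1 ord0).
apply: measurable_fun_rV => j.
have -> : rV_coord j \o (fun x : 'rV[R]_n.+1 => \row_j x ord0 (lift ord0 j)) =
    rV_coord (lift ord0 j).
  by apply/funext => x; rewrite /= /rV_coord mxE.
exact: measurable_rV_coord.
Qed.

Lemma rV_consK n : cancel (@rV_cons n) (@rV_uncons n).
Proof.
move=> [a v]; rewrite /rV_uncons /rV_cons mxE unlift_none /=; congr pair.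
by apply/rowP => j; rewrite !mxE liftK.
Qed.

HB.instance Definition _ n :=
  isMeasurableFun.Build _ _ _ _ (@rV_cons n) (@measurable_rV_cons n).

Section step.
Variables (n : nat) (m : {sigma_finite_measure set 'rV[R]_n -> \bar R}).

Definition lebesgue_step : set 'rV[R]_n.+1 -> \bar R :=
  pushforward (@lebesgue_measure R \x m)%E (@rV_cons n).

Let step0 : lebesgue_step set0 = 0%E.
Proof. by rewrite /lebesgue_step /pushforward preimage_set0 measure0. Qed.

Let step_ge0 A : (0 <= lebesgue_step A)%E.
Proof. by rewrite /lebesgue_step /pushforward; exact: measure_ge0. Qed.

Let step_sigma_additive : semi_sigma_additive lebesgue_step.
Proof.
have mc A : measurable A -> measurable (@rV_cons n @^-1` A).
  by move=> mA; rewrite -[X in measurable X]setTI; exact: measurable_rV_cons.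
move=> F mF tF mUF; rewrite /lebesgue_step /pushforward preimage_bigcup.
apply: measure_semi_sigma_additive; [by move=> k; exact: mc| |].
- apply/trivIsetP => i j _ _ ij; rewrite -preimage_setI.
  by move/trivIsetP : tF => /(_ _ _ _ _ ij) ->//; rewrite preimage_set0.
- by rewrite -preimage_bigcup; exact: mc.
Qed.

HB.instance Definition _ := isMeasure.Build _ _ _ lebesgue_step
  step0 step_ge0 step_sigma_additive.

Let step_sigma_finite : sigma_finite setT lebesgue_step.
Proof.
have /sigma_finiteP[F [FT ndF Ffin]] := sigma_finiteT (@lebesgue_measure R).
have /sigma_finiteP[G [GT ndG Gfin]] := sigma_finiteT m.
exists (fun k => @rV_uncons n @^-1` (F k `*` G k)).
  rewrite -preimage_bigcup (_ : \bigcup_k _ = setT) ?preimage_setT //.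
  rewrite -subTset => -[x y] _.
  have [i _ Fix] : (\bigcup_i F i) x by rewrite -FT.
  have [j _ Gjy] : (\bigcup_j G j) y by rewrite -GT.
  exists (maxn i j) => //; split => /=.
  - by move: x Fix; exact/subsetPset/ndF/leq_maxl.
  - by move: y Gjy; exact/subsetPset/ndG/leq_maxr.
move=> k; have [mF Foo] := Ffin k; have [mG Goo] := Gfin k.
split.
  rewrite -[X in measurable X]setTI; apply: measurable_rV_uncons => //.
  exact: measurableX.
rewrite /lebesgue_step /pushforward -comp_preimage.
rewrite (_ : _ \o _ = id); last by apply/funext => p /=; rewrite rV_consK.
rewrite preimage_id product_measure1E //.
by rewrite lte_mul_pinfty // ge0_fin_numE.
Qed.

HB.instance Definition _ :=
  Measure_isSigmaFinite.Build _ _ _ lebesgue_step step_sigma_finite.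

End step.

Fixpoint lebesgue_rV n : {sigma_finite_measure set 'rV[R]_n -> \bar R} :=
  match n with
  | 0 => \d_(0 : 'rV[R]_0)
  | n'.+1 => lebesgue_step (lebesgue_rV n')
  end.

Lemma lebesgue_rV_box n (A : 'I_n -> set R) : (forall i, measurable (A i)) ->
  lebesgue_rV n [set x | forall i, A i (x ord0 i)] =
  (\prod_(i < n) lebesgue_measure (A i))%E.
Proof.
elim: n A => [|n IHn] A mA.
  rewrite big_ord0 /= diracE (_ : _ \in _) //.
  by apply/mem_set => -[].
rewrite big_ord_recl -IHn //= /lebesgue_step /pushforward -product_measure1E //.
  congr ((_ \x _)%E _); apply/seteqP; split => -[a v] /=.
    move=> h; split; first by have := h ord0; rewrite mxE unlift_none.
    by move=> i; have := h (lift ord0 i); rewrite mxE liftK.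
  move=> [Aa Av] i; rewrite mxE.
  by case: (unliftP ord0 i) => [j|] ->.
  exact: mA.
suff -> : (fun x : 'rV[R]_n => forall i, A (lift ord0 i) (x ord0 i)) =
    \bigcap_(i in [set: 'I_n]) (rV_coord i @^-1` A (lift ord0 i)).
  apply: fin_bigcap_measurable => // i _.
  rewrite -[X in measurable X]setTI.
  by apply: measurable_rV_coord => //; exact: mA.
by apply/seteqP; split => x /= h i; [move=> _|]; exact: h.
Qed.

End lebesgue_rV.

Section euclidean.
Variables (R : realType) (n : nat).
Local Notation E := 'rV[R]_n.
Implicit Types (x y : E) (w : E -> R).

Definition dot x y : R := \sum_i x ord0 i * y ord0 i.

(* the canonical norm on 'rV[R]_n is the max norm *)
Definition enorm x : R := Num.sqrt (dot x x).

Definition opnorm (A : 'M[R]_n) : R :=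
  sup [set enorm (x *m A) | x in [set x | enorm x <= 1]].

Definition partial (i : 'I_n) w : E -> R := fun x => 'D_(delta_mx ord0 i) w x.

Definition grad w : E -> E := fun x => \row_i partial i w x.

Definition hessian w : E -> 'M[R]_n :=
  fun x => \matrix_(i, j) partial i (partial j w) x.

Definition iter_partial (s : seq 'I_n) w : E -> R := foldr partial w s.

(* C^k up to the boundary, for an open set Omega: the partial derivatives of
   order at most k exist in Omega and extend continuously to its closure. *)
Definition Ck_closure (Omega : set E) (k : nat) w : Prop :=
  {within closure Omega, continuous w} /\
  forall s : seq 'I_n, (size s <= k)%N ->
    (exists2 G : E -> R, {within closure Omega, continuous G} &
       forall x, Omega x -> iter_partial s w x = G x) /\
    ((size s < k)%N -> forall i x, Omega x ->
       derivable (iter_partial s w) x (delta_mx ord0 i)).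

Definition smooth_closure (Omega : set E) w : Prop :=
  forall k, Ck_closure Omega k w.

(* the extension of the gradient from Omega to its closure *)
Definition grad_closure (Omega : set E) w : E -> E :=
  fun x => \row_i lim (partial i w @ within Omega (nbhs x)).

Definition supporting_normal (Omega : set E) x (v : E) : Prop :=
  enorm v = 1 /\ forall y, Omega y -> dot v (y - x) <= 0.

(* For a convex Omega, the exterior unit normal exists at the boundary points
   where the supporting hyperplane is unique (at all of them if the boundary is
   C^1, and at almost all of them in general). *)
Definition exterior_unit_normal (Omega : set E) x (v : E) : Prop :=
  supporting_normal Omega x v /\
  forall v', supporting_normal Omega x v' -> v' = v.

Definition neumann_condition (Omega : set E) w : Prop :=
  forall x v, (closure Omega `\` Omega) x -> exterior_unit_normal Omega x v ->
    dot v (grad_closure Omega w x) = 0.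

End euclidean.

Section wasserstein.
Variables (R : realType) (n : nat).
Local Notation E := 'rV[R]_n.
Variables (Omega : set E) (mu nu : probability E R).

Definition has_density (f : E -> R) : Prop := forall A, measurable A ->
  mu A = (\int[lebesgue_rV R n]_(x in A `&` Omega) (f x)%:E)%E.

Definition coupling (pi : probability (E * E)%type R) : Prop :=
  [/\ pi (Omega `*` Omega) = 1%E,
      forall A, measurable A -> pi (A `*` setT) = mu A &
      forall B, measurable B -> pi (setT `*` B) = nu B].

Definition W2 : \bar R := sqrte (ereal_inf
  [set (\int[pi]_(z in Omega `*` Omega) (enorm (z.1 - z.2) ^+ 2)%:E)%E
     | pi in coupling]).

(* mu lives on Omega, and T need not be measurable outside Omega *)
Definition pushes_forward (T : E -> E) : Prop :=
  forall A, measurable A -> nu A = mu (Omega `&` T @^-1` A).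

Definition Hdot1 (phi : E -> R) : \bar R :=
  sqrte (\int[mu]_(x in Omega) (enorm (grad phi x) ^+ 2)%:E)%E.

Definition Hdotm1 (u : E -> R) : \bar R := ereal_sup
  [set (\int[mu]_(x in Omega) (u x * phi x)%:E)%E
     | phi in [set phi | Ck_closure Omega 1 phi /\ Hdot1 phi = 1%E]].

End wasserstein.

Section neumann_problem.
Variables (R : realType) (n : nat).
Local Notation E := 'rV[R]_n.
Variable (Omega : set E).
Local Notation leb := (lebesgue_rV R n).

Definition test_function (eta : E -> R) : Prop :=
  smooth_closure setT eta /\
  exists K : set E, [/\ compact K, K `<=` Omega & forall x, ~ K x -> eta x = 0].

Definition square_integrable (h : E -> R) : Prop :=
  measurable_fun Omega h /\ (\int[leb]_(x in Omega) (h x ^+ 2)%:E < +oo)%E.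

Definition weak_gradient (w : E -> R) (V : E -> E) : Prop :=
  forall eta, test_function eta -> forall i,
    (\int[leb]_(x in Omega) (w x * partial i eta x)%:E =
     - \int[leb]_(x in Omega) (V x ord0 i * eta x)%:E)%E.

(* w is in the Sobolev space H^1(Omega), with gradient V *)
Definition sobolev_H1 (w : E -> R) (V : E -> E) : Prop :=
  [/\ square_integrable w,
      forall i, square_integrable (fun x => V x ord0 i) &
      weak_gradient w V].

(* w solves  L w = h in Omega,  d_n w = 0 on the boundary,  where
     L w = - Delta w - grad (log f) . grad w,
   in the usual weak sense: multiply by phi, integrate over Omega, and integrate
   the Laplacian by parts, the boundary term being zero. The boundary of a
   convex domain may have corners, where classical solutions need not exist. *)
Definition neumann_solution (f w h : E -> R) : Prop :=
  exists2 V : E -> E, sobolev_H1 w V &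
  forall phi, Ck_closure Omega 1 phi ->
    (\int[leb]_(x in Omega)
        (dot (V x) (grad phi x) - dot (grad (fun y => ln (f y)) x) (V x) * phi x)%:E =
     \int[leb]_(x in Omega) (h x * phi x)%:E)%E.

Definition neumann_eigenvalue (f : E -> R) (lambda : R) : Prop :=
  exists2 w : E -> R, ~ {ae leb, forall x, Omega x -> w x = 0} &
    neumann_solution f w (fun x => lambda * w x).

Definition smallest_positive_eigenvalue (f : E -> R) (lambda1 : R) : Prop :=
  [/\ 0 < lambda1, neumann_eigenvalue f lambda1 &
      forall lambda, 0 < lambda -> neumann_eigenvalue f lambda ->
        lambda1 <= lambda].

Definition ae_upper_bound (h : E -> R) (K : R) : Prop :=
  {ae leb, forall x, Omega x -> h x <= K}.

End neumann_problem.

(* Main.v *)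
Require Import Defs.
From mathcomp Require Import all_boot all_order all_algebra.
From mathcomp Require Import all_classical all_reals all_analysis.
From mathcomp Require Import perm measurable_realfun ring lra.

Import Order.TTheory GRing.Theory Num.Theory.
Import numFieldNormedType.Exports.

Local Open Scope classical_set_scope.
Local Open Scope ring_scope.

Set Implicit Arguments.
Unset Strict Implicit.
Unset Printing Implicit Defensive.

(** Let A be the L2(mu) norm of grad psi, and T = grad phi = id + eps grad psi on
    Omega. The distance W2(mu, nu) and eps times the dual norm of u are both
    compared with eps A.

    The distance. The coupling (id, T) costs eps^2 A^2, hence W2 <= eps A (W2_le).
    Conversely psi is an almost optimal Kantorovich potential: by Taylor and Young,
    psi y - psi x <= eps |grad psi x|^2 / 2 + (1 / (2 eps) + K) |y - x|^2, where K
    bounds the Hessian of psi. The integral of the left side against any coupling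
    is eps int u psi dmu, which is also int (psi o T - psi) dmu, that is, eps A^2
    up to O(eps^2) (energy_lower). So every coupling costs at least
    (eps A (1 - O(eps)))^2 (coupling_cost_lower, W2_ge).

    The dual norm, from below: test with psi / A and use energy_lower again.

    The dual norm, from above (dual_norm_upper). Let w be a test function of mean
    zero and unit energy; then eps int u w dmu = int (w o T - w) dmu. On the
    segment from x to T x, with points T_t x, the increment of w is an average over
    t of eps grad w (T_t x) . grad psi x. By Young's inequality weighted with
    r = f (T_t x) / f x, the integrand times f x is at most
    (A' / 2) (|grad w|^2 f) (T_t x) + |grad psi x|^2 f x / (2 A' r) with
    A' = A + eps. The map T_t multiplies distances by at least 1 - O(eps), so composing
    with it multiplies an integral by at most 1 + O(eps) (noncontracting_integral),
    and the sum of the two terms is A + O(eps) as long as 1 / r is 1 + O(eps).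

    The constant may not depend on a lower bound of f, and this makes 1 / r
    delicate. At t = 1 the Monge-Ampere equation gives r = 1 + O(eps), because the
    Jacobian of T is 1 + O(eps) (monge_ampere_comparable). For t < 1, the second
    order Taylor bound of f along the segment gives
    f (T_t x) >= f x (1 - O(eps)) - O(eps^2) (partway_density). Where f x is at
    least a large multiple of eps^2, the resulting excess of 1 / r over 1 + O(eps)
    is O(eps^2) / f x, harmless once multiplied by f x and integrated. Where f x is
    of order eps^2, a cutoff c, a function of f, is used: by the push-forward
    relation int c (w o T - w) dmu equals
    int (c - c o T) (w o T) dmu + eps int c u w dmu. Both terms are O(eps^2), for
    c - c o T is O(eps), that region has mass O(eps^2), and int w^2 dmu is at
    most 1 / lambda1 (cutoff_part).

    The spectral gap int w^2 dmu <= int |grad w|^2 dmu / lambda1 for C1 functions of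
    mean zero is derived from the minimality of lambda1 among the weak eigenvalues
    (spectral_gap). Otherwise the infimum rho of the Rayleigh quotient would be
    smaller than lambda1. It is positive by the Poincare inequality on convex sets
    (weighted_poincare); a minimizing sequence is precompact in L2 (rellich) and
    then Cauchy in H1 by the parallelogram identity (almost_minimizers); its limit
    is a weak eigenfunction for rho (rayleigh_eigenvalue), a contradiction.

    Both the Poincare inequality and the transport estimate change variables only
    through maps that multiply distances, in the maximum norm, by at least some c > 0. For these, the preimage of a dyadic cube of side s has diameter at
    most s / c, hence measure at most (s / c)^n, and no Jacobian is computed.

    When eps is bounded below, the estimate only says that the two quantities are
    O(eps), which follows from W2 <= eps A and the bound (Ku^2 + 1 / lambda1) / 2 on
    the dual norm (Hdotm1_bound). *)

(** * Integrals of bounded measurable functions *)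

Section bounded_measurable.
Context d (T : measurableType d) (R : realType).
Variables (m : {measure set T -> \bar R}) (D : set T).
Implicit Types h k : T -> R.

(** On sets of finite measure these functions form an algebra of integrable functions,
    so the rules for real integrals below only ask for membership in it. *)
Definition bmfun h := measurable_fun D h /\ exists M, forall x, D x -> `|h x| <= M.

Lemma bmfun_cst a : bmfun (fun=> a).
Proof. by split; [exact: measurable_cst|exists `|a|]. Qed.

Lemma bmfunD h k : bmfun h -> bmfun k -> bmfun (fun x => h x + k x).
Proof.
move=> [mh [M hM]] [mk [L kL]]; split; first exact: measurable_funD.
by exists (M + L) => x Dx; apply: le_trans (ler_normD _ _) _; rewrite lerD ?hM ?kL.
Qed.

Lemma bmfunN h : bmfun h -> bmfun (fun x => - h x).
Proof.
move=> [mh [M hM]]; split; first exact: measurableT_comp.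
by exists M => x Dx; rewrite normrN hM.
Qed.

Lemma bmfunB h k : bmfun h -> bmfun k -> bmfun (fun x => h x - k x).
Proof. by move=> bh /bmfunN bk; exact: bmfunD. Qed.

Lemma bmfunM h k : bmfun h -> bmfun k -> bmfun (fun x => h x * k x).
Proof.
move=> [mh [M hM]] [mk [L kL]]; split; first exact: measurable_funM.
by exists (M * L) => x Dx; rewrite normrM ler_pM ?hM ?kL.
Qed.

Lemma bmfunX h n : bmfun h -> bmfun (fun x => h x ^+ n).
Proof.
move=> bh; elim: n => [|n IH]; first by under eq_fun do rewrite expr0; exact: bmfun_cst.
by under eq_fun do rewrite exprS; exact: bmfunM.
Qed.

Lemma bmfun_norm h : bmfun h -> bmfun (fun x => `|h x|).
Proof.
move=> [mh [M hM]]; split; first exact: measurableT_comp.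
by exists M => x Dx; rewrite normr_id hM.
Qed.

Lemma bmfun_sum I (r : seq I) (P : pred I) (h : I -> T -> R) :
  (forall i, bmfun (h i)) -> bmfun (fun x => \sum_(i <- r | P i) h i x).
Proof.
move=> bh; elim: r => [|a r IH].
  by under eq_fun do rewrite big_nil; exact: bmfun_cst.
under eq_fun do rewrite big_cons.
by case: (P a) => //; exact: bmfunD.
Qed.

Lemma eq_bmfun h k : (forall x, D x -> h x = k x) -> bmfun h -> bmfun k.
Proof.
move=> hk [mh [M hM]]; split.
  by apply: eq_measurable_fun mh => x /set_mem; exact: hk.
by exists M => x Dx; rewrite -hk ?hM.
Qed.

Hypotheses (mD : measurable D) (fD : (m D < +oo)%E).
Local Notation I h := (\int[m]_(x in D) h x)%R.

Lemma bmfun_integrable h : bmfun h -> m.-integrable D (EFin \o h).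
Proof.
move=> [mh [M hM]]; apply: measurable_bounded_integrable => //.
exists (M + 1); split; [exact: num_real|move=> M' M'M x Dx]; apply: ltW; apply: le_lt_trans M'M.
by apply: le_trans (hM _ Dx) _; rewrite lerDl.
Qed.

Lemma bmfun_integralE h : bmfun h ->
  (\int[m]_(x in D) (h x)%:E = (I h)%:E)%E.
Proof.
by move=> bh; rewrite /Rintegral fineK //; apply: integrable_fin_num => //; exact: bmfun_integrable.
Qed.

Lemma bm_le h k : bmfun h -> bmfun k -> (forall x, D x -> h x <= k x) -> I h <= I k.
Proof. by move=> bh bk hk; apply: le_Rintegral => //; exact: bmfun_integrable. Qed.

Lemma bm_D h k : bmfun h -> bmfun k -> I (fun x => h x + k x) = I h + I k.
Proof. by move=> bh bk; rewrite RintegralD //; exact: bmfun_integrable. Qed.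

Lemma bm_B h k : bmfun h -> bmfun k -> I (fun x => h x - k x) = I h - I k.
Proof. by move=> bh bk; rewrite RintegralB //; exact: bmfun_integrable. Qed.

Lemma bm_Z a h : bmfun h -> I (fun x => a * h x) = a * I h.
Proof. by move=> bh; rewrite RintegralZl //; exact: bmfun_integrable. Qed.

Lemma bm_cst a : I (fun=> a) = a * fine (m D).
Proof. by rewrite Rintegral_cst. Qed.

Lemma bm_sum J (r : seq J) (P : pred J) (h : J -> T -> R) : (forall i, bmfun (h i)) ->
  I (fun x => \sum_(i <- r | P i) h i x) = \sum_(i <- r | P i) I (h i).
Proof.
move=> bh; elim: r => [|a r IH].
  under eq_Rintegral do rewrite big_nil.
  by rewrite bm_cst mul0r big_nil.
under eq_Rintegral do rewrite big_cons.
rewrite big_cons; case: (P a) => //; rewrite bm_D ?IH //; exact: bmfun_sum.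
Qed.

Lemma bm_ge0 h : (forall x, D x -> 0 <= h x) -> 0 <= I h.
Proof. exact: Rintegral_ge0. Qed.

Lemma bm_indic (S : set T) : measurable S ->
  bmfun \1_S /\ I \1_S = fine (m (S `&` D)).
Proof.
move=> mS; split.
  split; first by apply: measurable_indic.
  by exists 1 => x _; rewrite indicE; case: (_ \in _); rewrite ?normr1 ?normr0 ?ler01.
by rewrite /Rintegral integral_indic.
Qed.

Lemma bm_eq h k : (forall x, D x -> h x = k x) -> I h = I k.
Proof. by move=> hk; apply: eq_Rintegral => x /set_mem; exact: hk. Qed.

Lemma bm_norm_le h k : bmfun h -> bmfun k -> (forall x, D x -> `|h x| <= k x) -> `|I h| <= I k.
Proof.
move=> bh bk hk; rewrite ler_norml; apply/andP; split.
  rewrite -[leLHS]mulN1r -bm_Z //; apply: bm_le => // [|x Dx].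
    by apply: bmfunM => //; exact: bmfun_cst.
  by rewrite mulN1r lerNl; apply: le_trans (hk x Dx); rewrite -normrN ler_norm.
by apply: bm_le => // x Dx; apply: le_trans (hk x Dx); exact: ler_norm.
Qed.

End bounded_measurable.

(** * Dyadic cubes *)

Section dyadic.
Variables (R : realType) (n : nat).
Local Notation E := 'rV[R]_n.
Local Notation leb := (lebesgue_rV R n).

Lemma coord_le_norm (x : E) i : `|x ord0 i| <= `|x|.
Proof.
by rewrite /Num.Def.normr /= mx_normrE (le_bigmax _ (fun ij => `|x ij.1 ij.2|) (ord0, i)).
Qed.

Lemma norm_le_coord (x : E) M : 0 <= M -> (forall i, `|x ord0 i| <= M) -> `|x| <= M.
Proof.
move=> M0 h; rewrite /Num.Def.normr /= mx_normrE; apply: bigmax_le => // -[a i] _ /=.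
by rewrite (ord1 a).
Qed.

Definition dyadic_index k (x : E) : {ffun 'I_n -> int} :=
  [ffun i => Num.floor (2 ^+ k * x ord0 i)].

Definition dyadic_cube k (z : {ffun 'I_n -> int}) : set E :=
  [set x | dyadic_index k x = z].

Lemma dyadic_cubeE k z : dyadic_cube k z =
  [set x | forall i, [set` `[(z i)%:~R / 2 ^+ k, ((z i)%:~R + 1) / 2 ^+ k[] (x ord0 i)].
Proof.
have p0 : (0 : R) < 2 ^+ k by rewrite exprn_gt0.
apply/seteqP; split => x /=.
  move=> <- i; rewrite in_itv /= ffunE.
  rewrite ler_pdivrMr // ltr_pdivlMr // mulrC; apply/andP; split.
    exact: floor_le.
  rewrite mulrC -(@intrD1 R); exact: floorD1_gt.
move=> h; apply/ffunP => i; rewrite ffunE; have := h i; rewrite in_itv /=.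
rewrite ler_pdivrMr // ltr_pdivlMr // => /andP[a b]; apply: floor_def.
by rewrite mulrC a /= intrD.
Qed.

Lemma measurable_dyadic_cube k z : measurable (dyadic_cube k z).
Proof.
suff -> : dyadic_cube k z = \bigcap_(i in [set: 'I_n]) (@rV_coord R n i @^-1`
    [set` `[(z i)%:~R / 2 ^+ k, ((z i)%:~R + 1) / 2 ^+ k[]).
  apply: fin_bigcap_measurable => // i _.
  by rewrite -[X in measurable X]setTI; apply: measurable_rV_coord.
rewrite dyadic_cubeE.
by apply/seteqP; split => x /= h i; [move=> _|]; exact: h.
Qed.

Lemma lebesgue_dyadic_cube k z : leb (dyadic_cube k z) = ((2 ^- k) ^+ n)%:E.
Proof.
rewrite dyadic_cubeE; etransitivity.
  by apply: (@lebesgue_rV_box R n (fun i => [set` `[(z i)%:~R / 2 ^+ k,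
    ((z i)%:~R + 1) / 2 ^+ k[])) => i; exact: measurable_itv.
rewrite (eq_bigr (fun=> (2 ^- k)%:E)); last first.
  move=> i _; rewrite /= lebesgue_measure_itv /= lte_fin ltr_pM2r ?invr_gt0 ?exprn_gt0 //.
  by rewrite ltrDl ltr01 EFinN -EFinD -mulrBl addrAC subrr add0r div1r.
by rewrite prodEFin prodr_const card_ord.
Qed.

Lemma dyadic_indexW k l x y : (k <= l)%N ->
  dyadic_index l x = dyadic_index l y -> dyadic_index k x = dyadic_index k y.
Proof.
move=> /subnK <-; elim: (l - k)%N => [//|j IH] h; apply: IH.
apply/ffunP => i; move/ffunP: h => /(_ i); rewrite !ffunE addSn exprS -!mulrA.
move: (_ ^+ _ * x _ _) (_ ^+ _ * y _ _) => s t st.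
apply/esym/floor_def; have /andP[a b] := floor_itv s.
have e1 : ((2 * Num.floor s)%:~R : R) <= 2 * t.
  by rewrite -floor_ge_int -st floor_ge_int intrM ler_pM2l.
have e2 : 2 * t < ((2 * (Num.floor s + 1))%:~R : R).
  rewrite -floor_lt_int -st floor_lt_int intrM ltr_pM2l //.
by move: e1 e2; rewrite !intrM ler_pM2l // ltr_pM2l // => -> ->.
Qed.

Lemma dyadic_index_close k x y : dyadic_index k x = dyadic_index k y ->
  `|x - y| <= 2 ^- k.
Proof.
have p0 : (0 : R) < 2 ^+ k by rewrite exprn_gt0.
move=> h; apply: norm_le_coord => [|i]; first by rewrite invr_ge0 ltW.
move/ffunP: h => /(_ i); rewrite !ffunE !mxE => h.
have /andP[] := floor_itv (2 ^+ k * x ord0 i).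
have /andP[] := floor_itv (2 ^+ k * y ord0 i).
rewrite h intrD => a b c d.
rewrite -(ler_pM2l p0) mulfV ?gt_eqF // -[X in X * _]gtr0_norm // -normrM mulrBr.
rewrite ler_norml; lra.
Qed.

(** Weaker than being open: dyadic cubes themselves qualify, which allows the pieces of
    a convex set cut along a dyadic grid. *)
Definition dyadic_open (S : set E) := forall x, S x ->
  exists k, forall y, dyadic_index k y = dyadic_index k x -> S y.

Lemma small_dyadic e : 0 < e -> exists k, 2 ^- k < e :> R.
Proof.
move=> e0; have h : (fun k => (2^-1 : R) ^+ k) @ \oo --> 0.
  by apply: cvg_expr; rewrite ger0_norm ?invr_ge0 // invf_lt1 // ltr1n.
move/cvgrPdist_lt: h => /(_ e e0) [k _ /(_ k (leqnn k))].
by rewrite sub0r normrN exprVn ger0_norm ?invr_ge0 ?exprn_ge0 //; exists k.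
Qed.

Lemma open_dyadic_open S : open S -> dyadic_open S.
Proof.
move=> oS x Sx; have : nbhs x S by exact: open_nbhs_nbhs.
move/nbhs_ballP => [e /= e0 he]; have [k ke] := small_dyadic e0; exists k => y yx.
by apply: he; rewrite -ball_normE /= distrC; apply: le_lt_trans ke; exact: dyadic_index_close.
Qed.

Lemma dyadic_openI S S' : dyadic_open S -> dyadic_open S' -> dyadic_open (S `&` S').
Proof.
move=> h h' x [/h [k hk] /h' [l hl]]; exists (maxn k l) => y yx; split.
  by apply: hk; apply: dyadic_indexW yx; exact: leq_maxl.
by apply: hl; apply: dyadic_indexW yx; exact: leq_maxr.
Qed.

Lemma dyadic_cube_open k z : dyadic_open (dyadic_cube k z).
Proof. by move=> x <-; exists k. Qed.

(** The cubes of level k are numbered by nat to be used in countable unions. *)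
Definition dyadic_piece (S : set E) k (j : nat) : set E :=
  if pickle_inv j is Some z then
    [set x | dyadic_cube k z x /\ dyadic_cube k z `<=` S] else set0.

Definition dyadic_part S k : set E :=
  [set x | dyadic_cube k (dyadic_index k x) `<=` S].

Lemma dyadic_part_bigcup S k : dyadic_part S k = \bigcup_j dyadic_piece S k j.
Proof.
apply/seteqP; split => x; rewrite /dyadic_part /dyadic_piece /=.
  by move=> h; exists (pickle (dyadic_index k x)) => //; rewrite pickleK_inv.
move=> [j _]; case: pickle_inv => // z [/= <-]; exact.
Qed.

Lemma dyadic_pieceP S k j : dyadic_piece S k j = set0 \/
  exists z, dyadic_piece S k j = dyadic_cube k z.
Proof.
rewrite /dyadic_piece; case: pickle_inv => [z|]; last by left.
have [h|h] := pselect (dyadic_cube k z `<=` S); [right|left].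
  by exists z; apply/seteqP; split => x //= [].
by apply/seteqP; split => x //= [].
Qed.

Lemma trivIset_dyadic_piece S k : trivIset setT (dyadic_piece S k).
Proof.
apply/trivIsetP => i j _ _ ij; apply/seteqP; split=> x //; rewrite /dyadic_piece /=.
case ei : (pickle_inv i) => [z|] [] //; case ej : (pickle_inv j) => [z'|] // [zx _] [z'x _].
have := @pickle_invK {ffun 'I_n -> int} i; have := @pickle_invK {ffun 'I_n -> int} j; rewrite ei ej /= -zx -z'x => ji ii.
by move: ij; rewrite -ji -ii eqxx.
Qed.

Lemma dyadic_part_sub S k : dyadic_part S k `<=` S.
Proof. by move=> x; exact. Qed.

Lemma dyadic_part_mono S : {homo dyadic_part S : k l / (k <= l)%N >-> (k <= l)%O}.
Proof.
move=> k l kl; apply/subsetPset => x /= h y /= yx; apply: h.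
exact: dyadic_indexW kl _.
Qed.

Lemma dyadic_open_bigcup S : dyadic_open S -> S = \bigcup_k dyadic_part S k.
Proof.
move=> oS; apply/seteqP; split => [x /oS [k h]|x [k _ /dyadic_part_sub]] //.
by exists k.
Qed.

Lemma measurable_dyadic_part S k : measurable (dyadic_part S k).
Proof.
rewrite dyadic_part_bigcup; apply: bigcup_measurable => j _.
by have [->|[z ->]] := dyadic_pieceP S k j => //; exact: measurable_dyadic_cube.
Qed.

Lemma dyadic_open_measurable (S : set E) : dyadic_open S -> measurable S.
Proof.
move=> /dyadic_open_bigcup ->; apply: bigcup_measurable => k _.
exact: measurable_dyadic_part.
Qed.

Lemma open_measurable_rV (S : set E) : open S -> measurable S.
Proof. by move/open_dyadic_open/dyadic_open_measurable. Qed.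

(** A dyadic open set is the increasing union over k of the disjoint unions of the level
    k cubes that it contains; the comparison passes to disjoint unions and then to the
    limit. *)
Lemma dyadic_compare d (T : measurableType d) (m : {measure set T -> \bar R})
    (D : set T) (tau : T -> E) (c : R) (S : set E) :
  measurable D -> measurable_fun D tau -> 0 <= c ->
  (forall k z, c%:E * m (D `&` tau @^-1` dyadic_cube k z) <= leb (dyadic_cube k z))%E ->
  dyadic_open S ->
  (c%:E * m (D `&` tau @^-1` S) <= leb S)%E.
Proof.
move=> mD mtau c0 hc oS.
have mp k j : measurable (dyadic_piece S k j).
  by have [->|[z ->]] := dyadic_pieceP S k j => //; exact: measurable_dyadic_cube.
have part k : (c%:E * m (D `&` tau @^-1` dyadic_part S k) <= leb (dyadic_part S k))%E.
  rewrite dyadic_part_bigcup preimage_bigcup setI_bigcupr.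
  have trivp : trivIset setT (fun j => D `&` tau @^-1` dyadic_piece S k j).
    apply/trivIsetP => i j _ _ ij; apply/seteqP; split => x // [[_ a] [_ b]].
    by have /trivIsetP/(_ i j Logic.I Logic.I ij)/seteqP[h _] := @trivIset_dyadic_piece S k; apply: (h (tau x)).
  rewrite (measure_bigcup m) //; last by move=> j _; exact: mtau.
  rewrite (measure_bigcup leb) //; last exact: trivIset_dyadic_piece.
  rewrite -nneseriesZl //; apply: lee_nneseries => [j _ _|j _].
    by rewrite mule_ge0.
  have [->|[z ->]] := dyadic_pieceP S k j; last exact: hc.
  by rewrite preimage_set0 setI0 measure0 mule0.
have mpart k := measurable_dyadic_part S k.
have h1 : m (D `&` tau @^-1` dyadic_part S k) @[k --> \oo] --> m (D `&` tau @^-1` S).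
  rewrite {2}(dyadic_open_bigcup oS) preimage_bigcup setI_bigcupr.
  apply: (@nondecreasing_cvg_mu _ _ _ m (fun k => D `&` tau @^-1` dyadic_part S k)).
  - by move=> k; exact: mtau.
  - by apply: bigcup_measurable => k _; exact: mtau.
  - move=> k l kl; apply/subsetPset => x /= [Dx h]; split => //.
    by have /subsetPset := dyadic_part_mono S kl; apply.
have h2 : leb (dyadic_part S k) @[k --> \oo] --> leb S.
  rewrite {2}(dyadic_open_bigcup oS); apply: nondecreasing_cvg_mu => //.
  - exact: bigcup_measurable.
  - exact: dyadic_part_mono.
have h3 : (c%:E * m (D `&` tau @^-1` dyadic_part S k))%E @[k --> \oo] -->
    (c%:E * m (D `&` tau @^-1` S))%E by exact: cvgeZl.
rewrite -(cvg_lim _ h3) // -(cvg_lim _ h2) //; apply: lee_lim.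
- by apply/cvg_ex; eexists; exact: h3.
- by apply/cvg_ex; eexists; exact: h2.
- by apply: nearW.
Qed.

End dyadic.

(** * Change of variables for noncontracting maps *)

(** A layer-cake sum with m layers of thickness del approximates t from below, within
    del as long as the layers reach t. *)
Lemma layer_le (R : realType) m (del t : R) : 0 < del -> 0 <= t ->
  \sum_(k < m) del * (if k.+1%:R * del < t then 1 else 0) <= t /\
  (t <= m%:R * del ->
   t <= del + \sum_(k < m) del * (if k.+1%:R * del < t then 1 else 0)).
Proof.
move=> del0 t0.
pose S m := \sum_(k < m) del * (if k.+1%:R * del < t then 1 else 0).
rewrite -/(S m); have : [/\ S m <= t, S m <= m%:R * del & t <= del + S m \/ (m%:R * del < t /\ S m = m%:R * del)].
  elim: m => [|m [IH1 IH2 IH3]].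
    rewrite /S big_ord0 mul0r addr0; split => //.
    by have [->|t1] := eqVneq t 0; [left; exact: ltW|right; rewrite lt_neqAle eq_sym t1].
  rewrite /S big_ord_recr /= -/(S m); case: ltP => h.
    rewrite mulr1 -natr1 mulrDl mul1r in h *; split; [lra|lra|].
    by case: IH3 => [|[_ ->]]; [left; lra|right; split; lra].
  rewrite mulr0 addr0 -natr1 mulrDl mul1r in h *; split; [lra|lra|].
  by left; case: IH3 => [|[? ->]]; lra.
move=> [h1 _ h3]; split => // tm; case: h3 => // -[] h; lra.
Qed.

Section noncontracting.
Variables (R : realType) (n : nat).
Local Notation E := 'rV[R]_n.
Local Notation leb := (lebesgue_rV R n).

Lemma measurable_rV_box (A : 'I_n -> set R) : (forall i, measurable (A i)) ->
  measurable [set x : E | forall i, A i (x ord0 i)].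
Proof.
move=> mA.
have e : [set x : E | forall i, A i (x ord0 i)] =
    \bigcap_(i in [set: 'I_n]) (@rV_coord R n i @^-1` A i).
  by apply/seteqP; split => x /= h i; [move=> _|]; exact: h.
apply: (eq_ind_r (fun B : set E => measurable B) _ e).
apply: fin_bigcap_measurable => // i _.
by rewrite -[X in measurable X]setTI; apply: measurable_rV_coord.
Qed.

(** The diameter is taken for the maximum norm, so the set lies in a cube of side r. *)
Lemma lebesgue_small_diameter (B : set E) r : measurable B -> 0 <= r ->
  (forall x y, B x -> B y -> `|x - y| <= r) -> (leb B <= (r ^+ n)%:E)%E.
Proof.
move=> mB r0 hB; have [->|/set0P[x0 Bx0]] := eqVneq B set0.
  by rewrite measure0 lee_fin exprn_ge0.
pose Bi i := [set x ord0 i | x in B].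
have hasinf i : has_inf (Bi i).
  split; first by exists (x0 ord0 i), x0.
  exists (x0 ord0 i - r) => _ [x Bx <-]; rewrite lerBlDr -lerBlDl.
  by apply: le_trans (ler_norm _) (le_trans _ (hB _ _ Bx0 Bx)); have := coord_le_norm (x0 - x) i; rewrite !mxE.
pose a i := inf (Bi i).
have sub : B `<=` [set x | forall i, [set` `[a i, a i + r]] (x ord0 i)].
  move=> x Bx i /=; rewrite in_itv /=; apply/andP; split.
    by apply: ge_inf; [case: (hasinf i)|exists x].
  rewrite -lerBlDr; apply: lb_le_inf; first by case: (hasinf i).
  move=> _ [y By <-]; rewrite lerBlDr -lerBlDl.
  by apply: le_trans (ler_norm _) (le_trans _ (hB _ _ Bx By)); have := coord_le_norm (x - y) i; rewrite !mxE.
have box : leb [set x | forall i, [set` `[a i, a i + r]] (x ord0 i)] = (r ^+ n)%:E.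
  etransitivity.
    by apply: (@lebesgue_rV_box R n (fun i => [set` `[a i, a i + r]])) => i; exact: measurable_itv.
  rewrite (eq_bigr (fun=> r%:E)); first by rewrite prodEFin prodr_const card_ord.
  move=> i _; rewrite /= lebesgue_measure_itv /= lte_fin ltrDl.
  case: ltP => [_|r0']; first by rewrite -EFinD addrAC subrr add0r.
  by congr EFin; apply/eqP; rewrite eq_le r0 r0'.
rewrite -box; apply: le_measure; rewrite ?inE //.
apply: (@measurable_rV_box (fun i => [set` `[a i, a i + r]])) => i; exact: measurable_itv.
Qed.

(** The preimage of a dyadic cube of side s has diameter at most s / c, so its measure
    is at most c ^- n times that of the cube. *)
Lemma noncontracting_measure (D S : set E) (tau : E -> E) c :
  measurable D -> measurable_fun D tau -> 0 < c ->
  (forall x y, D x -> D y -> c * `|x - y| <= `|tau x - tau y|) ->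
  dyadic_open S -> ((c ^+ n)%:E * leb (D `&` tau @^-1` S) <= leb S)%E.
Proof.
move=> mD mtau c0 hc oS; apply: (dyadic_compare mD mtau) => //.
  by rewrite exprn_ge0 // ltW.
move=> k z; rewrite lebesgue_dyadic_cube.
have r0 : 0 <= 2 ^- k / c :> R by rewrite divr_ge0 ?invr_ge0 ?exprn_ge0 // ltW.
have -> : (2 ^- k) ^+ n = c ^+ n * (2 ^- k / c) ^+ n :> R.
  by rewrite -exprMn mulrCA mulfV ?gt_eqF // mulr1.
rewrite EFinM lee_pmul2l // ?lte_fin ?exprn_gt0 //.
apply: lebesgue_small_diameter => //.
  by apply: mtau => //; exact: measurable_dyadic_cube.
move=> x y [Dx xz] [Dy yz]; rewrite ler_pdivlMr // mulrC.
by apply: le_trans (hc _ _ Dx Dy) _; apply: dyadic_index_close; rewrite xz yz.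
Qed.

(** The previous bound, applied to the superlevel sets of F and summed over layers. The
    factor c ^+ n stands for a lower bound of the Jacobian of tau. *)
Lemma noncontracting_integral (D S : set E) (tau : E -> E) (F : E -> R) c :
  measurable D -> measurable_fun D tau -> 0 < c ->
  (forall x y, D x -> D y -> c * `|x - y| <= `|tau x - tau y|) ->
  (forall x, D x -> S (tau x)) -> (leb S < +oo)%E ->
  (forall s, dyadic_open [set x | S x /\ s < F x]) -> bmfun S F ->
  (forall x, S x -> 0 <= F x) ->
  [/\ (leb D < +oo)%E, bmfun D (F \o tau) &
      c ^+ n * (\int[leb]_(x in D) F (tau x)) <= \int[leb]_(x in S) F x].
Proof.
move=> mD mtau c0 hc DS fS oF [mF [M hM]] F0.
have cn0 : 0 < c ^+ n by rewrite exprn_gt0.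
have oS : dyadic_open S.
  move=> x Sx; have [|k hk] := @oF (F x - 1) x; first by rewrite /= ltrBlDr ltrDl ltr01.
  by exists k => y /hk [].
have mS := dyadic_open_measurable oS.
have DS' : D `&` tau @^-1` S = D by apply/seteqP; split => [x []|x Dx] //; split => //; exact: DS.
have fD : (leb D < +oo)%E.
  have := noncontracting_measure mD mtau c0 hc oS; rewrite DS' => h.
  have := le_lt_trans h fS; rewrite !ltey; apply: contra => /eqP ->.
  by rewrite mulry gtr0_sg // mul1e.
have bFt : bmfun D (F \o tau).
  split; last by exists M => x Dx; apply: hM; exact: DS.
  apply: (measurability _ (RGenOInfty.measurableE R)) => // /= _ [_ [s ->] <-].
  have -> : D `&` (F \o tau) @^-1` `]s, +oo[%classic = D `&` tau @^-1` [set x | S x /\ s < F x].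
    apply/seteqP; split => x /=; rewrite in_itv /= andbT.
      by move=> [Dx sF]; do !split => //; exact: DS.
    by move=> [Dx []].
  by apply: mtau => //; exact: dyadic_open_measurable.
split => //.
have bF : bmfun S F by split => //; exists M.
apply/ler_addgt0Pr => e e0.
pose M1 := `|M| + 1; have M10 : 0 < M1 by rewrite ltr_wpDl.
pose K := c ^+ n * fine (leb D) * M1 / e.
pose m := (Num.bound K).+1.
have m0 : (0 : R) < m%:R by rewrite ltr0n.
pose del := M1 / m%:R; have del0 : 0 < del by rewrite divr_gt0.
pose A k := [set x | S x /\ k.+1%:R * del < F x].
have mA k : measurable (A k) by apply: dyadic_open_measurable; exact: oF.
have mB k : measurable (D `&` tau @^-1` A k) by exact: mtau.
have FM x : S x -> F x <= m%:R * del.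
  move=> Sx; rewrite mulrC divfK ?gt_eqF //; apply: le_trans (ler_norm _) _.
  by apply: le_trans (hM x Sx) _; rewrite -[leLHS]addr0 lerD ?ler_norm.
have [bD bS] : (forall k, bmfun D (\1_(D `&` tau @^-1` A k) : E -> R)) /\
    (forall k, bmfun S (\1_(A k) : E -> R)).
  by split => k; [case: (bm_indic leb mD (mB k))|case: (bm_indic leb mS (mA k))].
have step1 : \int[leb]_(x in D) F (tau x) <=
    \int[leb]_(x in D) (del + \sum_(k < m) del * \1_(D `&` tau @^-1` A k) x).
  apply: bm_le => //.
    by apply: bmfunD; [exact: bmfun_cst|apply: bmfun_sum => k; apply: bmfunM => //; exact: bmfun_cst].
  move=> x Dx; have [] := layer_le m del0 (F0 _ (DS _ Dx)) => _ /(_ (FM _ (DS _ Dx))) h.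
  apply: le_trans h _; rewrite lerD2l; apply: ler_sum => k _.
  rewrite indicE ler_pM2l //; case: ifP => h; last by rewrite ler0n.
  by rewrite mem_set //; do !split => //; exact: DS.
have step2 : \int[leb]_(x in S) (\sum_(k < m) del * \1_(A k) x) <= \int[leb]_(x in S) F x.
  apply: bm_le => //.
    by apply: bmfun_sum => k; apply: bmfunM => //; exact: bmfun_cst.
  move=> x Sx; have [h _] := layer_le m del0 (F0 _ Sx); apply: le_trans h.
  apply: ler_sum => k _; rewrite indicE ler_pM2l //; case: ifP => h; first by rewrite lern1 leq_b1.
  by rewrite memNset // => -[_]; rewrite h.
have step3 k : c ^+ n * fine (leb ((D `&` tau @^-1` A k) `&` D)) <= fine (leb (A k `&` S)).
  rewrite setIAC setIid (_ : A k `&` S = A k); last by apply/seteqP; split => [x []|x []].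
  have lA : (leb (A k) < +oo)%E.
    by apply: le_lt_trans fS; apply: le_measure; rewrite ?inE // => x [].
  have lB : (leb (D `&` tau @^-1` A k) < +oo)%E.
    by apply: le_lt_trans fD; apply: le_measure; rewrite ?inE // => x [].
  have := noncontracting_measure mD mtau c0 hc (@oF (k.+1%:R * del)).
  by rewrite -[X in (_ * X)%E]fineK ?ge0_fin_numE // -[X in (_ <= X)%E]fineK ?ge0_fin_numE // -EFinM lee_fin.
apply: le_trans (_ : c ^+ n * (del * fine (leb D) +
   \sum_(k < m) del * fine (leb ((D `&` tau @^-1` A k) `&` D))) <= _).
  rewrite ler_pM2l //; apply: le_trans step1 _.
  rewrite bm_D //; last first.
  - by apply: bmfun_sum => k; apply: bmfunM => //; exact: bmfun_cst.
  - exact: bmfun_cst.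
  rewrite bm_cst // lerD2l bm_sum //; last by move=> k; apply: bmfunM => //; exact: bmfun_cst.
  apply: ler_sum => k _; rewrite bm_Z //.
  by have [_ ->] := bm_indic leb mD (mB k).
apply: le_trans (_ : e + \sum_(k < m) del * fine (leb (A k `&` S)) <= _).
  rewrite mulrDr; apply: lerD.
    rewrite /del; have Ke : K < m%:R by rewrite (lt_le_trans (archi_boundP _)) // ?ler_nat //; 
      rewrite /K divr_ge0 ?mulr_ge0 ?fine_ge0 ?measure_ge0 // ltW.
    rewrite mulrCA [X in X <= _]mulrC mulrA ler_pdivrMr //.
    by move: Ke; rewrite /K ltr_pdivrMr // => /ltW; rewrite [e * _]mulrC.
  rewrite mulr_sumr; apply: ler_sum => k _.
  by rewrite mulrCA ler_pM2l.
rewrite addrC lerD2r; apply: le_trans step2.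
rewrite bm_sum //; last by move=> k; apply: bmfunM => //; exact: bmfun_cst.
apply: ler_sum => k _; rewrite bm_Z //.
by have [_ ->] := bm_indic leb mS (mA k).
Qed.

Lemma open_superlevel (O : set E) (F : E -> R) s : open O ->
  (forall x, O x -> {for x, continuous F}) -> open [set x | O x /\ s < F x].
Proof.
move=> oO cF; rewrite openE => x /= [Ox sF].
have h1 : \forall y \near x, O y by exact: open_nbhs_nbhs.
have h2 : \forall y \near x, s < F y.
  exact: (cF x Ox _ (open_nbhs_nbhs (conj (@open_gt _ s) sF))).
by rewrite /interior; near=> y; split; near: y.
Unshelve. all: by end_near. Qed.

Lemma continuous_measurable_rV (O : set E) (F : E -> R) : open O ->
  (forall x, O x -> {for x, continuous F}) -> measurable_fun O F.
Proof.
move=> oO cF.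
apply: (measurability _ (RGenOInfty.measurableE R)) => // /= _ [_ [s ->] <-].
suff -> : O `&` F @^-1` `]s, +oo[%classic = [set x | O x /\ s < F x].
  by apply: open_measurable_rV; exact: open_superlevel.
by apply/seteqP; split => x /=; rewrite in_itv /= andbT.
Qed.

End noncontracting.

(** * Continuously differentiable functions *)

Section calculus.
Variables (R : realType) (n : nat).
Local Notation E := 'rV[R]_n.
Implicit Types (x y v : E) (w : E -> R).

Let line_quotient w x v (s : R) :
  (fun h : R => h^-1 *: (((fun t : R => w (x + t *: v)) \o shift s) (h *: (1 : R)) - w (x + s *: v)))
  = (fun h : R => h^-1 *: ((w \o shift (x + s *: v)) (h *: v) - w (x + s *: v))).
Proof.
apply/funext => h /=; congr (_ *: (w _ - _)).
by rewrite -[h *: 1]/(h * 1) mulr1 scalerDl addrCA.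
Qed.

Lemma is_derive_line w x v (s d : R) :
  is_derive (x + s *: v) v w d <-> is_derive s 1 (fun t : R => w (x + t *: v)) d.
Proof.
split=> -[dw vw]; split; rewrite ?/derivable ?/derive.
- by rewrite line_quotient.
- by rewrite line_quotient.
- by rewrite -line_quotient.
- by rewrite -line_quotient.
Qed.

Lemma is_derive_dirZ w x v (c d : R) :
  is_derive x v w d -> is_derive x (c *: v) w (c * d).
Proof.
move=> h; rewrite -[x]addr0 -(scale0r (c *: v)); apply/is_derive_line.
have h1 : is_derive (c * 0) 1 (fun t : R => w (x + t *: v)) d.
  by apply/is_derive_line; rewrite mulr0 scale0r addr0.
have h2 : is_derive (0 : R) 1 (fun t : R => c * t) c.
  have := @is_deriveZ R R R id c (0:R) 1 1 (is_derive_id _ _).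
  by rewrite -[c *: 1]/(c * 1) mulr1.
have := is_derive1_comp h1 h2; rewrite mulrC; congr (is_derive _ _ _ _).
by apply/funext => t /=; rewrite scalerA [c * t]mulrC.
Qed.

Lemma line_MVT w x v (dw : R -> R) :
  (forall s : R, 0 <= s <= 1 -> is_derive (x + s *: v) v w (dw s)) ->
  exists2 s : R, 0 < s < 1 & w (x + v) - w x = dw s.
Proof.
move=> h; have h' (s : R) : 0 <= s <= 1 -> is_derive s 1 (fun t : R => w (x + t *: v)) (dw s).
  by move=> s01; apply/is_derive_line; exact: h.
have [] := @MVT R (fun t => w (x + t *: v)) dw 0 1 ltr01.
- by move=> s; rewrite in_itv /= => /andP[a b]; apply: h'; rewrite !ltW.
- apply: derivable_within_continuous => s; rewrite in_itv /= => s01.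
  by have [] := h' s s01.
move=> s; rewrite in_itv /= => s01; rewrite scale1r scale0r addr0 subr0 mulr1 => ->.
by exists s.
Qed.

Definition C1on (O : set E) w := forall x, O x -> forall i,
  derivable w x (delta_mx ord0 i) /\ {for x, continuous (partial i w)}.

Let tr k v : E := \row_i (if (i < k)%N then v ord0 i else 0).

Let trS (k : 'I_n) v : tr k.+1 v = tr k v + v ord0 k *: delta_mx ord0 k.
Proof.
apply/rowP => i; rewrite !mxE eqxx /= ltnS leq_eqVlt val_eqE.
have [->|ik] /= := eqVneq i k; first by rewrite ltnn add0r mulr1.
by rewrite mulr0 addr0.
Qed.

Lemma tr_norm k v : `|tr k v| <= `|v|.
Proof.
apply: norm_le_coord => // i; rewrite mxE; case: ifP => _; first exact: coord_le_norm.
by rewrite normr0.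
Qed.

(** The increment along h v is split into increments along the axes, each of them handled
    by the mean value theorem and the continuity of one partial derivative. *)
Lemma C1_is_derive O w x v : open O -> C1on O w -> O x ->
  is_derive x v w (dot (grad w x) v).
Proof.
move=> oO cw Ox.
suff h : h^-1 *: ((w \o shift x) (h *: v) - w x) @[h --> (0:R)^'] --> dot (grad w x) v.
  by split; [apply/cvg_ex; eexists; exact: h|exact: cvg_lim h].
apply/cvgrPdist_le => e e0.
pose B := 1 + \sum_(k < n) `|v ord0 k|.
have B0 : 0 < B by rewrite ltr_pwDl // sumr_ge0.
have eB : 0 < e / B by rewrite divr_gt0.
have : \forall y \near x, O y /\ forall k, `|partial k w x - partial k w y| <= e / B.
  have h1 : \forall y \near x, O y by exact: open_nbhs_nbhs.
  have h2 : \forall y \near x, forall k, `|partial k w x - partial k w y| <= e / B.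
    apply: (@filter_forall E 'I_n (fun k y => `|partial k w x - partial k w y| <= e / B) (nbhs x)) => k; have [_ ck] := cw x Ox k.
    by have /cvgrPdist_le := ck; apply.
  by near=> y; split; near: y.
move/nbhs_ballP => [r /= r0 hr].
have hr' y : `|y - x| < r -> O y /\ forall k, `|partial k w x - partial k w y| <= e / B.
  by move=> yx; apply: hr; rewrite -ball_normE /= distrC.
have : \forall h \near (0:R)^', h != 0 /\ `|h| * (`|v| + `|v|) < r.
  near=> h; split; first by near: h; exact: nbhs_dnbhs_neq.
  have V0 : 0 < 1 + (`|v| + `|v|) by rewrite ltr_pwDl // addr_ge0.
  apply: le_lt_trans (_ : `|h| * (1 + (`|v| + `|v|)) < r).
    by rewrite ler_wpM2l // lerDr.
  rewrite -ltr_pdivlMr //; near: h; apply: dnbhs0_lt; exact: divr_gt0.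
apply: filterS => h [h0 hr0].
(* z k moves the first k coordinates only *)
pose z k := x + h *: tr k v.
have incr (k : 'I_n) : exists2 y, `|y - x| < r &
    w (z k.+1) - w (z k) = (h * v ord0 k) * partial k w y.
  have zk : z k.+1 = z k + (h * v ord0 k) *: delta_mx ord0 k.
    by rewrite /z trS scalerDr addrA scalerA.
  have yO (s : R) : 0 <= s <= 1 -> `|z k + s *: ((h * v ord0 k) *: delta_mx ord0 k) - x| < r.
    move=> /andP[s0 s1].
    apply: le_lt_trans hr0; rewrite /z addrAC [x + _]addrC addrK mulrDr.
    apply: le_trans (ler_normD _ _) _; rewrite normrZ; apply: lerD.
      by rewrite ler_wpM2l // tr_norm.
    rewrite !normrZ (ger0_norm s0).
    have d1 : `|delta_mx ord0 k : E| <= 1.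
      apply: norm_le_coord => // i; rewrite mxE eqxx /=.
      by case: eqP => _; rewrite ?normr1 ?normr0 ?ler01.
    apply: le_trans (_ : 1 * (`|h| * `|v ord0 k| * 1) <= _).
      by apply: ler_pM; rewrite ?mulr_ge0 // ler_wpM2l // mulr_ge0.
    by rewrite mul1r mulr1 ler_wpM2l // coord_le_norm.
  have [] := @line_MVT w (z k) ((h * v ord0 k) *: delta_mx ord0 k)
    (fun s => (h * v ord0 k) * partial k w (z k + s *: ((h * v ord0 k) *: delta_mx ord0 k))).
    move=> s s01; have [Oy _] := hr' _ (yO s s01); have [dy _] := cw _ Oy k.
    exact/is_derive_dirZ/derivableP.
  move=> s /andP[s0 s1]; rewrite -zk => ->.
  by exists (z k + s *: ((h * v ord0 k) *: delta_mx ord0 k)) => //; rewrite yO // !ltW.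
have /boolp.choice[p hp] : forall k : 'I_n, exists y, `|y - x| < r /\
    w (z k.+1) - w (z k) = (h * v ord0 k) * partial k w y.
  by move=> k; have [y yx e1] := incr k; exists y.
have tele : w (h *: v + x) - w x = \sum_(k < n) (w (z k.+1) - w (z k)).
  rewrite -(big_mkord xpredT (fun k => w (z k.+1) - w (z k))) telescope_sumr // /z.
  congr (w _ - w _).
    by rewrite addrC; congr (_ + _ *: _); apply/rowP => i; rewrite mxE ltn_ord.
  by rewrite (_ : tr 0 v = 0) ?scaler0 ?addr0 //; apply/rowP => i; rewrite !mxE.
rewrite /= tele scaler_sumr /dot -sumrB.
apply: le_trans (ler_norm_sum _ _ _) _.
apply: le_trans (_ : \sum_(k < n) (`|v ord0 k| * (e / B)) <= _).
  apply: ler_sum => k _; have [/hr'[_ hk] ->] := hp k.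
  rewrite mxE -[_ *: _]/(_ * _) -mulrA mulKf // [X in X - _]mulrC -mulrBr normrM.
  by rewrite ler_wpM2l.
rewrite -mulr_suml mulrCA; apply: ler_piMr; first exact: ltW.
rewrite ler_pdivrMr // mul1r /B.
by rewrite lerDr.
Unshelve. all: by end_near. Qed.

Lemma C1_MVT O w x v : open O -> C1on O w ->
  (forall s : R, 0 <= s <= 1 -> O (x + s *: v)) ->
  exists2 s : R, 0 < s < 1 & w (x + v) - w x = dot (grad w (x + s *: v)) v.
Proof.
move=> oO cw seg.
have [] := @line_MVT w x v (fun s => dot (grad w (x + s *: v)) v).
  by move=> s s01; apply: (C1_is_derive v oO cw); exact: seg.
by move=> s s01 ->; exists s.
Qed.

End calculus.

(** * Functions with a continuous extension to the closure *)

Section closure_extension.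
Variables (R : realType) (n : nat).
Local Notation E := 'rV[R]_n.
Implicit Types (x y v : E) (w h G : E -> R) (K Omega : set E).

Let nbhs_within K x : K x -> nbhs (x : subspace K) = within K (nbhs x).
Proof. by move=> Kx; case: (@nbhs_subspaceP _ K x). Qed.

Lemma within_continuousP K G : {within K, continuous G} <->
  (forall x, K x -> forall e, 0 < e -> exists2 r, 0 < r &
    forall y, K y -> `|y - x| < r -> `|G y - G x| < e).
Proof.
split.
  move=> cG x Kx e e0.
  have h : nbhs (x : subspace K) [set t | `|G x - G t| < e].
    by have /cvgrPdist_lt := cG x; apply.
  move: h; rewrite nbhs_within // => /nbhs_ballP[r /= r0 hr]; exists r => // y Ky yx.
  by rewrite distrC; apply: hr => //; rewrite -ball_normE /= distrC.
move=> h x; apply/cvgrPdist_lt => e e0.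
have [Kx|nKx] := pselect (K x); last first.
  suff : nbhs (x : subspace K) [set t | `|G x - G t| < e] by [].
  by case: (@nbhs_subspaceP _ K x) => // _ y ->; rewrite /= subrr normr0.
have [r r0 hr] := h x Kx e e0.
suff : nbhs (x : subspace K) [set t | `|G x - G t| < e] by [].
rewrite nbhs_within //; apply/nbhs_ballP; exists r => //= y.
by rewrite -ball_normE /= => xy Ky; rewrite distrC; apply: hr => //; rewrite distrC.
Qed.

Lemma compact_uniformly_continuous K G e : compact K -> {within K, continuous G} -> 0 < e ->
  exists2 r, 0 < r & forall x y, K x -> K y -> `|x - y| < r -> `|G x - G y| < e.
Proof.
move=> /compact_near_coveringP cK /within_continuousP cG e0.
pose P (r : R) x := forall y, K x -> K y -> `|x - y| < r -> `|G x - G y| < e.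
have : \forall r \near (0 : R)^'+, K `<=` P r.
  apply: cK => x Kx; have [r r0 hr] := cG x Kx _ (divr_gt0 e0 (ltr0n _ 2)).
  have h1 : \forall y \near x, `|y - x| < r / 2.
    apply/nbhs_ballP; exists (r / 2); first by rewrite /= divr_gt0.
    by move=> y; rewrite -ball_normE /= distrC.
  have h2 : \forall s \near (0:R)^'+, s < r / 2 by apply: nbhs_right_lt; rewrite divr_gt0.
  exists ([set y | `|y - x| < r / 2], [set s | s < r / 2]) => //= -[y s] /= [yx sr] z Ky Kz yz.
  have zx : `|z - x| < r.
    rewrite -(subrKA y) (le_lt_trans (ler_normD _ _)) // [r]splitr ltrD //.
    by rewrite distrC (lt_trans yz).
  have yx' : `|y - x| < r by rewrite (lt_trans yx) // ltr_pdivrMr // ltr_pMr // ltr1n.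
  rewrite -(subrKA (G x)) (le_lt_trans (ler_normD _ _)) // [e]splitr ltrD ?hr //.
  by rewrite distrC hr.
move=> h; have : \forall r \near (0 : R)^'+, 0 < r /\ K `<=` P r.
  by near=> r; split; near: r => //; exact: nbhs_right_gt.
by move=> /filter_ex[r [r0 hr]]; exists r => // x y Kx Ky; exact: hr.
Unshelve. all: by end_near. Qed.

Variables (Omega : set E).
Hypotheses (oO : open Omega) (bO : bounded_set Omega).

Lemma compact_closure : compact (closure Omega).
Proof.
apply: bounded_closed_compact; last exact: closed_closure.
have [M [_ hM]] := bO; exists (M + 2); split; first exact: num_real.
move=> B MB x; rewrite /closure /= => /(_ _ (nbhsx_ballx x 1 ltr01)) [y [Oy]].
rewrite -ball_normE /= => xy; have := hM (M + 1) _ y Oy; rewrite ltrDl => /(_ ltr01) yM.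
rewrite -(subrK y x) (le_trans (ler_normD _ _)) // (le_trans (lerD (ltW xy) yM)) //.
by apply: ltW; apply: le_lt_trans MB; lra.
Qed.

(** The partial derivatives of a function that is C1 up to the boundary are only known to
    have this property; being bounded, uniformly continuous and measurable, they can be
    integrated. *)
Definition extends_continuously h := exists2 G, {within closure Omega, continuous G} &
  forall x, Omega x -> h x = G x.

Local Notation ext := extends_continuously.

Lemma ext_bounded h : ext h -> exists M, forall x, Omega x -> `|h x| <= M.
Proof.
move=> [G cG hG]; have [->|/set0P[x0 Ox0]] := eqVneq Omega set0; first by exists 0.
have ne : closure Omega !=set0 by exists x0; exact: subset_closure.
have [c _ hc] := EVT_max_rV ne compact_closure cG.
have [d _ hd] := EVT_min_rV ne compact_closure cG.
exists (`|G c| + `|G d|) => x Ox; have xc : x \in closure Omega by apply/mem_set/subset_closure.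
have := hc x xc; have := hd x xc; rewrite hG // => h1 h2; rewrite ler_norml.
have := ler_norm (G c); have := ler_norm (- G d); rewrite normrN.
have := normr_ge0 (G c); have := normr_ge0 (G d); lra.
Qed.

Lemma ext_unif h e : ext h -> 0 < e ->
  exists2 r, 0 < r & forall x y, Omega x -> Omega y -> `|x - y| < r -> `|h x - h y| < e.
Proof.
move=> [G cG hG] e0; have [r r0 hr] := compact_uniformly_continuous compact_closure cG e0.
by exists r => // x y Ox Oy xy; rewrite !hG //; apply: hr => //; exact: subset_closure.
Qed.

Lemma ext_cont h x : ext h -> Omega x -> {for x, continuous h}.
Proof.
move=> eh Ox; apply/(@cvgrPdist_lt _ _ _ (nbhs x) _ h) => e e0; have [r r0 hr] := ext_unif eh e0.
have h1 : \forall y \near x, Omega y by exact: open_nbhs_nbhs.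
have h2 : \forall y \near x, `|x - y| < r.
  by apply/nbhs_ballP; exists r => //= y; rewrite -ball_normE.
by apply: filterS2 h1 h2 => y Oy xy; exact: hr.
Qed.

Lemma ext_measurable h : ext h -> measurable_fun Omega h.
Proof. by move=> eh; apply: continuous_measurable_rV => // x; exact: ext_cont. Qed.

Lemma ext_bm h : ext h -> bmfun Omega h.
Proof. by move=> eh; split; [exact: ext_measurable|exact: ext_bounded]. Qed.

Lemma ext_cst a : ext (fun=> a).
Proof.
exists (fun=> a) => //; apply/within_continuousP => x _ e e0; exists 1 => // y _ _.
by rewrite subrr normr0.
Qed.

Let closure_bounded G : {within closure Omega, continuous G} ->
  exists2 M, 0 < M & forall x, closure Omega x -> `|G x| <= M.
Proof.
move=> cG; have [cO0|/set0P ne] := eqVneq (closure Omega) set0.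
  by exists 1 => // x; rewrite cO0.
have [c _ hc] := EVT_max_rV ne compact_closure cG.
have [d _ hd] := EVT_min_rV ne compact_closure cG.
exists (1 + (`|G c| + `|G d|)); first by rewrite ltr_pwDl // addr_ge0.
move=> x /mem_set xc; have := hc x xc; have := hd x xc => h1 h2; rewrite ler_norml.
have := ler_norm (G c); have := ler_norm (- G d); rewrite normrN.
have := normr_ge0 (G c); have := normr_ge0 (G d); lra.
Qed.

Lemma ext_D h k : ext h -> ext k -> ext (fun x => h x + k x).
Proof.
move=> [G cG hG] [H cH hH]; exists (fun x => G x + H x); last by move=> x Ox; rewrite hG ?hH.
apply/within_continuousP => x Kx e e0.
have e2 : 0 < e / 2 by rewrite divr_gt0.
have [r r0 hr] := (iffLR (within_continuousP _ _) cG) x Kx _ e2.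
have [s s0 hs] := (iffLR (within_continuousP _ _) cH) x Kx _ e2.
exists (Num.min r s); first by rewrite lt_min r0.
move=> y Ky; rewrite lt_min => /andP[yr ys]; rewrite opprD addrACA.
by rewrite (le_lt_trans (ler_normD _ _)) // [e]splitr ltrD ?hr ?hs.
Qed.

Lemma ext_M h k : ext h -> ext k -> ext (fun x => h x * k x).
Proof.
move=> [G cG hG] [H cH hH]; exists (fun x => G x * H x); last by move=> x Ox; rewrite hG ?hH.
have [M M0 GM] := closure_bounded cG; have [L L0 HL] := closure_bounded cH.
apply/within_continuousP => x Kx e e0.
have e1 : 0 < e / 2 / L by rewrite !divr_gt0.
have e2 : 0 < e / 2 / M by rewrite !divr_gt0.
have [r r0 hr] := (iffLR (within_continuousP _ _) cG) x Kx _ e1.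
have [s s0 hs] := (iffLR (within_continuousP _ _) cH) x Kx _ e2.
exists (Num.min r s); first by rewrite lt_min r0.
move=> y Ky; rewrite lt_min => /andP[yr ys].
rewrite (_ : _ - _ = (G y - G x) * H y + G x * (H y - H x)); last by ring.
rewrite (le_lt_trans (ler_normD _ _)) // [e]splitr ltrD // normrM.
  by rewrite (le_lt_trans (ler_wpM2l _ (HL y Ky))) // -ltr_pdivlMr // hr.
by rewrite (le_lt_trans (ler_wpM2r _ (GM x Kx))) // mulrC -ltr_pdivlMr // hs.
Qed.

Lemma ext_N h : ext h -> ext (fun x => - h x).
Proof. by move=> eh; under eq_fun do rewrite -mulN1r; apply: ext_M => //; exact: ext_cst. Qed.

Lemma ext_sum I (r : seq I) (P : pred I) (h : I -> E -> R) :
  (forall i, ext (h i)) -> ext (fun x => \sum_(i <- r | P i) h i x).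
Proof.
move=> bh; elim: r => [|a r IH].
  by under eq_fun do rewrite big_nil; exact: ext_cst.
under eq_fun do rewrite big_cons.
by case: (P a) => //; exact: ext_D.
Qed.

Lemma eq_ext h k : (forall x, Omega x -> h x = k x) -> ext h -> ext k.
Proof. by move=> hk [G cG hG]; exists G => // x Ox; rewrite -hk ?hG. Qed.

Lemma closure_pos_lower (f : E -> R) : {within closure Omega, continuous f} ->
  (forall x, closure Omega x -> 0 < f x) ->
  exists2 c, 0 < c & forall x, closure Omega x -> c <= f x.
Proof.
move=> cf f0; have [cO0|/set0P ne] := eqVneq (closure Omega) set0.
  by exists 1 => // x; rewrite cO0.
have [d dO hd] := EVT_min_rV ne compact_closure cf.
by exists (f d); [apply/f0/set_mem|move=> x /mem_set; exact: hd].
Qed.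

Lemma ext_V (f : E -> R) : {within closure Omega, continuous f} ->
  (forall x, closure Omega x -> 0 < f x) -> {within closure Omega, continuous (fun x => (f x)^-1)}.
Proof.
move=> cf f0; have [c c0 hc] := closure_pos_lower cf f0.
apply/within_continuousP => x Kx e e0.
have e1 : 0 < e * (c * c) by rewrite !mulr_gt0.
have [r r0 hr] := (iffLR (within_continuousP _ _) cf) x Kx _ e1; exists r => // y Ky yx.
have fx := f0 x Kx; have fy := f0 y Ky.
rewrite (_ : _ - _ = - (f y - f x) / (f y * f x)); last by field; rewrite !gt_eqF.
rewrite normrM normrN normfV [X in _ / X]gtr0_norm ?mulr_gt0 // ltr_pdivrMr ?mulr_gt0 //.
by apply: lt_le_trans (hr y Ky yx) _; rewrite ler_pM2l // ler_pM ?hc // ltW.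
Qed.

End closure_extension.

(** * C1 functions up to the boundary *)

Section C1_closure.
Variables (R : realType) (n : nat).
Local Notation E := 'rV[R]_n.
Implicit Types (x y v : E) (w h : E -> R).
Variable (Omega : set E).
Hypotheses (oO : open Omega) (bO : bounded_set Omega).
Local Notation ext := (extends_continuously Omega).

Definition C1ext w := ext w /\ forall i, ext (partial i w) /\
  forall x, Omega x -> derivable w x (delta_mx ord0 i).

Lemma Ck1P w : Ck_closure Omega 1 w <-> {within closure Omega, continuous w} /\ C1ext w.
Proof.
split=> [[cw h]|[cw [ew h]]].
  split => //; split; first by exists w.
  move=> i; have [/= hi _] := h [:: i] isT; split => //.
  by have [_ /(_ isT)] := h [::] isT; exact.
split => // -[|i [|]] //= _; split.
- by exists w.
- by move=> _ i; have [_] := h i.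
- by have [] := h i.
- by rewrite ltnn.
Qed.

Lemma smooth_C1 w : smooth_closure Omega w -> C1ext w.
Proof. by move=> sw; have /Ck1P[] := sw 1%N. Qed.

Lemma smooth_C1_partial w i : smooth_closure Omega w -> C1ext (partial i w).
Proof.
move=> sw; have [_ h] := sw 2%N; split; first by have [] := h [:: i] isT.
move=> j; split; first by have [] := h [:: j; i] isT.
by have [_ /(_ isT)/(_ j)] := h [:: i] isT.
Qed.

Lemma C1ext_C1on w : C1ext w -> C1on Omega w.
Proof. by move=> [_ h] x Ox i; have [e d] := h i; split; [exact: d|exact: ext_cont e Ox]. Qed.

Let near_partial w h x i : Omega x -> (forall y, Omega y -> w y = h y) ->
  derivable w x (delta_mx ord0 i) ->
  derivable h x (delta_mx ord0 i) /\ partial i h x = partial i w x.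
Proof.
move=> Ox wh dw; have : is_derive x (delta_mx ord0 i) h (partial i w x).
  apply: near_eq_is_derive (derivableP dw).
  have : \forall y \near x, Omega y by exact: open_nbhs_nbhs.
  exact: filterS.
by move=> [].
Qed.

Lemma eq_C1ext w h : (forall x, Omega x -> w x = h x) -> C1ext w ->
  C1ext h /\ forall i x, Omega x -> partial i h x = partial i w x.
Proof.
move=> wh [ew dw]; have eq i x : Omega x -> partial i h x = partial i w x.
  by move=> Ox; have [_ /(_ x Ox) dx] := dw i; have [] := near_partial Ox wh dx.
split => //; split; first exact: eq_ext ew.
move=> i; have [e d] := dw i; split; first by apply: eq_ext e => x Ox; rewrite eq.
by move=> x Ox; have [] := near_partial Ox wh (d x Ox).
Qed.

Lemma C1ext_cst a : C1ext (fun=> a) /\ forall i x, partial i (fun=> a : R) x = 0.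
Proof.
have e i x : partial i (fun=> a : R) x = 0.
  by rewrite /partial; have [_ ->] := is_derive_cst (a : R) x (delta_mx ord0 i).
split => //; split; first exact: ext_cst.
move=> i; split; last by move=> x _; have [] := is_derive_cst (a : R) x (delta_mx ord0 i).
by rewrite (_ : partial i _ = fun=> 0); [exact: ext_cst|apply/funext].
Qed.

Lemma C1ext_D w h : C1ext w -> C1ext h -> C1ext (fun x => w x + h x) /\
  forall i x, Omega x -> partial i (fun x => w x + h x) x = partial i w x + partial i h x.
Proof.
move=> [ew dw] [eh dh].
have H i x : Omega x -> is_derive x (delta_mx ord0 i) (fun x => w x + h x) (partial i w x + partial i h x).
  move=> Ox; have [_ /(_ x Ox) /derivableP d1] := dw i; have [_ /(_ x Ox) /derivableP d2] := dh i.
  exact: is_deriveD.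
split; last by move=> i x Ox; have [] := H i x Ox.
split; first exact: ext_D.
move=> i; split; last by move=> x Ox; have [] := H i x Ox.
apply: eq_ext (ext_D (dw i).1 (dh i).1) => x Ox.
by have [_ <-] := H i x Ox.
Qed.

Lemma C1ext_M w h : C1ext w -> C1ext h -> C1ext (fun x => w x * h x) /\
  forall i x, Omega x -> partial i (fun x => w x * h x) x = w x * partial i h x + h x * partial i w x.
Proof.
move=> [ew dw] [eh dh].
have H i x : Omega x -> is_derive x (delta_mx ord0 i) (fun x => w x * h x) (w x * partial i h x + h x * partial i w x).
  move=> Ox; have [_ /(_ x Ox) /derivableP d1] := dw i; have [_ /(_ x Ox) /derivableP d2] := dh i.
  exact: is_deriveM.
split; last by move=> i x Ox; have [] := H i x Ox.
split; first exact: ext_M.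
move=> i; split; last by move=> x Ox; have [] := H i x Ox.
apply: (@eq_ext _ _ _ (fun x => w x * partial i h x + h x * partial i w x)).
  by move=> x Ox; have [_ <-] := H i x Ox.
by apply: ext_D => //; apply: ext_M => //; [exact: (dh i).1|exact: (dw i).1].
Qed.

Lemma C1ext_Z a w : C1ext w -> C1ext (fun x => a * w x) /\
  forall i x, Omega x -> partial i (fun x => a * w x) x = a * partial i w x.
Proof.
move=> cw; have [ca da] := C1ext_cst a; have [cm dm] := C1ext_M ca cw.
by split => // i x Ox; rewrite dm // da mulr0 addr0.
Qed.

Lemma C1ext_V w : {within closure Omega, continuous w} -> (forall x, closure Omega x -> 0 < w x) ->
  C1ext w -> C1ext (fun x => (w x)^-1) /\
  forall i x, Omega x -> partial i (fun x => (w x)^-1) x = - (w x) ^- 2 * partial i w x.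
Proof.
move=> cw w0 [ew dw].
have wx x : Omega x -> w x != 0 by move=> /subset_closure/w0 /gt_eqF ->.
have d i x : Omega x -> partial i (fun x => (w x)^-1) x = - (w x) ^- 2 * partial i w x.
  by move=> Ox; apply: deriveV; [exact: wx|exact: (dw i).2].
have ei : ext (fun x => (w x)^-1) by exists (fun x => (w x)^-1) => //; exact: ext_V.
split => //; split => // i; split; last first.
  by move=> x Ox; apply: derivableV; [exact: wx|exact: (dw i).2].
apply: (@eq_ext _ _ _ (fun x => - ((w x)^-1 * (w x)^-1) * partial i w x)).
  by move=> x Ox; rewrite d // expr2 invfM.
by apply: ext_M => //; [apply: ext_N => //; exact: ext_M|exact: (dw i).1].
Qed.

Lemma C1_grad_unif w e : C1ext w -> 0 < e -> exists2 r, 0 < r &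
  forall x y, Omega x -> Omega y -> `|x - y| < r -> forall i, `|partial i w x - partial i w y| < e.
Proof.
move=> [_ dw] e0.
have : \forall r \near (0 : R)^'+, forall i, forall x y, Omega x -> Omega y -> `|x - y| < r ->
   `|partial i w x - partial i w y| < e.
  apply: filter_forall => i; have [r r0 hr] := ext_unif bO (dw i).1 e0.
  have : \forall s \near (0:R)^'+, s < r by apply: nbhs_right_lt.
  by apply: filterS => s sr x y Ox Oy xy; apply: hr => //; exact: lt_trans sr.
move=> h; have : \forall r \near (0 : R)^'+, 0 < r /\ forall i, forall x y, Omega x -> Omega y -> `|x - y| < r ->
   `|partial i w x - partial i w y| < e.
  by near=> r; split; near: r => //; exact: nbhs_right_gt.
by move=> /filter_ex[r [r0 hr]]; exists r => // x y Ox Oy xy i; exact: hr.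
Unshelve. all: by end_near. Qed.

Hypothesis cO : convex_set (Omega : set (convex_lmodType E)).

Lemma convex_segment x y (t : R) : Omega x -> Omega y -> 0 <= t <= 1 ->
  Omega (x + t *: (y - x)).
Proof.
move=> Ox Oy /andP[t0 t1].
have := cO (Itv01 t0 t1) (mem_set Oy) (mem_set Ox) => /set_mem.
rewrite /conv /= /unstable.onem scalerBl scale1r addrC -addrA.
by rewrite scalerBr [- _ + _]addrC.
Qed.

Lemma bounded_diameter : exists2 B, 0 < B & forall x y, Omega x -> Omega y -> `|x - y| <= B.
Proof.
have [M [_ hM]] := bO; exists (1 + (`|M + 1| + `|M + 1|)); first by rewrite ltr_pwDl // addr_ge0.
move=> x y Ox Oy; apply: le_trans (ler_normB _ _) _.
have h z : Omega z -> `|z| <= `|M + 1|.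
  by move=> Oz; apply: le_trans (hM (M + 1) _ z Oz) (ler_norm _); rewrite ltrDl.
by apply: le_trans (lerD (h _ Ox) (h _ Oy)) _; rewrite lerDr.
Qed.

(** The increment along a segment is an average of derivatives along it. Riemann sums
    that are uniform in the endpoints replace the integral over the segment, so that later
    integrals over x and y are exchanged with finite sums only. *)
Lemma C1_riemann w e : C1ext w -> 0 < e -> exists m : nat,
  forall x y, Omega x -> Omega y ->
  `|w y - w x - m.+1%:R^-1 * \sum_(j < m.+1)
      dot (grad w (x + (j%:R / m.+1%:R) *: (y - x))) (y - x)| <= e.
Proof.
move=> cw e0; have [B B0 hB] := bounded_diameter.
have e1 : 0 < e / ((n%:R + 1) * B) by rewrite divr_gt0 // mulr_gt0 // ltr_wpDl // ler0n.
have [r r0 hr] := C1_grad_unif cw e1.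
pose m := Num.bound (B / r); exists m => x y Ox Oy.
have m0 : (0 : R) < m.+1%:R by rewrite ltr0n.
have mr : B / m.+1%:R < r.
  rewrite ltr_pdivrMr // mulrC -ltr_pdivrMr //.
  by apply: lt_le_trans (archi_boundP _) _; rewrite ?ler_nat // divr_ge0 // ltW.
pose v := y - x; pose z (s : R) := x + (s / m.+1%:R) *: v.
have zO s : 0 <= s <= m.+1%:R -> Omega (z s).
  move=> /andP[s0 s1]; apply: convex_segment => //.
  by apply/andP; split; [rewrite divr_ge0 // ltW|rewrite ler_pdivrMr // mul1r].
have step (j : 'I_m.+1) : `|w (z j.+1%:R) - w (z j%:R) - m.+1%:R^-1 * dot (grad w (z j%:R)) v| <= e / m.+1%:R.
  have zS (s : R) : z j%:R + s *: (m.+1%:R^-1 *: v) = z (j%:R + s).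
    by rewrite /z scalerA -addrA -scalerDl mulrDl.
  have jm : j%:R + 1 <= m.+1%:R :> R by rewrite natr1 ler_nat.
  have [] := @C1_MVT R n Omega w (z j%:R) (m.+1%:R^-1 *: v) oO (C1ext_C1on cw).
    move=> s /andP[s0 s1]; rewrite zS; apply: zO.
    by rewrite addr_ge0 ?ler0n //= (le_trans _ jm) // lerD2l.
  move=> s /andP[s0 s1]; rewrite -{1}[m.+1%:R^-1 *: v]scale1r !zS natr1 => ->.
  have -> : dot (grad w (z (j%:R + s))) (m.+1%:R^-1 *: v) = m.+1%:R^-1 * dot (grad w (z (j%:R + s))) v.
    by rewrite /dot mulr_sumr; apply: eq_bigr => i _; rewrite !mxE mulrCA.
  have mi0 : 0 <= m.+1%:R^-1 :> R by rewrite invr_ge0 ltW.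
  rewrite -mulrBr normrM (ger0_norm mi0) [e / _]mulrC; apply: ler_wpM2l => //.
  rewrite /dot -sumrB; apply: le_trans (ler_norm_sum _ _ _) _.
  apply: le_trans (_ : \sum_(i < n) (e / ((n%:R + 1) * B) * B) <= _).
    apply: ler_sum => i _; rewrite !mxE -mulrBl normrM; apply: ler_pM => //; last first.
      by rewrite -[y ord0 i - x ord0 i]/_; have := coord_le_norm v i; rewrite !mxE => /le_trans; apply; exact: hB.
    apply/ltW/hr.
    - by apply: zO; rewrite addr_ge0 ?ler0n ?(ltW s0) //= (le_trans _ jm) // lerD2l ltW.
    - by apply: zO; rewrite ler0n (le_trans _ jm) // lerDl.
    rewrite /z opprD addrACA subrr add0r -scalerBl normrZ -mulrBl addrAC subrr add0r.
    rewrite normrM !ger0_norm ?invr_ge0 ?ler0n ?(ltW s0) //; apply: le_lt_trans mr.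
    rewrite mulrAC ler_pM2r ?invr_gt0 //; apply: le_trans (_ : 1 * B <= _); last by rewrite mul1r.
    by apply: ler_pM; rewrite ?(ltW s0) ?(ltW s1) // hB.
  rewrite sumr_const card_ord -[leLHS]mulr_natl.
  have n1 : (0 : R) < n%:R + 1 by rewrite ltr_wpDl // ler0n.
  have -> : e / ((n%:R + 1) * B) * B = e / (n%:R + 1).
    by field; rewrite !gt_eqF.
  rewrite mulrCA; apply: ler_piMr; first exact: ltW.
  by rewrite ler_pdivrMr // mul1r lerDl.
have -> : w y - w x = \sum_(j < m.+1) (w (z j.+1%:R) - w (z j%:R)).
  rewrite -(big_mkord xpredT (fun j => w (z j.+1%:R) - w (z j%:R))) (telescope_sumr (fun j => w (z j%:R))) // /z.
  by rewrite divff ?gt_eqF // scale1r mul0r scale0r addr0 /v [x + (y - x)]addrC subrK.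
rewrite mulr_sumr -sumrB; apply: le_trans (ler_norm_sum _ _ _) _.
apply: le_trans (ler_sum _ (fun j _ => step j)) _.
by rewrite sumr_const card_ord -[leLHS]mulr_natr divfK ?gt_eqF.
Qed.

End C1_closure.

(** * The Poincare inequality on convex sets *)

Section dot_product.
Variables (R : realType) (n : nat).
Local Notation E := 'rV[R]_n.
Implicit Types (x y v : E).

Lemma dotC x y : dot x y = dot y x.
Proof. by apply: eq_bigr => i _; rewrite mulrC. Qed.

Lemma dotDl x y v : dot (x + y) v = dot x v + dot y v.
Proof. by rewrite /dot -big_split; apply: eq_bigr => i _; rewrite mxE mulrDl. Qed.

Lemma dotZl a x y : dot (a *: x) y = a * dot x y.
Proof. by rewrite /dot mulr_sumr; apply: eq_bigr => i _; rewrite mxE mulrA. Qed.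

Lemma dotDr x y v : dot v (x + y) = dot v x + dot v y.
Proof. by rewrite dotC dotDl !(dotC v). Qed.

Lemma dotZr a x y : dot x (a *: y) = a * dot x y.
Proof. by rewrite dotC dotZl dotC. Qed.

Lemma dotNl x y : dot (- x) y = - dot x y.
Proof. by rewrite -scaleN1r dotZl mulN1r. Qed.

Lemma dotBl x y v : dot (x - y) v = dot x v - dot y v.
Proof. by rewrite dotDl dotNl. Qed.

Lemma dotBr x y v : dot v (x - y) = dot v x - dot v y.
Proof. by rewrite dotC dotBl !(dotC v). Qed.

Lemma dot_ge0 x : 0 <= dot x x.
Proof. by apply: sumr_ge0 => i _; rewrite -expr2 sqr_ge0. Qed.

Lemma dot_eq0 x : dot x x = 0 -> x = 0.
Proof.
move=> /eqP; rewrite psumr_eq0; last by move=> i _; rewrite -expr2 sqr_ge0.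
move=> /allP h; apply/rowP => i; rewrite mxE.
by have := h i (mem_index_enum i); rewrite -expr2 sqrf_eq0 => /eqP.
Qed.

Lemma cauchy_schwarz_dot x y : dot x y ^+ 2 <= dot x x * dot y y.
Proof.
have [/dot_eq0 ->|x0] := eqVneq (dot x x) 0.
  by rewrite -(scale0r 0) !dotZl !mul0r expr0n.
have xp : 0 < dot x x by rewrite lt_neqAle eq_sym x0 dot_ge0.
have := dot_ge0 (dot x x *: y - dot x y *: x).
rewrite dotBl !dotBr !dotZl !dotZr (dotC y x) => h.
rewrite -(ler_pM2l xp); lra.
Qed.

Lemma enorm_ge0 x : 0 <= enorm x.
Proof. exact: sqrtr_ge0. Qed.

Lemma enorm_sqr x : enorm x ^+ 2 = dot x x.
Proof. by rewrite /enorm sqr_sqrtr // dot_ge0. Qed.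

Lemma dot_le_enorm x y : dot x y <= enorm x * enorm y.
Proof.
have h : `|dot x y| <= enorm x * enorm y.
  rewrite -(ler_pXn2r (_ : 0 < 2)%N) ?nnegrE ?mulr_ge0 ?enorm_ge0 //.
  by rewrite -normrX ger0_norm ?sqr_ge0 // exprMn !enorm_sqr cauchy_schwarz_dot.
exact: le_trans (ler_norm _) h.
Qed.

Lemma dot_norm_le x : dot x x <= n%:R * `|x| ^+ 2.
Proof.
apply: le_trans (_ : \sum_(i < n) `|x| ^+ 2 <= _); last first.
  by rewrite sumr_const card_ord mulr_natl.
apply: ler_sum => i _; rewrite -expr2 -real_normK ?num_real //.
by rewrite ler_pXn2r ?nnegrE // coord_le_norm.
Qed.

End dot_product.

Lemma jensen_sqr (R : realFieldType) m (a : 'I_m.+1 -> R) :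
  (m.+1%:R^-1 * \sum_j a j) ^+ 2 <= m.+1%:R^-1 * \sum_j a j ^+ 2.
Proof.
have m0 : (0 : R) < m.+1%:R by rewrite ltr0n.
set A := m.+1%:R^-1 * _.
have : 0 <= \sum_j (a j - A) ^+ 2 by apply: sumr_ge0 => j _; exact: sqr_ge0.
under eq_bigr do rewrite sqrrB.
rewrite big_split sumrB /= sumr_const card_ord -[_ *+ m.+1]mulr_natl sumrMnl -mulr_suml.
have -> : \sum_j a j = m.+1%:R * A by rewrite /A mulrA divff ?gt_eqF // mul1r.
move=> h; rewrite mulrC ler_pdivlMr //.
move: h; rewrite -mulr_natl; nra.
Qed.

Section measurable_maps.
Variables (R : realType) (n : nat).
Local Notation E := 'rV[R]_n.

Lemma measurable_affine (a : R) (b : E) : measurable_fun setT (fun y : E => a *: y + b).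
Proof.
apply: measurable_fun_rV => i.
have -> : rV_coord i \o (fun y : E => a *: y + b) = (fun y => a * rV_coord i y + b ord0 i).
  by apply/funext => y; rewrite /rV_coord /= !mxE.
apply: measurable_funD; last exact: measurable_cst.
by apply: measurable_funM; [exact: measurable_cst|exact: measurable_rV_coord].
Qed.

Lemma measurable_midpoint : measurable_fun setT (fun z : E * E => 2^-1 *: (z.1 + z.2)).
Proof.
apply: measurable_fun_rV => i.
have -> : rV_coord i \o (fun z : E * E => 2^-1 *: (z.1 + z.2)) =
    (fun z => 2^-1 * ((@rV_coord R n i \o fst) z + (@rV_coord R n i \o snd) z)).
  by apply/funext => y; rewrite /rV_coord /= !mxE.
apply: measurable_funM; first exact: measurable_cst.
apply: measurable_funD; apply: measurableT_comp; try exact: measurable_rV_coord.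
- exact: measurable_fst.
- exact: measurable_snd.
Qed.

End measurable_maps.

Section local_poincare.
Variables (R : realType) (n : nat).
Local Notation E := 'rV[R]_n.
Local Notation leb := (lebesgue_rV R n).
Variable (Omega : set E).
Hypotheses (oO : open Omega) (bO : bounded_set Omega).
Hypothesis cO : convex_set (Omega : set (convex_lmodType E)).
Hypothesis fO : (leb Omega < +oo)%E.
Variable w : E -> R.
Hypothesis cw : C1ext Omega w.

Definition grad2 (w : E -> R) (x : E) : R := dot (grad w x) (grad w x).

Lemma ext_grad2 (h : E -> R) : C1ext Omega h -> extends_continuously Omega (grad2 h).
Proof.
move=> [_ dh]; apply: ext_sum => i.
by under eq_fun do rewrite mxE; apply: ext_M => //; exact: (dh i).1.
Qed.

Variables (D : set E) (delta : R).
Hypotheses (DO : D `<=` Omega) (oD : dyadic_open D).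
Hypothesis cD : forall x y (t : R), D x -> D y -> 0 <= t <= 1 -> D (x + t *: (y - x)).
Hypothesis dD : forall x y, D x -> D y -> `|x - y| <= delta.

Let mD : measurable D. Proof. exact: dyadic_open_measurable. Qed.

Let fD : (leb D < +oo)%E.
Proof.
apply: le_lt_trans fO; apply: le_measure; rewrite ?inE //; exact: open_measurable_rV.
Qed.

Lemma bmfun_sub (h : E -> R) : bmfun Omega h -> bmfun D h.
Proof.
move=> [mh [M hM]]; split; last by exists M => x /DO; exact: hM.
exact: measurable_funS (open_measurable_rV oO) DO mh.
Qed.

Let bw : bmfun D w.
Proof. by apply: bmfun_sub; apply: ext_bm => //; case: cw. Qed.

Let bg : bmfun D (grad2 w).
Proof. by apply: bmfun_sub; apply: ext_bm => //; exact: ext_grad2. Qed.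

Let mid (x y : E) : E := y + 2^-1 *: (x - y).

Let midE x y : mid x y = 2^-1 *: y + 2^-1 *: x.
Proof.
by apply/rowP => i; rewrite /mid !mxE; lra.
Qed.

(** For t <= 1 / 2, the map y |-> (1 - t) y + t x multiplies distances by at least 1 / 2
    and maps D to itself. *)
Lemma integral_grad2_along x (t : R) : D x -> 0 <= t <= 2^-1 ->
  bmfun D (fun y => grad2 w (y + t *: (x - y))) /\
  (2^-1) ^+ n * (\int[leb]_(y in D) grad2 w (y + t *: (x - y))) <= \int[leb]_(y in D) grad2 w y.
Proof.
move=> Dx /andP[t0 t1].
pose tau (y : E) := (1 - t) *: y + t *: x.
have tauE y : tau y = y + t *: (x - y).
  by rewrite /tau scalerBl scale1r scalerBr addrA addrAC.
have [||||||//|||_ b1 b2] := @noncontracting_integral R n D D tau (grad2 w) 2^-1.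
- exact: mD.
- by apply: measurable_funTS; exact: measurable_affine.
- by [].
- move=> y z _ _; rewrite /tau opprD addrACA subrr addr0 -scalerBr normrZ.
  rewrite ler_wpM2r // ger0_norm; lra.
- by move=> y Dy; rewrite tauE; apply: cD => //; lra.
- exact: fD.
- move=> s.
  have -> : [set y | D y /\ s < grad2 w y] = D `&` [set y | Omega y /\ s < grad2 w y].
    by apply/seteqP; split => y /= [Dy]; [move=> ?; do !split => //; exact: DO|move=> []].
  apply: dyadic_openI => //; apply: open_dyadic_open; apply: open_superlevel => //.
  by move=> y Oy; apply: ext_cont Oy => //; exact: ext_grad2.
- exact: bg.
- by move=> y _; exact: dot_ge0.
split; first by apply: eq_bmfun b1 => y _; rewrite /= tauE.
by under [X in _ * X <= _]bm_eq do rewrite -tauE.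
Qed.

Let bm_mid x : D x -> bmfun D (fun y => w (mid x y)).
Proof.
move=> Dx; have Dmid y : D y -> D (mid x y) by move=> Dy; apply: cD => //; lra.
split; last by have [_ [M hM]] := bw; exists M => y Dy; apply/hM/Dmid.
under eq_fun do rewrite midE.
apply: (@measurable_comp _ _ _ _ _ _ D w D (fun y => 2^-1 *: y + 2^-1 *: x)) => //.
- by move=> _ [y Dy <-]; rewrite -midE; exact: Dmid.
- by case: bw.
- by apply: measurable_funTS; exact: measurable_affine.
Qed.

(** Only the half of the segment on the side of y is used: on it the maps in
    integral_grad2_along multiply distances by at least 1 / 2. *)
Lemma mid_poincare x : D x ->
  \int[leb]_(y in D) (w (mid x y) - w y) ^+ 2 <=
  2 * n%:R * delta ^+ 2 * 2 ^+ n * \int[leb]_(y in D) grad2 w y.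
Proof.
move=> Dx; have half01 : 0 <= (2^-1 : R) <= 1 by lra.
have Dmid y : D y -> D (mid x y) by move=> Dy; exact: cD.
have bmid := bm_mid Dx.
set G := \int[leb]_(y in D) grad2 w y.
have bL : bmfun D (fun y => (w (mid x y) - w y) ^+ 2) by apply: bmfunX; exact: bmfunB.
apply/ler_addgt0Pr => e e0.
pose F := fine (leb D); have F0 : 0 <= F by rewrite fine_ge0.
have e1 : 0 < Num.min 1 (e / (2 * F + 1)).
  by rewrite lt_min ltr01 divr_gt0 // ltr_wpDl // mulr_ge0.
have [m hm] := C1_riemann oO bO cO cw e1.
set eta := Num.min _ _ in e1 hm.
have eta2 : 2 * eta ^+ 2 * F <= e.
  have h1 : eta ^+ 2 <= e / (2 * F + 1).
    rewrite expr2; apply: le_trans (_ : 1 * (e / (2 * F + 1)) <= _); last by rewrite mul1r.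
    by apply: ler_pM; [exact: ltW|exact: ltW|rewrite ge_min lexx|rewrite ge_min lexx orbT].
  apply: le_trans (_ : 2 * (e / (2 * F + 1)) * F <= _); first by rewrite ler_wpM2r // ler_wpM2l.
  have F1 : 0 < 2 * F + 1 by rewrite ltr_wpDl // mulr_ge0.
  by rewrite mulrAC mulrA ler_pdivrMr //; nra.
have m0 : (0 : R) < m.+1%:R by rewrite ltr0n.
have tj (j : 'I_m.+1) : 0 <= (j%:R / m.+1%:R / 2 : R) <= 2^-1.
  have j1 : j%:R / m.+1%:R <= 1 :> R by rewrite ler_pdivrMr // mul1r ler_nat ltnW.
  have j0 : 0 <= j%:R / m.+1%:R :> R by rewrite divr_ge0.
  by move: j0 j1; set q := _ / m.+1%:R; lra.
have pointwise y : D y -> (w (mid x y) - w y) ^+ 2 <= 2 * eta ^+ 2 +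
    (2 * n%:R * delta ^+ 2) * (m.+1%:R^-1 * \sum_(j < m.+1) grad2 w (y + (j%:R / m.+1%:R / 2) *: (x - y))).
  move=> Dy; have := hm y (mid x y) (DO Dy) (DO (Dmid y Dy)).
  have -> : mid x y - y = 2^-1 *: (x - y) by rewrite /mid addrC addKr.
  set s := m.+1%:R^-1 * _ => hs.
  have hs2 : s ^+ 2 <= n%:R * delta ^+ 2 * (m.+1%:R^-1 * \sum_(j < m.+1) grad2 w (y + (j%:R / m.+1%:R / 2) *: (x - y))).
    apply: le_trans (jensen_sqr _) _; rewrite mulrCA ler_pM2l ?invr_gt0 //.
    rewrite mulr_sumr; apply: ler_sum => j _; rewrite scalerA.
    apply: le_trans (cauchy_schwarz_dot _ _) _; rewrite mulrC; apply: ler_wpM2r; first exact: dot_ge0.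
    rewrite dotZl dotZr mulrA; apply: le_trans (_ : 1 * dot (x - y) (x - y) <= _).
      by apply: ler_wpM2r; [exact: dot_ge0|lra].
    rewrite mul1r; apply: le_trans (dot_norm_le _) _; rewrite ler_wpM2l ?ler0n //.
    have := dD Dx Dy; have := normr_ge0 (x - y); nra.
  have : `|w (mid x y) - w y - s| ^+ 2 <= eta ^+ 2.
    by have := normr_ge0 (w (mid x y) - w y - s); nra.
  rewrite real_normK ?num_real // => hd.
  move: hs2 hd; set X := m.+1%:R^-1 * _; set p := w _ - w y => hs2 hd.
  have hp : p ^+ 2 <= 2 * (p - s) ^+ 2 + 2 * s ^+ 2.
    by have := sqr_ge0 (p - 2 * s); nra.
  have -> : 2 * n%:R * delta ^+ 2 * X = 2 * (n%:R * delta ^+ 2 * X) by ring.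
  by move: hs2; set Z := n%:R * _ * X; lra.
apply: le_trans (_ : \int[leb]_(y in D) (2 * eta ^+ 2 +
    (2 * n%:R * delta ^+ 2) * (m.+1%:R^-1 * \sum_(j < m.+1) grad2 w (y + (j%:R / m.+1%:R / 2) *: (x - y)))) <= _).
  apply: bm_le => //.
  apply: bmfunD; first exact: bmfun_cst.
  apply: bmfunM; first exact: bmfun_cst.
  apply: bmfunM; first exact: bmfun_cst.
  by apply: bmfun_sum => j; have [] := integral_grad2_along Dx (tj j).
have bsum : bmfun D (fun y => \sum_(j < m.+1) grad2 w (y + (j%:R / m.+1%:R / 2) *: (x - y))).
  by apply: bmfun_sum => j; have [] := integral_grad2_along Dx (tj j).
have bmsum := bmfunM (bmfun_cst D m.+1%:R^-1) bsum.
rewrite bm_D //; [|exact: bmfun_cst|by apply: bmfunM => //; exact: bmfun_cst].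
rewrite bm_cst //; rewrite (bm_Z mD fD _ bmsum) (bm_Z mD fD _ bsum) bm_sum //; last by move=> j; have [] := integral_grad2_along Dx (tj j).
rewrite addrC; apply: lerD; last by rewrite -/F.
rewrite -[leRHS]mulrA; apply: ler_wpM2l.
  by apply: mulr_ge0; [rewrite mulr_ge0 ?ler0n|exact: sqr_ge0].
rewrite mulrC ler_pdivrMr //.
apply: le_trans (_ : \sum_(j < m.+1) (2 ^+ n * G) <= _); last by rewrite sumr_const card_ord mulr_natr.
apply: ler_sum => j _; have [_] := integral_grad2_along Dx (tj j).
by rewrite exprVn ler_pdivrMl ?exprn_gt0.
Qed.

Let iter_indic (h : E -> E -> R) :
  (\int[leb]_x \int[leb]_y (h x y * \1_D x * \1_D y)%:E =
   \int[leb]_(x in D) \int[leb]_(y in D) (h x y)%:E)%E.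
Proof.
rewrite [RHS]integral_mkcond; apply: eq_integral => x _; rewrite patchE.
case: ifPn => xD; last first.
  by rewrite integral0_eq // => y _; rewrite !indicE (negbTE xD) mulr0 mul0r.
rewrite [RHS]integral_mkcond; apply: eq_integral => y _; rewrite patchE !indicE xD mulr1.
by case: ifPn; rewrite ?mulr1 // mulr0.
Qed.

Let indic_mid (z : E * E) : E := 2^-1 *: (z.1 + z.2).

Let midz (x y : E) : indic_mid (x, y) = mid x y.
Proof. by rewrite midE /indic_mid /= scalerDr addrC. Qed.

(** The integral over D x D of (w x - w y)^2 is twice the variance. Both w x and w y are
    compared with the value of w at the midpoint, by mid_poincare and symmetry. *)
Lemma local_poincare :
  fine (leb D) * \int[leb]_(x in D) (w x) ^+ 2 <=
  (\int[leb]_(x in D) w x) ^+ 2 +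
  4 * n%:R * delta ^+ 2 * 2 ^+ n * fine (leb D) * \int[leb]_(x in D) grad2 w x.
Proof.
set A := \int[leb]_(x in D) w x; set B := \int[leb]_(x in D) (w x) ^+ 2.
set G := \int[leb]_(x in D) grad2 w x; set V := fine (leb D).
have [K KE] : exists K, K = 2 * n%:R * delta ^+ 2 * 2 ^+ n * G by eexists.
have VE : leb D = V%:E by rewrite /V fineK // ge0_fin_numE.
have bw2 : bmfun D (fun x => w x ^+ 2) by exact: bmfunX.
pose wD : E -> R := w \_ D.
have mwD : measurable_fun setT wD by apply/(measurable_restrictT _ mD); case: bw.
have m1D : measurable_fun setT (\1_D : E -> R) by exact: measurable_indic.
(* F and F' are the two halves and H the whole; they are set to 0 outside D x D, so
   that Fubini applies on the whole space *)
pose F (z : E * E) : \bar R := ((wD (indic_mid z) - wD z.2) ^+ 2 * \1_D z.1 * \1_D z.2)%:E.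
pose F' (z : E * E) : \bar R := ((wD (indic_mid z) - wD z.1) ^+ 2 * \1_D z.2 * \1_D z.1)%:E.
pose H (z : E * E) : \bar R := ((wD z.1 - wD z.2) ^+ 2 * \1_D z.1 * \1_D z.2)%:E.
have mmid : measurable_fun setT (wD \o indic_mid).
  by apply: measurableT_comp => //; exact: measurable_midpoint.
have mf (g : E -> R) : measurable_fun setT g ->
    measurable_fun setT (fun z : E * E => g z.1).
  by move=> mg; apply: (measurableT_comp mg); exact: measurable_fst.
have ms (g : E -> R) : measurable_fun setT g ->
    measurable_fun setT (fun z : E * E => g z.2).
  by move=> mg; apply: (measurableT_comp mg); exact: measurable_snd.
have mF : measurable_fun setT F.
  apply/measurable_EFinP; apply: measurable_funM; last exact: ms.
  apply: measurable_funM; last exact: mf.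
  by apply: measurable_funX; apply: measurable_funB => //; exact: ms.
have mF' : measurable_fun setT F'.
  apply/measurable_EFinP; apply: measurable_funM; last exact: mf.
  apply: measurable_funM; last exact: ms.
  by apply: measurable_funX; apply: measurable_funB => //; exact: mf.
have mH : measurable_fun setT H.
  apply/measurable_EFinP; apply: measurable_funM; last exact: ms.
  apply: measurable_funM; last exact: mf.
  by apply: measurable_funX; apply: measurable_funB; [exact: mf|exact: ms].
have pos (a : R) x y : (0 <= (a ^+ 2 * \1_D x * \1_D y)%:E)%E.
  by rewrite lee_fin; apply: mulr_ge0; [apply: mulr_ge0; [exact: sqr_ge0|]|]; rewrite indicE ler0n.
have F0 z : (0 <= F z)%E by exact: pos.
have F'0 z : (0 <= F' z)%E by exact: pos.
have H0 z : (0 <= H z)%E by exact: pos.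
have FK : (\int[leb]_x \int[leb]_y F (x, y) <= (K * V)%:E)%E.
  have -> : (\int[leb]_x \int[leb]_y F (x, y) =
      \int[leb]_(x in D) \int[leb]_(y in D) ((wD (mid x y) - wD y) ^+ 2)%:E)%E.
    by rewrite -iter_indic; apply: eq_integral => x _; apply: eq_integral => y _; rewrite /F midz.
  apply: le_trans (_ : \int[leb]_(x in D) (cst K%:E x) <= _)%E; last first.
    by rewrite integral_cst // EFinM -VE.
  apply: ge0_le_integral => //.
  - by move=> x _; apply: integral_ge0 => y _; rewrite lee_fin sqr_ge0.
  - have mFF : measurable_fun D (fubini_F leb F).
      by apply: measurable_funTS; exact: measurable_fun_fubini_tonelli_F.
    apply: eq_measurable_fun mFF => x xD.
    rewrite /fubini_F [RHS]integral_mkcond; apply: eq_integral => y _.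
    rewrite patchE /F midz !indicE xD mulr1.
    by case: ifPn; rewrite ?mulr1 // mulr0.
  move=> x Dx; have e y : D y -> (wD (mid x y) - wD y) ^+ 2 = (w (mid x y) - w y) ^+ 2.
    move=> Dy; rewrite /wD !patchE !mem_set //; apply: cD => //; lra.
  have -> : (\int[leb]_(y in D) ((wD (mid x y) - wD y) ^+ 2)%:E =
      \int[leb]_(y in D) ((w (mid x y) - w y) ^+ 2)%:E)%E.
    by apply: eq_integral => y /set_mem Dy; rewrite e.
  rewrite bmfun_integralE //; first by rewrite lee_fin KE mid_poincare.
  by apply: bmfunX; apply: bmfunB => //; exact: bm_mid.
have F'F : (\int[leb \x leb]_z F' z = \int[leb]_x \int[leb]_y F (x, y))%E.
  rewrite (fubini_tonelli2 F' mF' F'0).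
  apply: eq_integral => x _; apply: eq_integral => y _.
  by rewrite /F /F' /= /indic_mid /= [y + x]addrC.
have HFF : (\int[leb \x leb]_z H z <= (4 * (K * V))%:E)%E.
  apply: le_trans (_ : \int[leb \x leb]_z (2%:E * F z + 2%:E * F' z) <= _)%E.
    apply: ge0_le_integral => //.
    - by apply: emeasurable_funD; apply: measurable_funeM.
    move=> [x y] _; rewrite /F /F' /H /= -!EFinM -EFinD lee_fin.
    rewrite !indicE; case: (x \in D); case: (y \in D); rewrite ?mulr0 ?mul0r ?mulr0 ?addr0 // !mulr1.
    by have := sqr_ge0 (2 * wD (indic_mid (x, y)) - wD x - wD y); nra.
  rewrite ge0_integralD //; [|by move=> z _; rewrite mule_ge0| |by move=> z _; rewrite mule_ge0|].
  - rewrite !ge0_integralZl // F'F (fubini_tonelli1 F mF F0).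
    have -> : ((4 * (K * V))%:E = 2%:E * (K * V)%:E + 2%:E * (K * V)%:E)%E.
      by rewrite -!EFinM -EFinD; congr EFin; ring.
    by apply: leeD; rewrite lee_pmul2l // lte_fin.
  - exact: measurable_funeM.
  - exact: measurable_funeM.
have HE : (\int[leb \x leb]_z H z = (2 * (V * B - A ^+ 2))%:E)%E.
  rewrite (fubini_tonelli1 H mH H0).
  have -> : (\int[leb]_x fubini_F leb H x =
      \int[leb]_(x in D) \int[leb]_(y in D) ((wD x - wD y) ^+ 2)%:E)%E.
    by rewrite -iter_indic; apply: eq_integral => x _; apply: eq_integral => y _.
  have -> : (\int[leb]_(x in D) \int[leb]_(y in D) ((wD x - wD y) ^+ 2)%:E =
     \int[leb]_(x in D) (V * w x ^+ 2 - 2 * A * w x + B)%:E)%E.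
    apply: eq_integral => x /set_mem Dx.
    have -> : (\int[leb]_(y in D) ((wD x - wD y) ^+ 2)%:E =
        \int[leb]_(y in D) (w x ^+ 2 - 2 * w x * w y + w y ^+ 2)%:E)%E.
      apply: eq_integral => y /set_mem Dy; congr EFin.
      by rewrite /wD !patchE !mem_set //; ring.
    have b1 : bmfun D (fun y => 2 * w x * w y) by apply: bmfunM => //; exact: bmfun_cst.
    have b2 : bmfun D (fun y => w x ^+ 2 - 2 * w x * w y) by apply: bmfunB => //; exact: bmfun_cst.
    rewrite bmfun_integralE //; last exact: bmfunD.
    congr EFin; rewrite bm_D // bm_B //; last exact: bmfun_cst.
    by rewrite bm_cst // bm_Z // -/V -/A -/B; ring.
  have b1 : bmfun D (fun x => V * w x ^+ 2) by apply: bmfunM => //; exact: bmfun_cst.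
  have b2 : bmfun D (fun x => 2 * A * w x) by apply: bmfunM => //; exact: bmfun_cst.
  have b3 := bmfunB b1 b2.
  have b4 := bmfun_cst D B.
  rewrite bmfun_integralE //; last exact: bmfunD.
  by congr EFin; rewrite bm_D // bm_B // bm_cst // !bm_Z // -/V -/A -/B; ring.
move: HFF; rewrite HE lee_fin KE => h.
have -> : 4 * n%:R * delta ^+ 2 * 2 ^+ n * V * G = 2 * (2 * n%:R * delta ^+ 2 * 2 ^+ n * G * V) by ring.
by move: h; set Z := 2 * n%:R * _ * _ * G * V; lra.
Qed.

End local_poincare.

(** * The Rellich compactness theorem *)

Lemma itv_convex (R : realFieldType) (a b x y t : R) : a <= x < b -> a <= y < b ->
  0 <= t <= 1 -> a <= x + t * (y - x) < b.
Proof.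
move=> /andP[ax xb] /andP[ay yb] /andP[t0 t1]; apply/andP; split; first nra.
have [->|t0'] := eqVneq t 0; first by rewrite mul0r addr0.
have tp : 0 < t by rewrite lt_neqAle eq_sym t0'.
have h1 : 0 < t * (b - y) by rewrite mulr_gt0 // subr_gt0.
have h2 : 0 <= (1 - t) * (b - x) by rewrite mulr_ge0 // subr_ge0 // ltW.
nra.
Qed.

Section cells.
Variables (R : realType) (n : nat).
Local Notation E := 'rV[R]_n.
Local Notation leb := (lebesgue_rV R n).
Variable (Omega : set E).
Hypotheses (oO : open Omega) (bO : bounded_set Omega).
Hypothesis cO : convex_set (Omega : set (convex_lmodType E)).

Lemma bounded_finite_measure : (leb Omega < +oo)%E.
Proof.
have [B B0 hB] := bounded_diameter bO.
apply: le_lt_trans (lebesgue_small_diameter (open_measurable_rV oO) (ltW B0) hB) _.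
exact: ltry.
Qed.

Local Notation fO := bounded_finite_measure.

Lemma global_poincare : exists2 C, 0 <= C & forall w, C1ext Omega w ->
  fine (leb Omega) * \int[leb]_(x in Omega) (w x) ^+ 2 <=
  (\int[leb]_(x in Omega) w x) ^+ 2 +
  C * fine (leb Omega) * \int[leb]_(x in Omega) grad2 w x.
Proof.
have [B B0 hB] := bounded_diameter bO.
exists (4 * n%:R * B ^+ 2 * 2 ^+ n); first by rewrite !mulr_ge0 ?exprn_ge0 // ltW.
move=> w cw; apply: (@local_poincare R n Omega oO bO cO fO w cw Omega B) => //.
- exact: open_dyadic_open.
- by move=> x y t; exact: convex_segment.
Qed.

Let cell k L m (z : {ffun 'I_n -> 'I_m}) : set E :=
  Omega `&` dyadic_cube k [ffun i => (z i)%:Z - L%:Z].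

Let cell_cover k : exists L m, forall x, Omega x ->
  exists z : {ffun 'I_n -> 'I_m}, cell k L z x.
Proof.
have [M [_ hM]] := bO; pose B := 2 ^+ k * `|M + 1|.
have p0 : (0 : R) < 2 ^+ k by rewrite exprn_gt0.
have B0 : 0 <= B by rewrite mulr_ge0 // ltW.
pose L := Num.bound B; exists L, (L + L).+1 => x Ox.
have xB i : `|2 ^+ k * x ord0 i| <= B.
  rewrite normrM gtr0_norm // ler_pM2l //; apply: le_trans (coord_le_norm _ _) _.
  by apply: le_trans (hM (M + 1) _ x Ox) (ler_norm _); rewrite ltrDl.
have BL : B < L%:R by exact: archi_boundP.
have fl i : (0 <= Num.floor (2 ^+ k * x ord0 i)%R + L%:Z <= (L + L)%:Z)%R.
  have := xB i; rewrite ler_norml => /andP[x1 x2]; apply/andP; split.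
    rewrite -lerBlDr sub0r floor_ge_int mulrNz.
    by apply: le_trans x1; rewrite lerN2 ltW.
  rewrite PoszD lerD2r -(ler_int R); apply: le_trans (floor_le _) _.
  by apply: le_trans x2 (ltW BL).
exists [ffun i => inord (absz (Num.floor (2 ^+ k * x ord0 i) + L%:Z))].
split => //; apply/ffunP => i; rewrite !ffunE; have /andP[f0 f1] := fl i.
rewrite inordK; first by rewrite gez0_abs // addrK.
by rewrite ltnS -lez_nat gez0_abs.
Qed.

Lemma Rintegral_cells (J : finType) (D : J -> set E) h :
  (forall j, measurable (D j)) -> (forall j, D j `<=` Omega) ->
  (forall x, Omega x -> exists j, D j x) ->
  (forall i j x, D i x -> D j x -> i = j) -> bmfun Omega h ->
  \int[leb]_(x in Omega) h x = \sum_j \int[leb]_(x in D j) h x.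
Proof.
move=> mD DO cov disj bh; have mO := open_measurable_rV oO.
have e j : \int[leb]_(x in D j) h x = \int[leb]_(x in Omega) (h x * \1_(D j) x).
  have {1}-> : D j = Omega `&` D j.
    by apply/seteqP; split => [x Dx|x []] //; split => //; exact: (DO j).
  rewrite Rintegral_mkcondr; apply: bm_eq => x Ox.
  by rewrite patchE indicE; case: ifPn; rewrite ?mulr1 ?mulr0.
have b1 j : bmfun Omega (fun x => h x * \1_(D j) x).
  by apply: bmfunM => //; case: (bm_indic leb mO (mD j)).
rewrite (eq_bigr _ (fun j _ => e j)) -bm_sum //; last exact: fO.
apply: bm_eq => x Ox; have [j Dj] := cov x Ox.
rewrite (bigD1 j) //= big1 ?addr0 ?indicE ?mem_set ?mulr1 // => i ij.
by rewrite indicE memNset ?mulr0 // => /disj /(_ Dj) eij; rewrite eij eqxx in ij.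
Qed.

(** Cut Omega along a fine dyadic grid and apply local_poincare in each cell: up to a
    small multiple of the energy, the L2 norm is controlled by finitely many means. *)
Lemma precompact_cells eta : 0 < eta -> exists (J : finType) (D : J -> set E) (c : J -> R),
  [/\ forall j, measurable (D j) /\ D j `<=` Omega, forall j, 0 <= c j &
   forall w, C1ext Omega w ->
   \int[leb]_(x in Omega) (w x) ^+ 2 <= \sum_j c j * (\int[leb]_(x in D j) w x) ^+ 2 +
     eta * \int[leb]_(x in Omega) grad2 w x].
Proof.
move=> eta0; pose C : R := 4 * n%:R * 2 ^+ n + 1.
have C0 : 0 < C by rewrite /C ltr_wpDl // !mulr_ge0 ?exprn_ge0.
have e1 : 0 < Num.min 1 (eta / C) by rewrite lt_min ltr01 divr_gt0.
have [k hk] := small_dyadic e1.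
have kd : C * (2 ^- k) ^+ 2 <= eta.
  have k0 : 0 <= 2 ^- k :> R by rewrite invr_ge0 exprn_ge0.
  move: hk; rewrite lt_min => /andP[h1 h2].
  rewrite mulrC -ler_pdivlMr //; apply: le_trans (ltW h2).
  by rewrite expr2; apply: ler_piMr => //; exact: ltW.
have [L [m cov]] := cell_cover k.
pose J := {ffun 'I_n -> 'I_m}.
pose D (j : J) := cell k L j.
have DO j : D j `<=` Omega by move=> x [].
have oD j : dyadic_open (D j).
  by apply: dyadic_openI; [exact: open_dyadic_open|exact: dyadic_cube_open].
have mD j : measurable (D j) by exact: dyadic_open_measurable.
have disj i j x : D i x -> D j x -> i = j.
  move=> [_ xi] [_]; rewrite /dyadic_cube /= xi => /ffunP h; apply/ffunP => a.
  by have := h a; rewrite !ffunE => /addIr [] /val_inj.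
exists J, D, (fun j => (fine (leb (D j)))^-1); split => [j|j|w cw].
- by split.
- by rewrite invr_ge0 fine_ge0.
have bw : bmfun Omega w by apply: ext_bm => //; case: cw.
have bg : bmfun Omega (grad2 w) by apply: ext_bm => //; exact: ext_grad2.
rewrite (Rintegral_cells mD DO cov disj (bmfunX 2 bw)) (Rintegral_cells mD DO cov disj bg).
rewrite mulr_sumr -big_split; apply: ler_sum => j _ /=.
have fD : (leb (D j) < +oo)%E.
  by apply: le_lt_trans fO; apply: le_measure; rewrite ?inE //; exact: open_measurable_rV.
have G0 : 0 <= \int[leb]_(x in D j) grad2 w x by apply: Rintegral_ge0 => x _; exact: dot_ge0.
(* on a null cell the coefficient is 0 and the integral vanishes *)
have [V0|V0] := eqVneq (fine (leb (D j))) 0.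
  have [_ [M hM]] := bw.
  rewrite V0 invr0 mul0r add0r; apply: le_trans (_ : \int[leb]_(x in D j) (M ^+ 2) <= _).
    apply: bm_le => //; [apply: bmfunX; exact: (bmfun_sub oO (DO j))|exact: bmfun_cst|].
    move=> x /DO /hM; rewrite -[w x ^+ 2]real_normK ?num_real //.
    by have := normr_ge0 (w x); nra.
  by rewrite bm_cst // V0 mulr0; apply: mulr_ge0 => //; exact: ltW.
have Vp : 0 < fine (leb (D j)) by rewrite lt_neqAle eq_sym V0 fine_ge0.
have := @local_poincare R n Omega oO bO cO fO w cw (D j) (2 ^- k) (DO j) (oD j) _ _.
set V := fine _ in V0 Vp *; set X := \int[leb]_(x in D j) (w x) ^+ 2.
set G := \int[leb]_(x in D j) grad2 w x in G0 *; set A := \int[leb]_(x in D j) w x.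
move=> h; have {}h : V * X <= A ^+ 2 + 4 * n%:R * (2 ^- k) ^+ 2 * 2 ^+ n * V * G.
  apply: h.
  - move=> x y t [Ox xc] [Oy yc] t01; split; first exact: convex_segment.
    move: xc yc; rewrite !dyadic_cubeE /= => xc yc i; have := xc i; have := yc i.
    by rewrite !in_itv /= !mxE => yi xi; exact: itv_convex.
  - by move=> x y [_ xc] [_ yc]; apply: dyadic_index_close; rewrite xc yc.
rewrite -(ler_pM2l Vp); apply: le_trans h _.
rewrite mulrDr [V * (_ * _)]mulrA (_ : V * _ = 1) ?mul1r ?lerD2l; last by rewrite /V mulfV.
rewrite (_ : 4 * _ * _ * _ * V * G = V * (4 * n%:R * 2 ^+ n * (2 ^- k) ^+ 2 * G)); last by ring.
rewrite ler_pM2l //; apply: ler_wpM2r => //; apply: le_trans kd.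
by apply: ler_wpM2r; [exact: sqr_ge0|rewrite /C lerDl].
Qed.

End cells.

Section precompact.
Variables (R : realType) (n : nat).
Local Notation E := 'rV[R]_n.
Local Notation leb := (lebesgue_rV R n).
Variable (Omega : set E).
Hypotheses (oO : open Omega) (bO : bounded_set Omega).
Hypothesis cO : convex_set (Omega : set (convex_lmodType E)).

(** Along an ultrafilter all bounded sequences converge, which replaces repeated extraction
    of subsequences. *)
Lemma ultra_bounded_cvg (U : set_system nat) (a : nat -> R) (B : R) :
  UltraFilter U -> (forall k, `|a k| <= B) -> exists p, forall e, 0 < e ->
  U [set k | `|p - a k| < e].
Proof.
move=> UU aB; have cB := @segment_compact R (- B) B.
have [] := cB (a @ U) _ _.
  by apply: (@filterE _ U) => k; rewrite /= in_itv /= -ler_norml.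
move=> p [_ ap]; exists p => e e0.
have [//|nU] := @in_ultra_setVsetC _ U [set k | `|p - a k| < e] UU.
have pe : nbhs p (ball p e) by exact: nbhsx_ballx.
have nU' : (a @ U) (~` ball p e) by apply: filterS nU => k /= h; rewrite -ball_normE; exact: h.
have [y hy] := ap _ _ nU' pe.
by case: hy.
Qed.

Lemma diff_sqr_le (w h : E -> R) M : C1ext Omega w -> C1ext Omega h ->
  \int[leb]_(x in Omega) grad2 w x <= M -> \int[leb]_(x in Omega) grad2 h x <= M ->
  C1ext Omega (fun x => w x - h x) /\
  \int[leb]_(x in Omega) grad2 (fun x => w x - h x) x <= 4 * M.
Proof.
move=> cw ch wM hM; have fO := bounded_finite_measure oO bO; have mO := open_measurable_rV oO.
have [cNh dNh] := C1ext_Z bO (-1) ch; have [cd dd] := C1ext_D cw cNh.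
have e x : w x + -1 * h x = w x - h x by rewrite mulN1r.
have [c d] := eq_C1ext oO (fun x _ => e x) cd; split => //.
have b1 : bmfun Omega (grad2 w) by apply: ext_bm => //; exact: ext_grad2.
have b2 : bmfun Omega (grad2 h) by apply: ext_bm => //; exact: ext_grad2.
have b3 : bmfun Omega (grad2 (fun x => w x - h x)) by apply: ext_bm => //; exact: ext_grad2.
apply: le_trans (_ : \int[leb]_(x in Omega) (2 * grad2 w x + 2 * grad2 h x) <= _).
  apply: bm_le => //; first by apply: bmfunD; apply: bmfunM => //; exact: bmfun_cst.
  move=> x Ox; rewrite /grad2 /dot !mulr_sumr -big_split /=; apply: ler_sum => i _.
  rewrite !mxE d // dd // dNh //; set p := partial i w x; set q := partial i h x.
  by rewrite -subr_ge0 (_ : _ - _ = (p + q) ^+ 2) ?sqr_ge0 //; ring.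
rewrite bm_D //; [|by apply: bmfunM => //; exact: bmfun_cst|by apply: bmfunM => //; exact: bmfun_cst].
rewrite !bm_Z // (_ : 4 * M = 2 * M + 2 * M); last by ring.
by apply: lerD; rewrite ler_pM2l.
Qed.

(** Along an ultrafilter the finitely many means in precompact_cells converge, so the
    sequence is Cauchy in L2; a subsequence then converges at any prescribed speed. *)
Lemma rellich (phi : nat -> E -> R) (M : R) :
  (forall k, C1ext Omega (phi k)) ->
  (forall k, \int[leb]_(x in Omega) (phi k x) ^+ 2 <= M) ->
  (forall k, \int[leb]_(x in Omega) grad2 (phi k) x <= M) ->
  forall eps : nat -> R, (forall i, 0 < eps i) ->
  exists s : nat -> nat, (forall i, (i <= s i)%N) /\
  forall i j, (i <= j)%N ->
    \int[leb]_(x in Omega) (phi (s i) x - phi (s j) x) ^+ 2 <= eps i.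
Proof.
move=> cphi L2 H1 eps eps0.
have fO := bounded_finite_measure oO bO; have mO := open_measurable_rV oO.
have [U [UU oU]] := @ultraFilterLemma nat \oo _.
have bphi k : bmfun Omega (phi k) by apply: ext_bm => //; case: (cphi k).
have M0 : 0 <= M by apply: le_trans (L2 0%N); apply: Rintegral_ge0 => x _; exact: sqr_ge0.
(* U contains sets on which the sequence varies arbitrarily little in L2 *)
have near eta : 0 < eta -> exists2 S, U S & forall k l, S k -> S l ->
    \int[leb]_(x in Omega) (phi k x - phi l x) ^+ 2 <= eta.
  move=> eta0; have e1 : 0 < eta / 2 / (4 * M + 1) by rewrite !divr_gt0 // ltr_wpDl // mulr_ge0.
  have [J [D [c [mD c0 hJ]]]] := precompact_cells oO bO cO e1.
  pose Sc := 1 + \sum_j c j.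
  have Sc0 : 0 < Sc by rewrite ltr_pwDl // sumr_ge0.
  pose tau := Num.min 1 (eta / (8 * Sc)).
  have tau0 : 0 < tau by rewrite lt_min ltr01 divr_gt0 // mulr_gt0.
  have bD j k : bmfun (D j) (phi k) by have [_ DO] := mD j; exact: (bmfun_sub oO DO).
  have fD j : (leb (D j) < +oo)%E.
    have [mDj DO] := mD j.
    by apply: le_lt_trans fO; apply: le_measure; rewrite ?inE.
  have lB j k : `|\int[leb]_(x in D j) phi k x| <= fine (leb Omega) + M.
    have [mDj DO] := mD j; have fDj := fD j.
    have bO1 : bmfun Omega (fun x => 1 + (phi k x) ^+ 2) by apply: bmfunD; [exact: bmfun_cst|exact: bmfunX].
    apply: le_trans (_ : \int[leb]_(x in D j) (1 + (phi k x) ^+ 2) <= _).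
      apply: bm_norm_le; [exact: mDj|exact: fD|exact: bD|exact: (bmfun_sub oO DO bO1)|].
      move=> x _; rewrite -[phi k x ^+ 2]real_normK ?num_real //.
      by have := sqr_ge0 (`|phi k x| - 1); have := normr_ge0 (phi k x); nra.
    apply: le_trans (_ : \int[leb]_(x in Omega) (1 + (phi k x) ^+ 2) <= _).
      rewrite -lee_fin -!bmfun_integralE //; last exact: (bmfun_sub oO DO).
      apply: ge0_subset_integral => //.
      - by apply/measurable_EFinP; case: bO1.
      - by move=> x _; rewrite lee_fin addr_ge0 // sqr_ge0.
    rewrite bm_D //; [|exact: bmfun_cst|exact: bmfunX].
    by rewrite bm_cst // mul1r lerD2l.
  have /boolp.choice[p hp] : forall j, exists p, forall e, 0 < e ->
      U [set k | `|p - \int[leb]_(x in D j) phi k x| < e].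
    by move=> j; apply: ultra_bounded_cvg => k; exact: lB.
  exists [set k | forall j, `|p j - \int[leb]_(x in D j) phi k x| < tau].
    by apply: filter_forall => j; exact: hp.
  move=> k l Sk Sl; have [cd gd] := diff_sqr_le (cphi k) (cphi l) (H1 k) (H1 l).
  apply: le_trans (hJ _ cd) _.
  rewrite [leRHS]splitr; apply: lerD; last first.
    apply: le_trans (_ : eta / 2 / (4 * M + 1) * (4 * M) <= _).
      by apply: ler_wpM2l => //; exact: ltW.
    rewrite -mulrA; apply: ler_piMr; first by rewrite divr_ge0 // ltW.
    by rewrite mulrC ler_pdivrMr ?mul1r ?lerDl ?ler01 // ltr_wpDl // mulr_ge0.
  apply: le_trans (_ : \sum_j c j * (4 * (eta / (8 * Sc))) <= _).
    apply: ler_sum => j _; apply: ler_wpM2l => //.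
    rewrite (bm_B (mD j).1 (fD j) (bD j k) (bD j l)).
    have := Sk j; have := Sl j; set a := \int[leb]_(x in _) _; set b := \int[leb]_(x in _) _.
    move=> hb ha; have t1 : tau ^+ 2 <= eta / (8 * Sc).
      rewrite expr2; apply: le_trans (_ : 1 * (eta / (8 * Sc)) <= _); last by rewrite mul1r.
      by apply: ler_pM; [exact: ltW|exact: ltW|rewrite ge_min lexx|rewrite ge_min lexx orbT].
    have : `|a - b| <= 2 * tau.
      by move: ha hb; rewrite !ltr_norml => /andP[? ?] /andP[? ?]; rewrite ler_norml; lra.
    move=> ab; rewrite -[_ ^+ 2]real_normK ?num_real //.
    apply: le_trans (_ : (2 * tau) ^+ 2 <= _).
      by rewrite distrC !expr2; apply: ler_pM.
    by rewrite exprMn -natrX ler_pM2l.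
  rewrite -mulr_suml (_ : 4 * _ = eta / 2 / Sc); last by field; rewrite gt_eqF.
  rewrite mulrCA; apply: ler_piMr; first by rewrite divr_ge0 // ltW.
  by rewrite ler_pdivrMr // mul1r /Sc lerDr.
have /boolp.choice[S hS] : forall i, exists S, U S /\ forall k l, S k -> S l ->
    \int[leb]_(x in Omega) (phi k x - phi l x) ^+ 2 <= eps i.
  by move=> i; have [S US hS] := near _ (eps0 i); exists S.
have /boolp.choice[s hs] : forall i, exists k, (i <= k)%N /\ forall j, (j <= i)%N -> S j k.
  move=> i; have : U [set k | (i <= k)%N /\ forall j : 'I_i.+1, S j k].
    apply: filterI; first by apply: oU; exact: nbhs_infty_ge.
    by apply: filter_forall => j; case: (hS j).
  move=> /filter_ex[k [ik hk]]; exists k; split => // j ji.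
  by have := hk (Ordinal (ji : (j < i.+1)%N)).
exists s; split => [i|i j ij]; first by case: (hs i).
have [_ h] := hS i; apply: h; first by have [_] := hs i; apply.
by have [_] := hs j; apply.
Qed.

End precompact.

(** * Completeness of L2 *)

Section riesz_fischer.
Context d (T : measurableType d) (R : realType).
Variables (m : {measure set T -> \bar R}) (D : set T).
Hypotheses (mD : measurable D) (fD : (m D < +oo)%E).

(** The series of the increments converges absolutely almost everywhere, since its
    integral is finite; Fatou bounds the distance to the pointwise limit. *)
Lemma riesz_fischer (h : nat -> T -> R) :
  (forall i, bmfun D (h i)) ->
  (forall i j, (i <= j)%N -> \int[m]_(x in D) (h i x - h j x) ^+ 2 <= (4^-1) ^+ i) ->
  exists2 g : T -> R, measurable_fun D g &
    forall i, (\int[m]_(x in D) ((h i x - g x) ^+ 2)%:E <= ((4^-1) ^+ i)%:E)%E.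
Proof.
move=> bh hh; pose a i x := `|h i.+1 x - h i x|.
have ba i : bmfun D (a i) by apply: bmfun_norm; exact: bmfunB.
have ma i : measurable_fun D (EFin \o a i) by apply/measurable_EFinP; case: (ba i).
have a0 i x : D x -> (0 <= (EFin \o a i) x)%E by move=> _; rewrite lee_fin normr_ge0.
pose V := fine (m D); have V0 : 0 <= V by rewrite fine_ge0.
have Ia i : \int[m]_(x in D) a i x <= (2^-1) ^+ i * (V + 1).
  have p0 : 0 < (2^-1 : R) ^+ i by rewrite exprn_gt0.
  apply: le_trans (_ : \int[m]_(x in D) ((2^-1) ^+ i + 2 ^+ i * (h i x - h i.+1 x) ^+ 2) <= _).
    apply: bm_le => //.
      apply: bmfunD; first exact: bmfun_cst.
      by apply: bmfunM; [exact: bmfun_cst|apply: bmfunX; exact: bmfunB].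
    move=> x Dx; rewrite /a -[(h i x - _) ^+ 2]real_normK ?num_real // distrC.
    set t := `|_|; have -> : 2 ^+ i = ((2^-1) ^+ i)^-1 :> R by rewrite exprVn invrK.
    set p := _ ^+ i in p0 *; rewrite -(ler_pM2l p0) mulrDr mulrA divff ?gt_eqF // mul1r.
    have t0 : 0 <= t by exact: normr_ge0.
    have tp : 0 <= p * t by apply: mulr_ge0 => //; exact: ltW.
    by have := sqr_ge0 (p - t); nra.
  have b1 : bmfun D (fun x => (h i x - h i.+1 x) ^+ 2) by apply: bmfunX; exact: bmfunB.
  rewrite bm_D //; [|exact: bmfun_cst|by apply: bmfunM => //; exact: bmfun_cst].
  rewrite bm_cst // bm_Z // mulrDr mulr1 lerD2l.
  apply: le_trans (_ : 2 ^+ i * (4^-1) ^+ i <= _).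
    by apply: ler_wpM2l; [rewrite exprn_ge0|exact: hh].
  by rewrite -exprMn (_ : 2 * 4^-1 = 2^-1) //; lra.
pose S x := (\sum_(0 <= i <oo) (a i x)%:E)%E.
have S0 x : (0 <= S x)%E by apply: nneseries_ge0 => i _ _; rewrite lee_fin normr_ge0.
have mS : measurable_fun D S.
  by apply: (@ge0_emeasurable_sum _ T R D (fun i => EFin \o a i) xpredT) => // i x Dx _; exact: a0.
have IS : (\int[m]_(x in D) S x < +oo)%E.
  rewrite /S (integral_nneseries m mD ma a0).
  apply: le_lt_trans (_ : (\sum_(0 <= i <oo) (2 * (V + 1) / (2 ^ (i + 1))%:R)%:E) < _)%E.
    apply: lee_nneseries => [i _ _|i _]; first by apply: integral_ge0 => x; exact: a0.
    rewrite bmfun_integralE // lee_fin (le_trans (Ia i)) // natrX addn1 exprS exprVn.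
    by rewrite invfM mulrACA mulfV // mul1r mulrC.
  by rewrite (cvg_lim _ (@cvg_geometric_eseries_half R (2 * (V + 1)) 0)) // ltry.
(* the null set where the increments are not summable *)
pose N := D `&` S @^-1` [set +oo%E].
have mN : measurable N by apply: mS => //; exact: emeasurable_set1.
have N0 : m N = 0.
  have iS : m.-integrable D S.
    apply/integrableP; split => //; apply: le_lt_trans IS.
    apply: ge0_le_integral => //; first exact: measurableT_comp.
    by move=> x _; rewrite gee0_abs.
  apply: measure_negligible => //; apply: negligibleS (integrable_ae mD iS) => x [Dx Sx] /=.
  by move=> /(_ Dx); rewrite Sx.
pose D' := D `\` N.
have mD' : measurable D' by exact: measurableD.
have cvgh x : D' x -> cvgn (h ^~ x).
  move=> [Dx Nx].
  have Sx : (S x < +oo)%E.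
    by rewrite ltey; apply/eqP => Sx; apply: Nx.
  have : cvgn [normed series (telescope (h ^~ x))].
    apply: nondecreasing_is_cvgn.
      by apply: nondecreasing_series => i _ _; exact: normr_ge0.
    exists (fine (S x)) => _ [k _ <-].
    rewrite -lee_fin fineK; last by rewrite ge0_fin_numE.
    rewrite /series /= -sumEFin; apply: nneseries_lim_ge => i _.
    by rewrite lee_fin normr_ge0.
  move=> /normed_cvg/cvg_ex[l hl]; apply/cvg_ex; exists (h 0%N x + l).
  have -> : h ^~ x = (fun k => h 0%N x + series (telescope (h ^~ x)) k).
    by apply/funext => k; rewrite -eq_sum_telescope.
  by apply: cvgD => //; exact: cvg_cst.
pose g x := if x \in D' then limn (h ^~ x) else 0.
have hg x : D' x -> h k x @[k --> \oo] --> g x.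
  by move=> D'x; rewrite /g mem_set //; exact: cvgh.
have mg : measurable_fun D g.
  have D'D : D' `<=` D by move=> x [].
  have h1 : measurable_fun D' g.
    apply: (measurable_fun_cvg (h := h)) => // k.
    by apply: measurable_funS D'D _ => //; case: (bh k).
  have -> : D = D' `|` N.
    apply/seteqP; split => x; last by move=> [[]|[]].
    by move=> Dx; have [Nx|Nx] := pselect (N x); [right|left].
  apply/measurable_funU => //; split => //.
  have m0 : measurable_fun N (fun=> 0 : R) by exact: measurable_cst.
  apply: eq_measurable_fun m0 => x /set_mem Nx; rewrite /g memNset // => -[]; exact.
exists g => // i.
have mL : measurable_fun D (fun x => ((h i x - g x) ^+ 2)%:E).
  by apply/measurable_EFinP; apply: measurable_funX; apply: measurable_funB => //; case: (bh i).
rewrite (ge0_negligible_integral mN mD mL) //; last by move=> x _; rewrite lee_fin sqr_ge0.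
pose F k x := ((h i x - h k x) ^+ 2)%:E.
have e x : D' x -> ((h i x - g x) ^+ 2)%:E = limn_einf (F ^~ x).
  move=> D'x; have : F k x @[k --> \oo] --> ((h i x - g x) ^+ 2)%:E.
    have hc : (h i x - h k x) @[k --> \oo] --> h i x - g x.
      by apply: cvgB; [exact: cvg_cst|exact: hg].
    have hc2 : ((h i x - h k x) ^+ 2) @[k --> \oo] --> (h i x - g x) ^+ 2 by exact: (cvgM hc hc).
    by apply: cvg_EFin; [exact: nearW|exact: hc2].
  by move=> /cvg_limn_einf_sup[].
rewrite (_ : integral _ _ _ = \int[m]_(x in D') limn_einf (F ^~ x))%E; last first.
  by apply: eq_integral => x /set_mem; exact: e.
apply: le_trans (@fatou _ _ _ m D' mD' F _ _) _.
- move=> k; apply/measurable_EFinP; apply: measurable_funX; apply: measurable_funB.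
  + by apply: measurable_funS (bh i).1 => // x [].
  + by apply: measurable_funS (bh k).1 => // x [].
- by move=> k x _; rewrite lee_fin sqr_ge0.
rewrite limn_einf_lim; apply: lime_le; first exact: is_cvg_einfs.
apply: nearW => k; set u := fun k => _.
have -> : einfs u k = ereal_inf (sdrop u k) by [].
apply: le_trans (_ : u (maxn k i) <= _)%E.
  by apply: ereal_inf_lbound; exists (maxn k i) => //=; exact: leq_maxl.
have bF : bmfun D (fun x => (h i x - h (maxn k i) x) ^+ 2) by apply: bmfunX; exact: bmfunB.
apply: le_trans (_ : (\int[m]_(x in D) ((h i x - h (maxn k i) x) ^+ 2)%:E <= _)%E); last first.
  by rewrite bmfun_integralE // lee_fin hh // leq_maxr.
apply: ge0_subset_integral => //.
- by apply/measurable_EFinP; case: bF.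
- by move=> x _; rewrite lee_fin sqr_ge0.
- by move=> x [].
Qed.

End riesz_fischer.

(** * Integration by parts against test functions *)

Section translation.
Variables (R : realType) (n : nat).
Local Notation E := 'rV[R]_n.
Local Notation leb := (lebesgue_rV R n).
Local Notation B M := ([set x : E | `|x| < M]).

Lemma open_norm_ball (M : R) : open (B M).
Proof.
rewrite openE => x /= xM; apply/nbhs_ballP; exists (M - `|x|); first by rewrite /= subr_gt0.
move=> y; rewrite -ball_normE /= => xy.
by rewrite -(subrK x y) (le_lt_trans (ler_normD _ _)) // distrC -ltrBrDr.
Qed.

Lemma bounded_norm_ball (M : R) : bounded_set (B M).
Proof.
exists M; split; first exact: num_real.
by move=> L ML x /= xM; apply/ltW/(lt_trans xM).
Qed.

Lemma continuous_ext (O : set E) (F : E -> R) : (forall x, {for x, continuous F}) ->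
  extends_continuously O F.
Proof. by move=> cF; exists F => //; apply: continuous_subspaceT => x; exact: cF. Qed.

Lemma integral_outside (O D : set E) (h : E -> R) : measurable O -> measurable D -> D `<=` O ->
  (leb O < +oo)%E -> bmfun O h -> (forall x, O x -> ~ D x -> h x = 0) ->
  \int[leb]_(x in O) h x = \int[leb]_(x in D) h x.
Proof.
move=> mO mD DO fO bh h0.
have -> : D = O `&` D by apply/seteqP; split => [x Dx|x []] //; split => //; exact: DO.
rewrite Rintegral_mkcondr; apply: bm_eq => x Ox; rewrite patchE.
by case: ifPn => // /negP xD; apply: h0 => // Dx; apply: xD; exact/mem_set.
Qed.

(** A translation is noncontracting with c = 1, so noncontracting_integral gives one
    inequality; the opposite translation gives the other one in translate_eq. *)
Lemma translate_le (G : E -> R) M (v : E) : (forall x, {for x, continuous G}) ->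
  (forall x, 0 <= G x) -> `|v| <= 1 -> (forall x : E, M <= `|x| -> G x = 0) ->
  \int[leb]_(x in B M) G (x + v) <= \int[leb]_(x in B M) G x.
Proof.
move=> cG G0 v1 GM.
have bG (O : set E) : open O -> bounded_set O -> bmfun O G.
  by move=> oO bO; apply: ext_bm => //; exact: continuous_ext.
have mB L : measurable (B L) by apply: open_measurable_rV; exact: open_norm_ball.
have fB L : (leb (B L) < +oo)%E.
  by apply: bounded_finite_measure; [exact: open_norm_ball|exact: bounded_norm_ball].
have [] := @noncontracting_integral R n (B M) (B (M + 1)) (fun x => x + v) G 1.
- exact: mB.
- have -> : (fun x : E => x + v) = (fun x => 1 *: x + v) by apply/funext => x; rewrite scale1r.
  by apply: measurable_funTS; exact: measurable_affine.
- exact: ltr01.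
- by move=> x y _ _; rewrite mul1r opprD addrACA subrr addr0.
- by move=> x /= xM; apply: le_lt_trans (ler_normD _ _) _; rewrite ltr_leD.
- exact: fB.
- by move=> s; apply/open_dyadic_open/open_superlevel => //; exact: open_norm_ball.
- by apply: bG; [exact: open_norm_ball|exact: bounded_norm_ball].
- by [].
move=> _ _; rewrite expr1n mul1r => /le_trans; apply.
rewrite (@integral_outside (B (M + 1)) (B M)) //.
- by move=> x /= xM; rewrite ltr_wpDr.
- by apply: bG; [exact: open_norm_ball|exact: bounded_norm_ball].
- by move=> x _ /= /negP; rewrite -leNgt; exact: GM.
Qed.

Lemma translate_eq (F : E -> R) M (v : E) : (forall x, {for x, continuous F}) ->
  `|v| <= 1 -> (forall x : E, M <= `|x| -> F x = 0) ->
  \int[leb]_(x in B (M + 1)) F (x + v) = \int[leb]_(x in B (M + 1)) F x.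
Proof.
move=> cF v1 FM.
have mB : measurable (B (M + 1)) by apply: open_measurable_rV; exact: open_norm_ball.
have fB : (leb (B (M + 1)%R) < +oo)%E.
  by apply: bounded_finite_measure; [exact: open_norm_ball|exact: bounded_norm_ball].
have bG (G : E -> R) : (forall x, {for x, continuous G}) -> bmfun (B (M + 1)) G.
  by move=> cG; apply: ext_bm; [exact: open_norm_ball|exact: bounded_norm_ball|exact: continuous_ext].
have cshift (G : E -> R) (u : E) : (forall x, {for x, continuous G}) -> forall x : E, {for x, continuous (fun y : E => G (y + u))}.
  move=> cG x; apply: (@continuous_comp _ _ _ (fun y : E => y + u) G); last exact: cG.
  by apply: (@cvgD _ _ _ (nbhs x) _ id (fun=> u)); [exact: cvg_id|exact: cvg_cst].
have eqG (G : E -> R) : (forall x, {for x, continuous G}) -> (forall x, 0 <= G x) ->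
    (forall x : E, M <= `|x| -> G x = 0) ->
    \int[leb]_(x in B (M + 1)) G (x + v) = \int[leb]_(x in B (M + 1)) G x.
  move=> cG G0 GM; apply/eqP; rewrite eq_le; apply/andP; split.
    by apply: translate_le => // x Mx; apply: GM; apply: le_trans Mx; rewrite lerDl.
  have := @translate_le (fun x => G (x + v)) (M + 1) (- v) (cshift G v cG).
  rewrite normrN; under [X in _ -> _ -> _ -> X <= _]bm_eq do rewrite subrK.
  apply => // x Mx; apply: GM; rewrite -lerBrDr in Mx; apply: le_trans Mx _.
  by rewrite lerBlDr -{1}(addrK v x) (le_trans (ler_normB _ _)) // lerD2l.
have cN (x : E) : {for x, continuous (fun y : E => `|F y|)} by exact: (cvg_norm (cF x)).
have c1 (x : E) : {for x, continuous (fun y : E => `|F y| + F y)} by exact: (cvgD (cN x) (cF x)).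
have c2 (x : E) : {for x, continuous (fun y : E => `|F y| - F y)} by exact: (cvgB (cN x) (cF x)).
have e1 := eqG _ c1 _ _; have e2 := eqG _ c2 _ _.
(* F is a difference of nonnegative continuous functions *)
have FE x : F x = 2^-1 * ((`|F x| + F x) - (`|F x| - F x)) by lra.
have b1 := bG _ c1; have b2 := bG _ c2.
have b1v := bG _ (cshift _ v c1); have b2v := bG _ (cshift _ v c2).
rewrite (bm_eq leb (fun x _ => FE x)) (bm_eq leb (fun x _ => FE (x + v))).
rewrite (bm_Z mB fB _ (bmfunB b1v b2v)) (bm_Z mB fB _ (bmfunB b1 b2)); congr (_ * _).
rewrite (bm_B mB fB b1v b2v) (bm_B mB fB b1 b2); congr (_ - _).
- apply: e1 => [x|x Mx]; first by rewrite -lerBlDr sub0r -normrN ler_norm.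
  by rewrite FM // normr0 addr0.
- apply: e2 => [x|x Mx]; first by rewrite subr_ge0 ler_norm.
  by rewrite FM // normr0 subr0.
Qed.

End translation.

Section integration_by_parts.
Variables (R : realType) (n : nat).
Local Notation E := 'rV[R]_n.
Local Notation leb := (lebesgue_rV R n).
Local Notation B M := ([set x : E | `|x| < M]).
Variable (Omega : set E).
Hypotheses (oO : open Omega) (bO : bounded_set Omega).

(** By translation invariance the integral of F (x + t e_i) - F x vanishes; divided by t,
    the integrand converges uniformly to the partial derivative. *)
Lemma integral_partial_compact (F : E -> R) (K : set E) (i : 'I_n) :
  C1ext Omega F -> compact K -> K `<=` Omega -> (forall x, ~ K x -> F x = 0) ->
  \int[leb]_(x in Omega) partial i F x = 0.
Proof.
move=> cF cK KO F0; set ei := delta_mx ord0 i : E.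
have oK : open (~` K).
  by apply/closed_openC; apply: compact_closed cK; exact: norm_hausdorff.
have near0 (h : E -> R) : (forall x, ~ K x -> h x = 0) -> forall x, ~ K x -> \forall y \near x, h y = 0.
  move=> h0 x Kx; have : \forall y \near x, (~` K) y by exact: open_nbhs_nbhs.
  by apply: filterS => y; exact: h0.
have cont0 (h : E -> R) : (forall x, ~ K x -> h x = 0) -> (forall x, Omega x -> {for x, continuous h}) ->
    forall x : E, {for x, continuous h}.
  move=> h0 hO x; have [/KO Kx|Kx] := pselect (K x); first exact: hO.
  apply/(@cvgrPdist_lt _ _ _ (nbhs x) _ h) => e e0.
  by apply: filterS (near0 h h0 x Kx) => y hy; rewrite hy (h0 x Kx) subrr normr0.
have d0 x : ~ K x -> is_derive x ei F 0.
  move=> Kx; have h := is_derive_cst (0 : R) x ei; apply: near_eq_is_derive h.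
  by apply: filterS (near0 F F0 x Kx) => y ->.
have dF x : derivable F x ei.
  have [/KO Ox|Kx] := pselect (K x); first by have [_ /(_ i)[_]] := cF; apply.
  by have [] := d0 x Kx.
have p0 x : ~ K x -> partial i F x = 0 by move=> /d0[].
have ccF := cont0 F F0 (fun x Ox => ext_cont oO bO cF.1 Ox).
have cp := cont0 _ p0 (fun x Ox => ext_cont oO bO (cF.2 i).1 Ox).
have [L [_ hL]] := bO; pose M := `|L + 1| + 1.
have OM x : Omega x -> `|x| < M.
  move=> Ox; rewrite /M; apply: le_lt_trans (_ : `|L + 1| < _); last by rewrite ltrDl.
  by apply: le_trans (hL (L + 1) _ x Ox) (ler_norm _); rewrite ltrDl.
have nK x : M <= `|x| -> ~ K x by move=> Mx /KO/OM; rewrite ltNge Mx.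
have mB : measurable (B (M + 1)) by apply: open_measurable_rV; exact: open_norm_ball.
have fB : (leb (B (M + 1)%R) < +oo)%E.
  by apply: bounded_finite_measure; [exact: open_norm_ball|exact: bounded_norm_ball].
have bG (G : E -> R) : (forall x : E, {for x, continuous G}) -> bmfun (B (M + 1)) G.
  by move=> cG; apply: ext_bm; [exact: open_norm_ball|exact: bounded_norm_ball|exact: continuous_ext].
rewrite -(@integral_outside R n (B (M + 1)) Omega) //; first last.
- by move=> x _ Ox; apply: p0 => /KO.
- exact: bG.
- by move=> x /OM /= xM; rewrite ltr_wpDr.
- exact: open_measurable_rV.
pose V := fine (leb (B (M + 1))); have V0 : 0 <= V by rewrite fine_ge0.
suff h e : 0 < e -> `|\int[leb]_(x in B (M + 1)) partial i F x| <= e * V.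
  apply/eqP; rewrite -normr_le0; apply/ler_addgt0Pr => e e0; rewrite add0r.
  have e1 : 0 < e / (V + 1) by rewrite divr_gt0 // ltr_wpDl.
  apply: le_trans (h _ e1) _; rewrite mulrAC ler_pdivrMr; last by rewrite ltr_wpDl.
  by rewrite ler_pM2l // lerDl.
move=> e0.
have [r r0 hr] := ext_unif (bounded_norm_ball n (M + 2)) (continuous_ext (B (M + 2)) cp) e0.
pose t := Num.min 1 (r / 2).
have t0 : 0 < t by rewrite lt_min ltr01 divr_gt0.
have tr : t < r by rewrite gt_min ltr_pdivrMr // ltr_pMr // ltr1n orbT.
have t1 : t <= 1 by rewrite ge_min lexx.
have ei1 : `|ei| <= 1.
  apply: norm_le_coord => // j; rewrite mxE eqxx /=.
  by case: eqP => _; rewrite ?normr1 ?normr0 ?ler01.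
have sei (s : R) : 0 <= s <= 1 -> `|s *: (t *: ei)| <= t.
  move=> /andP[s0 s1]; rewrite !normrZ (ger0_norm s0) (gtr0_norm t0).
  apply: le_trans (_ : 1 * (t * 1) <= _); last by rewrite mul1r mulr1.
  by apply: ler_pM => //; [rewrite mulr_ge0 // ltW|rewrite ler_pM2l].
have te1 : `|t *: ei| <= 1 by have := sei 1; rewrite scale1r => /(_ _)/le_trans; apply => //; rewrite ler01 lexx.
have := @translate_eq R n F M (t *: ei) ccF te1 (fun x Mx => F0 x (nK x Mx)).
have bF := bG _ ccF; have bp := bG _ cp.
have cs : forall x : E, {for x, continuous (fun y : E => F (y + t *: ei))}.
  move=> x; apply: (@continuous_comp _ _ _ (fun y : E => y + t *: ei) F); last exact: ccF.
  by apply: (@cvgD _ _ _ (nbhs x) _ id (fun=> t *: ei)); [exact: cvg_id|exact: cvg_cst].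
have bFs := bG _ cs.
move=> /eqP; rewrite -subr_eq0 -bm_B // => /eqP diff0.
have btp : bmfun (B (M + 1)) (fun x => t * partial i F x) by apply: bmfunM => //; exact: bmfun_cst.
rewrite -(ler_pM2l t0) -[X in X * _](gtr0_norm t0) -normrM -bm_Z //.
rewrite -[X in `|X|]subr0 -diff0 -bm_B //; last exact: bmfunB.
apply: le_trans (_ : \int[leb]_(x in B (M + 1)) (t * e) <= _); last first.
  by rewrite bm_cst // mulrA.
apply: bm_norm_le => //; [by apply: bmfunB => //; exact: bmfunB|exact: bmfun_cst|].
move=> x /= xM.
have [] := @line_MVT R n F x (t *: ei) (fun s => t * partial i F (x + s *: (t *: ei))).
  by move=> s s01; apply/is_derive_dirZ/derivableP.
move=> s /andP[s0 s1] ->; rewrite -mulrBr normrM (gtr0_norm t0) ler_pM2l //.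
have st : `|s *: (t *: ei)| <= t by apply: sei; rewrite !ltW.
apply/ltW/hr => /=.
- by apply: lt_trans xM _; rewrite ltrD2l ltr1n.
- apply: le_lt_trans (ler_normD _ _) _; apply: lt_le_trans (ltr_leD xM (le_trans st t1)) _.
  by rewrite -addrA lerD2l.
- by rewrite opprD addrA subrr add0r normrN (le_lt_trans st).
Qed.

Lemma test_function_C1ext (eta : E -> R) : test_function Omega eta ->
  C1ext Omega eta /\ exists2 K : set E, compact K /\ K `<=` Omega & forall x, ~ K x -> eta x = 0.
Proof.
move=> [se [K [cK KO e0]]]; split; last by exists K.
have /Ck1P[ce [_ de]] := se 1%N.
have sub (G : E -> R) : {within closure setT, continuous G} -> {within closure Omega, continuous G}.
  by move=> cG; apply: (continuous_subspaceW _ cG) => x _; exact: subset_closure.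
split; first by exists eta => //; exact: sub.
move=> i; have [[G cG hG] d] := de i; split; first by exists G => [|x _]; [exact: sub|exact: hG].
by move=> x _; exact: d.
Qed.

(** The product w eta has compact support, so its partial derivatives have integral 0. *)
Lemma C1_weak_gradient (w eta : E -> R) (i : 'I_n) : C1ext Omega w -> test_function Omega eta ->
  \int[leb]_(x in Omega) (w x * partial i eta x) =
  - \int[leb]_(x in Omega) (partial i w x * eta x).
Proof.
move=> cw /test_function_C1ext[ce [K [cK KO] e0]].
have [cF dF] := C1ext_M bO cw ce.
have mO := open_measurable_rV oO; have fO := bounded_finite_measure oO bO.
have bw : bmfun Omega w by apply: ext_bm => //; exact: cw.1.
have be : bmfun Omega eta by apply: ext_bm => //; exact: ce.1.
have bdw : bmfun Omega (partial i w) by apply: ext_bm => //; exact: (cw.2 i).1.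
have bde : bmfun Omega (partial i eta) by apply: ext_bm => //; exact: (ce.2 i).1.
have := integral_partial_compact i cF cK KO (fun x Kx => etrans (congr1 (fun t => w x * t) (e0 x Kx)) (mulr0 _)).
rewrite (bm_eq leb (fun x Ox => dF i x Ox)) bm_D //; try exact: bmfunM.
move=> /eqP; rewrite addr_eq0 => /eqP ->; congr (- _).
by apply: bm_eq => x _; rewrite mulrC.
Qed.

End integration_by_parts.

(** * Limits of L2 pairings *)

Lemma eq0_geometric (R : realType) (x C : R) : (forall i, `|x| <= C * (2^-1) ^+ i) -> x = 0.
Proof.
move=> h; have C0 : 0 <= C by have := h 0%N; rewrite expr0 mulr1; exact: le_trans.
apply/eqP; rewrite -normr_le0; apply/ler_addgt0Pr => e e0; rewrite add0r.
have hc : (fun k => (2^-1 : R) ^+ k) @ \oo --> 0.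
  by apply: cvg_expr; rewrite ger0_norm ?invr_ge0 // invf_lt1 // ltr1n.
have e1 : 0 < e / (C + 1) by rewrite divr_gt0 // ltr_wpDl.
move/cvgrPdist_lt: hc => /(_ _ e1) [k _ /(_ k (leqnn k))].
rewrite sub0r normrN ger0_norm ?exprn_ge0 // => hk.
apply: le_trans (h k) _; apply: le_trans (_ : C * (e / (C + 1)) <= _).
  by apply: ler_wpM2l => //; exact: ltW.
by rewrite mulrCA; apply: ler_piMr; [exact: ltW|rewrite ler_pdivrMr ?mul1r ?lerDl // ltr_wpDl].
Qed.

Section l2_pairing.
Context d (T : measurableType d) (R : realType).
Variables (m : {measure set T -> \bar R}) (D : set T).
Hypotheses (mD : measurable D) (fD : (m D < +oo)%E).

(** By Young, |(h - g) b| <= p b^2 + p^-1 (h - g)^2 with p = 2 ^- i, which balances the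
    rate 4 ^- i of the hypothesis. *)
Lemma l2_pair (h : nat -> T -> R) (g b : T -> R) :
  (forall i, bmfun D (h i)) -> measurable_fun D g ->
  (forall i, (\int[m]_(x in D) ((h i x - g x) ^+ 2)%:E <= ((4^-1) ^+ i)%:E)%E) ->
  bmfun D b ->
  m.-integrable D (EFin \o (fun x => g x * b x)) /\
  forall i, `|\int[m]_(x in D) (h i x * b x) - \int[m]_(x in D) (g x * b x)| <=
    (\int[m]_(x in D) (b x) ^+ 2 + 1) * (2^-1) ^+ i.
Proof.
move=> bh mg hg bb.
have bb2 : bmfun D (fun x => b x ^+ 2) by exact: bmfunX.
have mdiff i : measurable_fun D (fun x => (h i x - g x) * b x).
  by apply: measurable_funM; [apply: measurable_funB => //; case: (bh i)|case: bb].
have p0 i : 0 < (2^-1 : R) ^+ i by rewrite exprn_gt0.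
have key i : (\int[m]_(x in D) `|((h i x - g x) * b x)%:E| <=
    ((\int[m]_(x in D) (b x) ^+ 2 + 1) * (2^-1) ^+ i)%:E)%E.
  apply: le_trans (_ : \int[m]_(x in D) (((2^-1) ^+ i * b x ^+ 2)%:E +
      (2 ^+ i)%:E * ((h i x - g x) ^+ 2)%:E) <= _)%E.
    apply: ge0_le_integral => //.
    - by apply: measurableT_comp => //; apply/measurable_EFinP.
    - apply: emeasurable_funD.
        by apply/measurable_EFinP; apply: measurable_funM => //; case: bb2.
      apply: measurable_funeM; apply/measurable_EFinP; apply: measurable_funX.
      by apply: measurable_funB => //; case: (bh i).
    move=> x Dx; rewrite -EFinM -EFinD lee_fin normrM -[(h i x - _) ^+ 2]real_normK ?num_real //.
    rewrite -[b x ^+ 2]real_normK ?num_real //.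
    have -> : 2 ^+ i = ((2^-1) ^+ i)^-1 :> R by rewrite exprVn invrK.
    have := p0 i; set p := _ ^+ i => pp; set t := `|h i x - g x|; set u := `|b x|.
    rewrite -(ler_pM2l pp) mulrDr [p * (p^-1 * _)]mulrA divff ?gt_eqF // mul1r.
    have t0 : 0 <= t by exact: normr_ge0. have u0 : 0 <= u by exact: normr_ge0.
    have : 0 <= p * (t * u) by rewrite !mulr_ge0 // ltW.
    by have := sqr_ge0 (p * u - t); nra.
  have b1 : bmfun D (fun x => (2^-1) ^+ i * b x ^+ 2) by apply: bmfunM => //; exact: bmfun_cst.
  have m2 : measurable_fun D (fun x => ((h i x - g x) ^+ 2)%:E).
    by apply/measurable_EFinP; apply: measurable_funX; apply: measurable_funB => //; case: (bh i).
  rewrite ge0_integralD //; last first.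
  - exact: measurable_funeM.
  - by move=> x _; apply: mule_ge0; [rewrite lee_fin exprn_ge0|rewrite lee_fin sqr_ge0].
  - by apply/measurable_EFinP; case: b1.
  - by move=> x _; rewrite lee_fin; apply: mulr_ge0; [exact: ltW|exact: sqr_ge0].
  rewrite ge0_integralZl //; last by move=> x _; rewrite lee_fin sqr_ge0.
  rewrite bmfun_integralE // bm_Z // mulrDl mul1r EFinD; apply: leeD; first by rewrite mulrC.
  apply: le_trans (_ : (2 ^+ i)%:E * ((4^-1) ^+ i)%:E <= _)%E.
    by apply: lee_wpmul2l; [rewrite lee_fin exprn_ge0|exact: hg].
  by rewrite -EFinM lee_fin -exprMn (_ : 2 * 4^-1 = 2^-1) //; lra.
have idiff i : m.-integrable D (EFin \o (fun x => (h i x - g x) * b x)).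
  apply/integrableP; split; first exact/measurable_EFinP.
  by apply: le_lt_trans (key i) _; rewrite ltry.
have ih i : m.-integrable D (EFin \o (fun x => h i x * b x)).
  by apply: bmfun_integrable => //; exact: bmfunM.
have ig : m.-integrable D (EFin \o (fun x => g x * b x)).
  have := integrableB mD (ih 0%N) (idiff 0%N); apply: eq_integrable => // x _ /=.
  by rewrite -EFinB; congr EFin; ring.
split => // i; rewrite -RintegralB //.
have -> : \int[m]_(x in D) (h i x * b x - g x * b x) = \int[m]_(x in D) ((h i x - g x) * b x).
  by apply: bm_eq => x _; ring.
rewrite -lee_fin; apply: le_trans (key i); rewrite EFin_normr_Rintegral //.
by apply: le_abse_integral => //; exact/measurable_EFinP.
Qed.

End l2_pairing.

(** * The Rayleigh quotient *)

Lemma poincare_arith (R : realFieldType) (c L C N X Y G D : R) :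
  0 < c -> 0 < L -> 0 <= C -> N <= X -> X <= L * Y -> c * G <= D -> Y <= C * G -> 0 <= G ->
  c / (L * C + 1) * N <= D.
Proof.
move=> c0 L0 C0 NX XY GD YG G0.
have p0 : 0 < L * C + 1 by rewrite ltr_wpDl // mulr_ge0 // ltW.
apply: le_trans GD; rewrite mulrAC ler_pdivrMr // -mulrA ler_pM2l //.
apply: le_trans NX (le_trans XY _); apply: le_trans (ler_wpM2l (ltW L0) YG) _.
by rewrite mulrDr mulr1 [G * (L * C)]mulrC mulrA lerDl.
Qed.

Section rayleigh.
Variables (R : realType) (n : nat).
Local Notation E := 'rV[R]_n.
Local Notation leb := (lebesgue_rV R n).
Variable (Omega : set E).
Hypotheses (oO : open Omega) (bO : bounded_set Omega).
Hypothesis cO : convex_set (Omega : set (convex_lmodType E)).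
Variable (f : E -> R).
Hypotheses (cf : {within closure Omega, continuous f}) (C1f : C1ext Omega f).
Hypothesis f0 : forall x, closure Omega x -> 0 < f x.
Local Notation I h := (\int[leb]_(x in Omega) h x).
Hypothesis If1 : I f = 1.

Let mO := open_measurable_rV oO.
Let fO := bounded_finite_measure oO bO.

(** The quadratic forms of the operator L, for the measure f dx: its Rayleigh quotient is
    weighted_dirichlet w w / weighted_norm2 w on functions with weighted_mean w = 0. *)
Definition weighted_norm2 (w : E -> R) := I (fun x => w x ^+ 2 * f x).
Definition weighted_prod (w h : E -> R) := I (fun x => w x * h x * f x).
Definition weighted_dirichlet (w h : E -> R) := I (fun x => dot (grad w x) (grad h x) * f x).
Definition weighted_mean (w : E -> R) := I (fun x => w x * f x).

Let bf : bmfun Omega f.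
Proof. by apply: ext_bm => //; case: C1f. Qed.

Let bC1 w : C1ext Omega w -> bmfun Omega w.
Proof. by move=> cw; apply: ext_bm => //; case: cw. Qed.

Let bp w i : C1ext Omega w -> bmfun Omega (partial i w).
Proof. by move=> cw; apply: ext_bm => //; exact: (cw.2 i).1. Qed.

Let bdot w h : C1ext Omega w -> C1ext Omega h -> bmfun Omega (fun x => dot (grad w x) (grad h x)).
Proof.
move=> cw ch; apply: bmfun_sum => i; under eq_fun do rewrite !mxE.
by apply: bmfunM; exact: bp.
Qed.

Lemma rayleigh_expand w h t : C1ext Omega w -> C1ext Omega h ->
  [/\ C1ext Omega (fun x => w x + t * h x),
      weighted_norm2 (fun x => w x + t * h x) = weighted_norm2 w + 2 * t * weighted_prod w h + t ^+ 2 * weighted_norm2 h,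
      weighted_dirichlet (fun x => w x + t * h x) (fun x => w x + t * h x) =
        weighted_dirichlet w w + 2 * t * weighted_dirichlet w h + t ^+ 2 * weighted_dirichlet h h &
      weighted_mean (fun x => w x + t * h x) = weighted_mean w + t * weighted_mean h].
Proof.
move=> cw ch; have [cth dth] := C1ext_Z bO t ch; have [cs ds] := C1ext_D cw cth.
have bw := bC1 cw; have bh := bC1 ch.
have lin3 (a b c : E -> R) s r : bmfun Omega a -> bmfun Omega b -> bmfun Omega c ->
    I (fun x => a x + s * b x + r * c x) = I a + s * I b + r * I c.
  move=> ba bb bc.
  have b1 : bmfun Omega (fun x => s * b x) by apply: bmfunM => //; exact: bmfun_cst.
  have b2 : bmfun Omega (fun x => r * c x) by apply: bmfunM => //; exact: bmfun_cst.
  by rewrite bm_D //; [rewrite bm_D // !bm_Z|exact: bmfunD].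
split => //.
- rewrite /weighted_norm2 /weighted_prod -lin3; last 3 first.
  + by apply: bmfunM => //; exact: bmfunX.
  + by apply: bmfunM => //; exact: bmfunM.
  + by apply: bmfunM => //; exact: bmfunX.
  by apply: bm_eq => x _; ring.
- rewrite /weighted_dirichlet -lin3; last 3 first.
  + by apply: bmfunM => //; exact: bdot.
  + by apply: bmfunM => //; exact: bdot.
  + by apply: bmfunM => //; exact: bdot.
  apply: bm_eq => x Ox.
  have -> : grad (fun x => w x + t * h x) x = grad w x + t *: grad h x.
    by apply/rowP => i; rewrite !mxE ds // dth.
  rewrite dotDl !dotDr !dotZl !dotZr (dotC (grad h x) (grad w x)); ring.
- rewrite /weighted_mean; have b1 : bmfun Omega (fun x => w x * f x) by exact: bmfunM.
  have b2 : bmfun Omega (fun x => h x * f x) by exact: bmfunM.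
  rewrite -bm_Z // -bm_D //; last by apply: bmfunM => //; exact: bmfun_cst.
  by apply: bm_eq => x _; ring.
Qed.

Let f_lower : exists2 c, 0 < c & forall x, Omega x -> c <= f x.
Proof.
have [c c0 hc] := closure_pos_lower bO cf f0.
by exists c => // x Ox; apply/hc/subset_closure.
Qed.

Let f_upper : exists2 L, 0 < L & forall x, Omega x -> f x <= L.
Proof.
have [_ [M hM]] := bf; exists (`|M| + 1); first by rewrite ltr_wpDl.
move=> x Ox; apply: le_trans (ler_norm _) _; apply: le_trans (hM x Ox) _.
by apply: le_trans (ler_norm _) _; rewrite lerDl.
Qed.

(** The density lies between two positive constants, so the inequality for Lebesgue
    measure transfers. The constant obtained depends on f; it only serves to make the
    infimum of the Rayleigh quotient positive. *)
Lemma weighted_poincare : exists2 rho0, 0 < rho0 & forall w, C1ext Omega w ->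
  weighted_mean w = 0 -> rho0 * weighted_norm2 w <= weighted_dirichlet w w.
Proof.
have [C C0 hC] := global_poincare oO bO cO.
have [c c0 hc] := f_lower; have [L L0 hL] := f_upper.
have V0 : 0 < fine (leb Omega).
  have : I f <= L * fine (leb Omega).
    by rewrite -bm_cst //; apply: bm_le => //; exact: bmfun_cst.
  rewrite If1 => h; have := lt_le_trans ltr01 h; rewrite pmulr_rgt0 //.
exists (c / (L * C + 1)); first by rewrite divr_gt0 // ltr_wpDl // mulr_ge0 // ltW.
move=> w cw w0; pose a := I w / fine (leb Omega).
have bw := bC1 cw.
have [c1 _] := C1ext_cst Omega (- a).
have [cwa dwa] := C1ext_D cw c1.
have bwa := bC1 cwa.
have := hC _ cwa; rewrite bm_D //; last exact: bmfun_cst.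
rewrite bm_cst // mulNr divfK ?gt_eqF // subrr expr0n add0r mulrAC.
rewrite mulrC ler_pM2r // => h.
have e1 : weighted_norm2 w <= I (fun x => (w x - a) ^+ 2 * f x).
  have e2 : I (fun x => (w x - a) ^+ 2 * f x) = weighted_norm2 w + a ^+ 2.
    have b1 : bmfun Omega (fun x => w x ^+ 2 * f x) by apply: bmfunM => //; exact: bmfunX.
    have b2 : bmfun Omega (fun x => w x * f x) by apply: bmfunM.
    have b3 : bmfun Omega (fun x => (-2 * a) * (w x * f x)) by apply: bmfunM => //; exact: bmfun_cst.
    have b4 : bmfun Omega (fun x => a ^+ 2 * f x) by apply: bmfunM => //; exact: bmfun_cst.
    have -> : I (fun x => (w x - a) ^+ 2 * f x) =
       I (fun x => w x ^+ 2 * f x + (-2 * a) * (w x * f x) + a ^+ 2 * f x).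
      by apply: bm_eq => x _; ring.
    rewrite bm_D //; last exact: bmfunD.
    rewrite bm_D // !bm_Z // If1 mulr1 -/(weighted_mean w) w0 mulr0 addr0 //.
  by rewrite e2 lerDl sqr_ge0.
have e3 : I (fun x => (w x - a) ^+ 2 * f x) <= L * I (fun x => (w x - a) ^+ 2).
  have b1 : bmfun Omega (fun x => (w x - a) ^+ 2) by apply: bmfunX.
  rewrite -bm_Z //; apply: bm_le => //; [exact: bmfunM|by apply: bmfunM => //; exact: bmfun_cst|].
  by move=> x Ox; rewrite mulrC ler_wpM2r ?sqr_ge0 // hL.
have e4 : I (grad2 (fun x => w x - a)) = I (grad2 w).
  apply: bm_eq => x Ox; rewrite /grad2; congr dot; apply/rowP => i.
    by rewrite !mxE dwa // (C1ext_cst Omega (-a)).2 addr0.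
  by rewrite !mxE dwa // (C1ext_cst Omega (-a)).2 addr0.
have e5 : c * I (grad2 w) <= weighted_dirichlet w w.
  have b1 : bmfun Omega (grad2 w) := bdot cw cw.
  have -> : weighted_dirichlet w w = I (fun x => grad2 w x * f x) by [].
  rewrite -(bm_Z mO fO c b1); apply: (bm_le mO fO); first exact: (bmfunM (bmfun_cst _ c) b1).
    exact: bmfunM.
  by move=> x Ox; rewrite mulrC; apply: ler_wpM2l; [exact: dot_ge0|exact: hc].
have G0 : 0 <= I (grad2 w) by apply: Rintegral_ge0 => x _; exact: dot_ge0.
rewrite e4 in h; exact: (poincare_arith c0 L0 C0 e1 e3 e5 h G0).
Qed.

End rayleigh.

(** * Minimizing sequences *)

Lemma parallelogram_arith (R : realFieldType) (rho p a b d : R) :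
  rho * (1 + 2 * 1 * p + 1 ^+ 2 * 1) <= a + 2 * 1 * b + 1 ^+ 2 * d ->
  a + 2 * -1 * b + (-1) ^+ 2 * d <=
  2 * (a - rho) + 2 * (d - rho) + rho * (1 + 2 * -1 * p + (-1) ^+ 2 * 1).
Proof. by rewrite sqrrN !expr1n; lra. Qed.

Lemma almost_min_arith (R : realFieldType) (rho c q W A B D Y X : R) :
  W <= 2 * (A - rho) + 2 * (B - rho) + Y -> A - rho <= D -> B - rho <= D ->
  D <= c / 8 * q -> Y <= X -> X <= c / 2 * q -> W <= c * q.
Proof. lra. Qed.

Section eigenfunction.
Variables (R : realType) (n : nat).
Local Notation E := 'rV[R]_n.
Local Notation leb := (lebesgue_rV R n).
Variable (Omega : set E).
Hypotheses (oO : open Omega) (bO : bounded_set Omega).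
Hypothesis cO : convex_set (Omega : set (convex_lmodType E)).
Variable (f : E -> R).
Hypotheses (cf : {within closure Omega, continuous f}) (C1f : C1ext Omega f).
Hypothesis f0 : forall x, closure Omega x -> 0 < f x.
Local Notation I h := (\int[leb]_(x in Omega) h x).
Hypothesis If1 : I f = 1.
Local Notation wnorm := (weighted_norm2 Omega f).
Local Notation wprod := (weighted_prod Omega f).
Local Notation wdirichlet := (weighted_dirichlet Omega f).
Local Notation wmean := (weighted_mean Omega f).

Variable (rho : R).
Hypothesis rho0 : 0 < rho.
Hypothesis rho_lower : forall w, C1ext Omega w -> wmean w = 0 -> rho * wnorm w <= wdirichlet w w.
Hypothesis rho_inf : forall d, 0 < d -> exists w, [/\ C1ext Omega w, wmean w = 0, wnorm w = 1 &
  wdirichlet w w < rho + d].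

Let mO := open_measurable_rV oO.
Let fO := bounded_finite_measure oO bO.

Let bf : bmfun Omega f.
Proof. by apply: ext_bm => //; case: C1f. Qed.

Let bC1 w : C1ext Omega w -> bmfun Omega w.
Proof. by move=> cw; apply: ext_bm => //; case: cw. Qed.

Let bp w i : C1ext Omega w -> bmfun Omega (partial i w).
Proof. by move=> cw; apply: ext_bm => //; exact: (cw.2 i).1. Qed.

Let bg w : C1ext Omega w -> bmfun Omega (grad2 w).
Proof. by move=> cw; apply: ext_bm => //; exact: ext_grad2. Qed.

(** The parallelogram identity, with the Dirichlet form of w + h bounded below by rho
    times its norm: almost minimizers that are close in L2 are close in H1. *)
Lemma almost_minimizers w h : C1ext Omega w -> C1ext Omega h -> wmean w = 0 -> wmean h = 0 ->
  wnorm w = 1 -> wnorm h = 1 ->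
  C1ext Omega (fun x => w x + -1 * h x) /\
  wdirichlet (fun x => w x + -1 * h x) (fun x => w x + -1 * h x) <=
  2 * (wdirichlet w w - rho) + 2 * (wdirichlet h h - rho) + rho * wnorm (fun x => w x + -1 * h x).
Proof.
move=> cw ch mw mh nw nh.
have [cm nm dm mm] := rayleigh_expand oO bO C1f (-1) cw ch.
have [cp np dp mp] := rayleigh_expand oO bO C1f 1 cw ch.
split => //.
have := rho_lower cp _; rewrite mp mw mh mulr0 addr0 => /(_ erefl).
rewrite dm nm dp np nw nh; exact: parallelogram_arith.
Qed.

(** Rellich gives convergence in L2, and almost_minimizers turns it into convergence of
    the gradients. The weights f and rho are absorbed by kap and sig, so that the rate is
    4 ^- i as in riesz_fischer. *)
Lemma minimizing_sequence : exists psi : nat -> E -> R,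
  [/\ forall i, C1ext Omega (psi i), forall i, wmean (psi i) = 0, forall i, wnorm (psi i) = 1,
   forall i, wdirichlet (psi i) (psi i) <= rho + (4^-1) ^+ i &
   forall i j, (i <= j)%N ->
     I (fun x => (psi i x - psi j x) ^+ 2) <= (4^-1) ^+ i /\
     forall k, I (fun x => (partial k (psi i) x - partial k (psi j) x) ^+ 2) <= (4^-1) ^+ i].
Proof.
have [c c0 hc] : exists2 c, 0 < c & forall x, Omega x -> c <= f x.
  have [c c0 hc] := closure_pos_lower bO cf f0.
  by exists c => // x Ox; apply/hc/subset_closure.
have [L L0 hL] : exists2 L, 0 < L & forall x, Omega x -> f x <= L.
  have [_ [M hM]] := bf; exists (`|M| + 1); first by rewrite ltr_wpDl.
  move=> x Ox; apply: le_trans (ler_norm _) _; apply: le_trans (hM x Ox) _.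
  by apply: le_trans (ler_norm _) _; rewrite lerDl.
pose kap := Num.min 1 (c / 8).
have kap0 : 0 < kap by rewrite lt_min ltr01 divr_gt0.
have kap1 : kap <= 1 by rewrite ge_min lexx.
have kapc : kap <= c / 8 by rewrite ge_min lexx orbT.
pose del i : R := kap * (4^-1) ^+ i.
have q0 i : 0 < (4^-1 : R) ^+ i by rewrite exprn_gt0.
have del0 i : 0 < del i by rewrite mulr_gt0.
have del1 i : del i <= (4^-1) ^+ i by rewrite /del ger_pMl.
have /boolp.choice[phi hphi] : forall i, exists w, [/\ C1ext Omega w, wmean w = 0, wnorm w = 1 &
  wdirichlet w w < rho + del i] by move=> i; exact: rho_inf.
have low w : bmfun Omega w -> (forall x, 0 <= w x) -> I w <= c^-1 * I (fun x => w x * f x).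
  move=> bw w0; rewrite -(bm_Z mO fO _ (bmfunM bw bf)); apply: (bm_le mO fO) => //.
    by apply: bmfunM; [exact: bmfun_cst|exact: bmfunM].
  move=> x Ox; rewrite mulrC -mulrA; apply: ler_peMr; first exact: w0.
  by rewrite ler_pdivlMr // mul1r hc.
pose M := c^-1 * (rho + 2).
have c10 : 0 <= c^-1 by rewrite invr_ge0 ltW.
have B1 k : I (fun x => phi k x ^+ 2) <= M.
  have [ck _ nk _] := hphi k.
  apply: le_trans (low _ _ _) _; [by apply: bmfunX; exact: bC1|by move=> x; exact: sqr_ge0|].
  rewrite -/(wnorm (phi k)) nk /M; apply: ler_wpM2l => //.
  by apply: le_trans (_ : 0 + 2 <= _); [rewrite add0r ler1n|rewrite lerD2r ltW].
have B2 k : I (grad2 (phi k)) <= M.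
  have [ck _ nk dk] := hphi k.
  apply: le_trans (low _ _ _) _; [exact: bg|by move=> x; exact: dot_ge0|].
  rewrite -/(wdirichlet (phi k) (phi k)) /M; apply: ler_wpM2l => //.
  apply: le_trans (ltW dk) _; rewrite lerD2l; apply: le_trans (del1 k) _.
  by apply: le_trans (_ : 1 <= _); [apply: exprn_ile1 => //; rewrite invf_le1 // ler1n|rewrite ler1n].
pose sig := Num.min 1 (c / (2 * rho * L)).
have sig0 : 0 < sig by rewrite lt_min ltr01 divr_gt0 // !mulr_gt0.
have sig1 : sig <= 1 by rewrite ge_min lexx.
have sigc : rho * L * sig <= c / 2.
  have : sig <= c / (2 * rho * L) by rewrite ge_min lexx orbT.
  rewrite ler_pdivlMr ?mulr_gt0 // => h; rewrite ler_pdivlMr //.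
  by rewrite (_ : rho * L * sig * 2 = sig * (2 * rho * L)) //; ring.
have [s [si hs]] := rellich oO bO cO (fun k => let: And4 a _ _ _ := hphi k in a) B1 B2
  (fun i => mulr_gt0 sig0 (q0 i)).
exists (fun i => phi (s i)).
have mono i j : (i <= j)%N -> del (s j) <= del i.
  move=> ij; rewrite ler_pM2l //; apply: ler_wiXn2l; [by rewrite invr_ge0|by rewrite invf_le1 // ler1n|exact: leq_trans (si j)].
split => [i|i|i|i|i j ij].
- by have [] := hphi (s i).
- by have [] := hphi (s i).
- by have [] := hphi (s i).
- have [_ _ _ d] := hphi (s i); apply: le_trans (ltW d) _; rewrite lerD2l.
  by apply: le_trans (mono i i _) (del1 i).
have L2 := hs i j ij; split.
  by apply: le_trans L2 _; rewrite ger_pMl.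
move=> k; have [ci mi ni di] := hphi (s i); have [cj mj nj dj] := hphi (s j).
have [cd hd] := almost_minimizers ci cj mi mj ni nj.
have dE x : phi (s i) x + -1 * phi (s j) x = phi (s i) x - phi (s j) x by rewrite mulN1r.
have Nle : wnorm (fun x => phi (s i) x + -1 * phi (s j) x) <= L * (sig * (4^-1) ^+ i).
  have b1 : bmfun Omega (fun x => (phi (s i) x - phi (s j) x) ^+ 2).
    by apply: bmfunX; apply: bmfunB; exact: bC1.
  apply: le_trans (ler_wpM2l (ltW L0) L2); rewrite -(bm_Z mO fO _ b1); apply: (bm_le mO fO).
  - by apply: bmfunM => //; apply: bmfunX; exact: bC1.
  - by apply: bmfunM => //; exact: bmfun_cst.
  - by move=> x Ox; rewrite dE mulrC; apply: ler_wpM2r; [exact: sqr_ge0|exact: hL].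
have Dle : wdirichlet (fun x => phi (s i) x + -1 * phi (s j) x)
    (fun x => phi (s i) x + -1 * phi (s j) x) <= c * (4^-1) ^+ i.
  have di' : wdirichlet (phi (s i)) (phi (s i)) - rho <= del i.
    by rewrite lerBlDl; apply: le_trans (ltW di) _; rewrite lerD2l; exact: mono.
  have dj' : wdirichlet (phi (s j)) (phi (s j)) - rho <= del i.
    by rewrite lerBlDl; apply: le_trans (ltW dj) _; rewrite lerD2l; exact: mono.
  have h1 : del i <= c / 8 * (4^-1) ^+ i by rewrite ler_pM2r.
  have h2 := ler_wpM2l (ltW rho0) Nle.
  have h3 : rho * (L * (sig * (4^-1) ^+ i)) <= c / 2 * (4^-1) ^+ i.
    by rewrite (_ : rho * _ = rho * L * sig * (4^-1) ^+ i); [rewrite ler_pM2r|ring].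
  exact: (almost_min_arith hd di' dj' h1 h2 h3).
have b1 : bmfun Omega (fun x => (partial k (phi (s i)) x - partial k (phi (s j)) x) ^+ 2).
  by apply: bmfunX; apply: bmfunB; exact: bp.
apply: le_trans (_ : I (grad2 (fun x => phi (s i) x + -1 * phi (s j) x)) <= _).
  apply: (bm_le mO fO) => //; first exact: bg.
  move=> x Ox; have [cz dz] := C1ext_Z bO (-1) cj; have [_ ds] := C1ext_D ci cz.
  rewrite /grad2 /dot (bigD1 k) //= !mxE ds // dz // mulN1r -expr2 lerDl.
  by apply: sumr_ge0 => l _; rewrite mxE -expr2 sqr_ge0.
apply: le_trans (low _ (bg cd) (fun x => dot_ge0 _)) _.
by rewrite ler_pdivrMl.
Qed.

Lemma partial_ln x k : Omega x -> partial k (fun y => ln (f y)) x = partial k f x / f x.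
Proof.
move=> Ox; have [_ /(_ k)[_ /(_ x Ox)/derivableP df]] := C1f.
have fx : 0 < f x by apply/f0/subset_closure.
have d1 : is_derive (0 : R) 1 (fun t : R => f (x + t *: delta_mx ord0 k)) (partial k f x).
  by apply/is_derive_line; rewrite scale0r addr0.
have d2 : is_derive (f (x + 0 *: delta_mx ord0 k)) 1 (@ln R) (f x)^-1.
  by rewrite scale0r addr0; exact: is_derive1_ln.
have := is_derive1_comp d2 d1.
have -> : @ln R \o (fun t : R => f (x + t *: delta_mx ord0 k)) =
  (fun t : R => (fun y => ln (f y)) (x + t *: delta_mx ord0 k)) by [].
move=> h; have := (@is_derive_line R n (fun y => ln (f y)) x (delta_mx ord0 k) 0 _).2 h.
by rewrite scale0r addr0 mulrC => -[].
Qed.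

(** The quadratic polynomial in t is nonnegative and at most q^2 at 0, so its linear
    coefficient is O(q): take t = q and t = - q. *)
Lemma first_variation_arith (W b D p N q : R) : 0 <= D -> 0 <= N ->
  (forall t, rho * (1 + 2 * t * p + t ^+ 2 * N) <= W + 2 * t * b + t ^+ 2 * D) ->
  0 < q -> W <= rho + q ^+ 2 -> `|b - rho * p| <= (1 + D) * q.
Proof.
move=> D0 N0 h q0 Wq; have rN : 0 <= rho * N by rewrite mulr_ge0 // ltW.
have qN : 0 <= q ^+ 2 * (rho * N) by rewrite mulr_ge0 // sqr_ge0.
have h1 := h q; have h2 := h (- q); rewrite sqrrN in h2.
rewrite ler_norml; apply/andP; split; rewrite -(ler_pM2l q0); nra.
Qed.

Lemma l2_finite (h g : E -> R) : bmfun Omega h -> measurable_fun Omega g ->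
  (\int[leb]_(x in Omega) ((h x - g x) ^+ 2)%:E <= 1)%E ->
  (\int[leb]_(x in Omega) (g x ^+ 2)%:E < +oo)%E.
Proof.
move=> bh mg hg; have bh2 : bmfun Omega (fun x => 2 * h x ^+ 2).
  by apply: bmfunM; [exact: bmfun_cst|exact: bmfunX].
have md : measurable_fun Omega (fun x => ((h x - g x) ^+ 2)%:E).
  by apply/measurable_EFinP; apply: measurable_funX; apply: measurable_funB => //; case: bh.
apply: le_lt_trans (_ : \int[leb]_(x in Omega) ((2 * h x ^+ 2)%:E + 2%:E * ((h x - g x) ^+ 2)%:E) < _)%E.
  apply: ge0_le_integral => //.
  - by move=> x _; rewrite lee_fin sqr_ge0.
  - by apply/measurable_EFinP; exact: measurable_funX.
  - apply: emeasurable_funD; first by apply/measurable_EFinP; case: bh2.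
    exact: measurable_funeM.
  - move=> x _; rewrite -EFinM -EFinD lee_fin.
    by have := sqr_ge0 (2 * h x - g x); nra.
rewrite ge0_integralD //; last first.
- exact: measurable_funeM.
- by move=> x _; apply: mule_ge0; rewrite lee_fin ?sqr_ge0.
- by apply/measurable_EFinP; case: bh2.
- by move=> x _; rewrite lee_fin mulr_ge0 // sqr_ge0.
rewrite ge0_integralZl //; last by move=> x _; rewrite lee_fin sqr_ge0.
rewrite bmfun_integralE //; apply: lte_add_pinfty; first exact: ltry.
apply: le_lt_trans (_ : 2%:E * 1 < _)%E; last by rewrite mule1 ltry.
by apply: lee_wpmul2l.
Qed.

End eigenfunction.

(** * The spectral gap *)

Lemma el_arith (R : realFieldType) (A A' B B' C C' D q rho : R) : 0 < rho ->
  `|A - A'| <= C * q -> rho * `|B - B'| <= rho * (C' * q) -> `|A - rho * B| <= D * q ->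
  `|A' - rho * B'| <= (C + rho * C' + D) * q.
Proof.
move=> rho0 s1 s2 s3.
rewrite (_ : A' - rho * B' = (A - rho * B) - (A - A') + rho * (B - B')); last by ring.
apply: le_trans (ler_normD _ _) _; rewrite normrM (gtr0_norm rho0).
apply: le_trans (lerD (ler_normB _ _) s2) _.
rewrite (_ : (C + rho * C' + D) * q = D * q + C * q + rho * (C' * q)); last by ring.
by rewrite lerD2r lerD.
Qed.

Section eigenvalue.
Variables (R : realType) (n : nat).
Local Notation E := 'rV[R]_n.
Local Notation leb := (lebesgue_rV R n).
Variable (Omega : set E).
Hypotheses (oO : open Omega) (bO : bounded_set Omega).
Hypothesis cO : convex_set (Omega : set (convex_lmodType E)).
Variable (f : E -> R).
Hypotheses (cf : {within closure Omega, continuous f}) (C1f : C1ext Omega f).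
Hypothesis f0 : forall x, closure Omega x -> 0 < f x.
Local Notation I h := (\int[leb]_(x in Omega) h x).
Hypothesis If1 : I f = 1.
Local Notation wnorm := (weighted_norm2 Omega f).
Local Notation wprod := (weighted_prod Omega f).
Local Notation wdirichlet := (weighted_dirichlet Omega f).
Local Notation wmean := (weighted_mean Omega f).

Let mO := open_measurable_rV oO.
Let fO := bounded_finite_measure oO bO.

Let bf : bmfun Omega f.
Proof. by apply: ext_bm => //; case: C1f. Qed.

Let bC1 w : C1ext Omega w -> bmfun Omega w.
Proof. by move=> cw; apply: ext_bm => //; case: cw. Qed.

Let bp w i : C1ext Omega w -> bmfun Omega (partial i w).
Proof. by move=> cw; apply: ext_bm => //; exact: (cw.2 i).1. Qed.

Let half_sqr i : ((2^-1 : R) ^+ i) ^+ 2 = (4^-1) ^+ i.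
Proof. by rewrite -exprM mulnC exprM (_ : 2^-1 ^+ 2 = 4^-1 :> R) // expr2; lra. Qed.

(** Used to pass to the limit in the identity that defines weak gradients. *)
Let limit_eq (a b : nat -> R) (A B C C' : R) : (forall i, `|a i - A| <= C * (2^-1) ^+ i) ->
  (forall i, `|b i - B| <= C' * (2^-1) ^+ i) -> (forall i, a i = - b i) -> A = - B.
Proof.
move=> hA hB ab; apply/eqP; rewrite -subr_eq0 opprK; apply/eqP.
apply: (@eq0_geometric _ _ (C + C')) => i; rewrite mulrDl.
rewrite (_ : A + B = - (a i - A) - (b i - B)); last by rewrite ab; ring.
by apply: le_trans (ler_normB _ _) _; rewrite normrN; exact: lerD.
Qed.

(** The minimizing sequence converges in H1 to some (w, V). Since the functional is only
    almost minimal at each term, the first variation is small rather than zero, and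
    vanishes in the limit. The test function phi of the weak equation, which is set against
    Lebesgue measure, corresponds to the variation phi / f, made of mean zero by
    subtracting a constant. *)
Lemma rayleigh_eigenvalue (rho : R) : 0 < rho ->
  (forall w, C1ext Omega w -> wmean w = 0 -> rho * wnorm w <= wdirichlet w w) ->
  (forall d, 0 < d -> exists w, [/\ C1ext Omega w, wmean w = 0, wnorm w = 1 &
    wdirichlet w w < rho + d]) ->
  neumann_eigenvalue Omega f rho.
Proof.
move=> rho0 rho_lower rho_inf.
have [psi [cp mp np dp hp]] := minimizing_sequence oO bO cO cf C1f f0 rho0 rho_lower rho_inf.
have bpsi i : bmfun Omega (psi i) by exact: bC1.
have bdpsi k i : bmfun Omega (partial k (psi i)) by exact: bp.
have [w mw hw] := riesz_fischer mO fO bpsi (fun i j ij => (hp i j ij).1).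
have /boolp.choice[V hV] : forall k, exists g : E -> R, measurable_fun Omega g /\
    forall i, (\int[leb]_(x in Omega) ((partial k (psi i) x - g x) ^+ 2)%:E <= ((4^-1) ^+ i)%:E)%E.
  move=> k; have [g mg hg] := riesz_fischer mO fO (bdpsi k) (fun i j ij => (hp i j ij).2 k).
  by exists g.
have pairw b := l2_pair mO fO bpsi mw hw (b := b).
have pairV k b := l2_pair mO fO (bdpsi k) (hV k).1 (hV k).2 (b := b).
have hw0 : (\int[leb]_(x in Omega) ((psi 0%N x - w x) ^+ 2)%:E <= 1)%E.
  by apply: le_trans (hw 0%N) _; rewrite expr0.
have hV0 k : (\int[leb]_(x in Omega) ((partial k (psi 0%N) x - V k x) ^+ 2)%:E <= 1)%E.
  by apply: le_trans ((hV k).2 0%N) _; rewrite expr0.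
have toR g : leb.-integrable Omega (EFin \o g) ->
    (\int[leb]_(x in Omega) (g x)%:E = (I g)%:E)%E.
  by move=> ig; rewrite /Rintegral fineK //; exact: integrable_fin_num.
exists w.
  move=> w0.
  have psi0 i : I (fun x => psi i x ^+ 2) <= (4^-1) ^+ i.
    rewrite -lee_fin -bmfun_integralE //; last exact: bmfunX.
    apply: le_trans (hw i); rewrite le_eqVlt; apply/orP; left; apply/eqP.
    apply: ge0_ae_eq_integral => //.
    - by apply/measurable_EFinP; case: (bmfunX 2 (bpsi i)).
    - apply/measurable_EFinP; apply: measurable_funX; apply: measurable_funB => //.
      by case: (bpsi i).
    - by move=> x _; rewrite lee_fin sqr_ge0.
    - by move=> x _; rewrite lee_fin sqr_ge0.
    - by apply: filterS w0 => x h Ox; rewrite h // subr0.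
  have [_ [L hL]] := bf.
  have n0 i : `|1| <= `|L| * (2^-1) ^+ i.
    rewrite normr1 -[X in X <= _](np i); apply: le_trans (_ : `|L| * I (fun x => psi i x ^+ 2) <= _).
      have b2 := bmfunX 2 (bpsi i).
      rewrite -(bm_Z mO fO _ b2); apply: (bm_le mO fO); [exact: bmfunM|by apply: bmfunM => //; exact: bmfun_cst|].
      move=> x Ox; rewrite mulrC; apply: ler_wpM2r; first exact: sqr_ge0.
      by apply: le_trans (ler_norm _) (le_trans (hL x Ox) (ler_norm _)).
    apply: ler_wpM2l => //; apply: le_trans (psi0 i) _; rewrite -half_sqr expr2.
    by apply: ler_piMr; [rewrite exprn_ge0|rewrite exprn_ile1 // invf_le1 // ler1n].
  by move/eqP: (eq0_geometric n0); rewrite oner_eq0.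
pose VV x : E := \row_k V k x.
exists VV.
  split.
  - by split => //; exact: (l2_finite oO bO (bpsi 0%N) mw hw0).
  - move=> k; have -> : (fun x => VV x ord0 k) = V k by apply/funext => x; rewrite mxE.
    by split; [exact: (hV k).1|exact: (l2_finite oO bO (bdpsi k 0%N) (hV k).1 (hV0 k))].
  - move=> eta teta k; have [ce _] := test_function_C1ext teta.
    have be := bC1 ce; have bde := bp k ce.
    have [i1 h1] := pairw _ bde; have [i2 h2] := pairV k _ be.
    have -> : (\int[leb]_(x in Omega) (VV x ord0 k * eta x)%:E =
       \int[leb]_(x in Omega) (V k x * eta x)%:E)%E by apply: eq_integral => x _; rewrite mxE.
    rewrite !toR // -EFinN; congr EFin; apply: limit_eq h1 h2 _ => i.
    exact: C1_weak_gradient.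
move=> phi /Ck1P[cphi C1phi].
have [civ div] := C1ext_V bO cf f0 C1f.
have [ceta deta] := C1ext_M bO C1phi civ.
set eta := (fun x => phi x * (f x)^-1) in ceta deta.
pose a := wmean eta.
have [ccst dcst] := C1ext_cst Omega (1 : R).
have [ceta0 _ _ meta0] := rayleigh_expand oO bO C1f (- a) ceta ccst.
set eta0 := (fun x => eta x + - a * 1) in ceta0 meta0.
have {}meta0 : wmean eta0 = 0.
  have -> : wmean eta0 = wmean eta + - a * wmean (fun=> 1) by [].
  have -> : wmean (fun=> 1) = 1.
    by rewrite -[RHS]If1; apply: bm_eq => x _; rewrite mul1r.
  by rewrite mulr1 subrr.
pose beta k x := partial k phi x - partial k f x / f x * phi x.
have ei : extends_continuously Omega (fun x => (f x)^-1) by case: civ.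
have bphi := bC1 C1phi.
have binv : bmfun Omega (fun x => (f x)^-1) by exact: ext_bm.
have bbeta k : bmfun Omega (beta k).
  by apply: bmfunB; [exact: bp|apply: bmfunM => //; apply: bmfunM => //; exact: bp].
have fx x : Omega x -> f x != 0 by move=> Ox; rewrite gt_eqF //; apply/f0/subset_closure.
have gradE k x : Omega x -> partial k eta0 x * f x = beta k x.
  move=> Ox; have fn := fx x Ox.
  have [cz dz] := C1ext_Z bO (- a) ccst; have [_ ds] := C1ext_D ceta cz.
  rewrite ds // dz // dcst mulr0 addr0 deta // div // /beta; field; exact: fn.
have var i : `|\sum_k I (fun x => partial k (psi i) x * beta k x) - rho * I (fun x => psi i x * phi x)| <=
    (1 + wdirichlet eta0 eta0) * (2^-1) ^+ i.
  have -> : \sum_k I (fun x => partial k (psi i) x * beta k x) = wdirichlet (psi i) eta0.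
    rewrite -bm_sum //; last by move=> k; exact: bmfunM.
    apply: bm_eq => x Ox; rewrite /dot mulr_suml; apply: eq_bigr => k _.
    by rewrite !mxE -mulrA gradE.
  have -> : I (fun x => psi i x * phi x) = wprod (psi i) eta0.
    have b1 : bmfun Omega (fun x => psi i x * phi x) by exact: bmfunM.
    have b2 : bmfun Omega (fun x => a * (psi i x * f x)).
      by apply: bmfunM; [exact: bmfun_cst|exact: bmfunM].
    have -> : wprod (psi i) eta0 = I (fun x => psi i x * phi x - a * (psi i x * f x)).
      by apply: bm_eq => x Ox; rewrite /eta0 /eta; field; exact: fx.
    rewrite (bm_B mO fO b1 b2) (bm_Z mO fO _ (bmfunM (bpsi i) bf)) -/(wmean (psi i)) mp.
    by rewrite mulr0 subr0.
  apply: (@first_variation_arith R rho rho0 (wdirichlet (psi i) (psi i)) _ _ _ (wnorm eta0)).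
  - by apply: Rintegral_ge0 => x Ox; apply: mulr_ge0; [exact: dot_ge0|apply/ltW/f0/subset_closure].
  - by apply: Rintegral_ge0 => x Ox; apply: mulr_ge0; [exact: sqr_ge0|apply/ltW/f0/subset_closure].
  - move=> t; have [ct nt dt mt] := rayleigh_expand oO bO C1f t (cp i) ceta0.
    by have := rho_lower _ ct; rewrite mt mp meta0 mulr0 addr0 nt dt np; exact.
  - by rewrite exprn_gt0.
  - by rewrite half_sqr; exact: dp.
have [iw limw] := pairw _ bphi.
have limV k := (pairV k _ (bbeta k)).2.
have iV k := (pairV k _ (bbeta k)).1.
have EL : \sum_k I (fun x => V k x * beta k x) = rho * I (fun x => w x * phi x).
  apply/eqP; rewrite -subr_eq0; apply/eqP.
  pose C := \sum_k (I (fun x => beta k x ^+ 2) + 1).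
  pose C' := I (fun x => phi x ^+ 2) + 1.
  apply: (@eq0_geometric _ _ (C + rho * C' + (1 + wdirichlet eta0 eta0))) => i.
  have s1 : `|\sum_k I (fun x => partial k (psi i) x * beta k x) - \sum_k I (fun x => V k x * beta k x)|
      <= C * (2^-1) ^+ i.
    rewrite -sumrB; apply: le_trans (ler_norm_sum _ _ _) _; rewrite mulr_suml.
    by apply: ler_sum => k _; exact: limV.
  have s2 := ler_wpM2l (ltW rho0) (limw i).
  exact: (el_arith rho0 s1 s2 (var i)).
have e1 x : Omega x -> dot (VV x) (grad phi x) - dot (grad (fun y => ln (f y)) x) (VV x) * phi x =
    \sum_k V k x * beta k x.
  move=> Ox; rewrite /dot mulr_suml -sumrB; apply: eq_bigr => k _.
  by rewrite !mxE (partial_ln C1f f0) // /beta; ring.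
have -> : (\int[leb]_(x in Omega) (dot (VV x) (grad phi x) -
     dot (grad (fun y => ln (f y)) x) (VV x) * phi x)%:E =
    \int[leb]_(x in Omega) (\sum_k (V k x * beta k x)%:E))%E.
  by apply: eq_integral => x /set_mem Ox; rewrite e1 // sumEFin.
have -> : (\int[leb]_(x in Omega) (\sum_k (V k x * beta k x)%:E) =
    \sum_k \int[leb]_(x in Omega) (V k x * beta k x)%:E)%E.
  exact: (@integral_sum _ _ _ leb Omega mO _ (fun k x => (V k x * beta k x)%:E)).
under eq_bigr do rewrite toR //.
rewrite sumEFin EL.
have -> : (\int[leb]_(x in Omega) (rho * w x * phi x)%:E =
    \int[leb]_(x in Omega) (rho%:E * (w x * phi x)%:E))%E.
  by apply: eq_integral => x _; rewrite -EFinM mulrA.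
by rewrite integralZl // toR // EFinM.
Qed.

Let rayleigh_normalize w : C1ext Omega w -> wmean w = 0 -> 0 < wnorm w ->
  exists h, [/\ C1ext Omega h, wmean h = 0, wnorm h = 1 & wdirichlet h h = wdirichlet w w / wnorm w].
Proof.
move=> cw mw nw; have [c0 d0] := C1ext_cst Omega (0 : R).
pose t := (Num.sqrt (wnorm w))^-1.
have t2 : t ^+ 2 = (wnorm w)^-1 by rewrite exprVn sqr_sqrtr // ltW.
have [ch nh dh mh] := rayleigh_expand oO bO C1f t c0 cw.
have z (g : E -> R) : (forall x, Omega x -> g x = 0) -> I g = 0.
  by move=> g0; rewrite (bm_eq leb g0) (bm_cst leb mO) mul0r.
have g0 x (g : E) : dot (grad (fun=> 0 : R) x) g = 0.
  rewrite (_ : grad (fun=> 0 : R) x = 0 *: g) ?dotZl ?mul0r //.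
  by apply/rowP => i; rewrite !mxE d0 mul0r.
have z1 : wmean (fun=> 0) = 0 by apply: z => x _; rewrite mul0r.
have z2 : wprod (fun=> 0) w = 0 by apply: z => x _; rewrite !mul0r.
have z3 : wnorm (fun=> 0) = 0 by apply: z => x _; rewrite expr0n mul0r.
have z4 h : wdirichlet (fun=> 0) h = 0 by apply: z => x _; rewrite g0 mul0r.
exists (fun x => 0 + t * w x); split => //.
- by rewrite mh mw mulr0 addr0 z1.
- by rewrite nh t2 mulVf ?gt_eqF // z2 z3 mulr0 !add0r.
- by rewrite dh t2 !z4 mulr0 !add0r mulrC.
Qed.

Lemma wdirichlet_ge0 w : 0 <= wdirichlet w w.
Proof.
by apply: Rintegral_ge0 => x Ox; apply: mulr_ge0; [exact: dot_ge0|apply/ltW/f0/subset_closure].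
Qed.

Lemma wnorm_ge0 w : 0 <= wnorm w.
Proof.
by apply: Rintegral_ge0 => x Ox; apply: mulr_ge0; [exact: sqr_ge0|apply/ltW/f0/subset_closure].
Qed.

(** If the inequality failed for some w, the infimum rho of the Rayleigh quotient would be
    smaller than lambda1; being positive, it would be an eigenvalue. *)
Theorem spectral_gap (lambda1 : R) : 0 < lambda1 ->
  (forall lambda, 0 < lambda -> neumann_eigenvalue Omega f lambda -> lambda1 <= lambda) ->
  forall w, C1ext Omega w -> wmean w = 0 -> lambda1 * wnorm w <= wdirichlet w w.
Proof.
move=> l0 hl w cw mw; rewrite leNgt; apply/negP => bad.
have nw : 0 < wnorm w.
  rewrite lt_neqAle wnorm_ge0 andbT eq_sym; apply/eqP => n0.
  by move: bad; rewrite n0 mulr0 ltNge wdirichlet_ge0.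
pose S := [set d | exists h, [/\ C1ext Omega h, wmean h = 0, wnorm h = 1 & wdirichlet h h = d]].
have [rho0 r0 hr] := weighted_poincare oO bO cO cf C1f f0 If1.
have lbS : lbound S rho0.
  by move=> d [h [ch mh nh <-]]; have := hr h ch mh; rewrite nh mulr1.
have Sw : S (wdirichlet w w / wnorm w) by exact: rayleigh_normalize.
have iS : has_inf S by split; [eexists; exact: Sw|exists rho0].
have rp : 0 < inf S by apply: lt_le_trans r0 _; apply: lb_le_inf => //; eexists; exact: Sw.
have ev : neumann_eigenvalue Omega f (inf S).
  apply: rayleigh_eigenvalue => //.
    move=> h ch mh; have [n0|n0] := eqVneq (wnorm h) 0; first by rewrite n0 mulr0 wdirichlet_ge0.
    have np : 0 < wnorm h by rewrite lt_neqAle eq_sym n0 wnorm_ge0.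
    by rewrite -ler_pdivlMr //; apply: ge_inf; [exists rho0|exact: rayleigh_normalize].
  move=> d d0; have [_ [h [ch mh nh <-]] hd] := inf_adherent d0 iS.
  by exists h.
have := hl _ rp ev; apply/negP; rewrite -ltNge.
apply: le_lt_trans (_ : wdirichlet w w / wnorm w < _); last by rewrite ltr_pdivrMr.
by apply: ge_inf Sw; exists rho0.
Qed.

End eigenvalue.

(** * Transfer of integrals *)

(** The sum counts the integers k < K below v, that is, it rounds v up. *)
Lemma staircase (R : realFieldType) K (v : R) : 0 <= v <= K%:R ->
  v <= \sum_(k < K) (k%:R < v)%R%:R <= v + 1.
Proof.
elim: K => [|K IH] /andP[v0 vK].
  by rewrite big_ord0 vK /=; lra.
rewrite big_ord_recr /=; case: ltP => Kv; last by rewrite addr0 IH // v0.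
rewrite (eq_bigr (fun=> 1)) => [|k _]; last first.
  have -> // : (k%:R < v)%R by apply: le_lt_trans Kv; rewrite ler_nat ltnW.
rewrite sumr_const card_ord; move: vK; rewrite -natr1 mulr1n => vK.
by rewrite vK lerD2r ltW.
Qed.

Section transfer.
Context d1 d2 (T1 : measurableType d1) (T2 : measurableType d2) (R : realType).
Variables (m1 : {measure set T1 -> \bar R}) (m2 : {measure set T2 -> \bar R}).
Variables (D1 : set T1) (D2 : set T2).
Hypotheses (mD1 : measurable D1) (fD1 : (m1 D1 < +oo)%E).
Hypotheses (mD2 : measurable D2) (fD2 : (m2 D2 < +oo)%E).

Lemma bmfun_step (h : T2 -> R) (N : nat) : bmfun D2 h ->
  exists K (A : 'I_K -> set T2) (a : R),
   (forall k, measurable (A k) /\ A k `<=` D2) /\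
   forall x, D2 x -> `|h x - (N.+1%:R^-1 * \sum_k \1_(A k) x + a)| <= N.+1%:R^-1.
Proof.
move=> [mh [M hM]]; pose c : R := N.+1%:R.
have c0 : 0 < c by rewrite ltr0n.
have [K MK] : exists K : nat, c * (2 * M) <= K%:R.
  by exists (Num.bound `|c * (2 * M)|); apply: ltW; apply: le_lt_trans (archi_boundP (normr_ge0 _)); rewrite ler_norm.
exists K, (fun k => D2 `&` h @^-1` `]k%:R / c - M, +oo[%classic), (- M); split.
  by move=> k; split; [exact: mh|exact: subIsetl].
move=> x Dx; have := hM _ Dx; rewrite ler_norml => /andP[h1 h2].
have vK : 0 <= c * (h x + M) <= K%:R.
  apply/andP; split; first by apply: mulr_ge0; [exact: ltW|lra].
  by apply: le_trans MK; rewrite ler_pM2l //; lra.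
have := staircase vK.
rewrite (eq_bigr (fun k : 'I_K => \1_(D2 `&` h @^-1` `]k%:R / c - M, +oo[%classic) x)); last first.
  move=> k _; rewrite indicE; suff -> : (k%:R < c * (h x + M)) =
    (x \in D2 `&` h @^-1` `]k%:R / c - M, +oo[%classic) by [].
  rewrite in_setI (mem_set Dx) /= -ltr_pdivrMl // mulrC -ltrBlDr.
  by apply/idP/idP => [kc|/set_mem/=]; [apply/mem_set; rewrite /= in_itv /= kc|rewrite in_itv /= andbT].
move: (\sum_k _) => S; rewrite -/c => /andP[S1 S2].
have -> : h x - (c^-1 * S - M) = c^-1 * (c * (h x + M) - S).
  by field; rewrite gt_eqF.
rewrite normrM gtr0_norm ?invr_gt0 // ler_piMr ?invr_ge0 ?(ltW c0) //.
by rewrite ler_norml; apply/andP; split; lra.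
Qed.

Variables (tau : T1 -> T2) (p : T1 -> R).
Hypotheses (mtau : measurable_fun D1 tau) (tauD : forall x, D1 x -> D2 (tau x)).

Lemma bmfun_comp (h : T2 -> R) : bmfun D2 h -> bmfun D1 (fun x => h (tau x)).
Proof.
move=> [mh [M hM]]; split; last by exists M => x Dx; exact/hM/tauD.
by apply: (measurable_comp mD2) mh mtau => _ [x Dx <-]; exact: tauD.
Qed.

Hypothesis bp : bmfun D1 p.
Hypothesis m12 : forall A, measurable A -> A `<=` D2 ->
  fine (m2 A) = \int[m1]_(x in D1) (\1_A (tau x) * p x).

(** Linearity and uniform approximation by step functions reduce the formula to indicator
    functions. It covers densities (tau = id), push-forwards (p = 1) and both at once. *)
Lemma bm_transfer (h : T2 -> R) : bmfun D2 h ->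
  \int[m2]_(y in D2) h y = \int[m1]_(x in D1) (h (tau x) * p x).
Proof.
move=> bh; set L := LHS; set Q := RHS.
have [B BE] : exists B, B = fine (m2 D2) + \int[m1]_(x in D1) `|p x| by eexists.
suff H N : `|L - Q| <= B * N.+1%:R^-1.
  apply/eqP; rewrite -subr_eq0; apply/eqP; apply: (@eq0_geometric R _ B) => i.
  have := H (2 ^ i).-1; rewrite prednK ?expn_gt0 // natrX.
  by rewrite exprVn.
have [K [A [a [mA hA]]]] := bmfun_step N bh.
pose s (y : T2) : R := N.+1%:R^-1 * \sum_k \1_(A k) y + a.
have bA k : bmfun D2 (\1_(A k) : T2 -> R) by case: (bm_indic m2 mD2 (proj1 (mA k))).
have bS : bmfun D2 (fun y => \sum_k \1_(A k) y : R) by exact: bmfun_sum.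
have bZ : bmfun D2 (fun y => N.+1%:R^-1 * \sum_k \1_(A k) y : R).
  by apply: bmfunM => //; exact: bmfun_cst.
have bs : bmfun D2 s by apply: bmfunD => //; exact: bmfun_cst.
have bAp k : bmfun D1 (fun x => \1_(A k) (tau x) * p x).
  by apply: bmfunM => //; exact: bmfun_comp.
have m2D : fine (m2 D2) = \int[m1]_(x in D1) p x.
  by rewrite m12 //; apply: bm_eq => x Dx; rewrite indicE (mem_set (tauD Dx)) mul1r.
have sE : \int[m2]_(y in D2) s y = \int[m1]_(x in D1) (s (tau x) * p x).
  rewrite /s (bm_D mD2 fD2 bZ (bmfun_cst _ _)) (bm_Z mD2 fD2 _ bS) (bm_cst m2 mD2) (bm_sum mD2 fD2) //.
  rewrite m2D -(bm_Z mD1 fD1 _ bp).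
  under eq_bigr => k _.
    rewrite (proj2 (bm_indic m2 mD2 (proj1 (mA k)))).
    rewrite (setIidl (proj2 (mA k))) (m12 (proj1 (mA k)) (proj2 (mA k))); over.
  rewrite -(bm_sum mD1 fD1) // -(bm_Z mD1 fD1 _ (bmfun_sum _ _ bAp)) -(bm_D mD1 fD1); first last.
  - by apply: bmfunM => //; exact: bmfun_cst.
  - by apply: bmfunM; [exact: bmfun_cst|exact: bmfun_sum].
  by apply: bm_eq => x Dx; rewrite mulrDl -mulrA mulr_suml.
have bst : bmfun D1 (fun x => s (tau x) * p x) by apply: bmfunM => //; exact: bmfun_comp.
have bht : bmfun D1 (fun x => h (tau x) * p x) by apply: bmfunM => //; exact: bmfun_comp.
have e1 : `|L - \int[m2]_(y in D2) s y| <= N.+1%:R^-1 * fine (m2 D2).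
  rewrite -(bm_B mD2 fD2 bh bs) -(bm_cst m2 mD2).
  apply: (bm_norm_le mD2 fD2) => //; [exact: bmfunB|exact: bmfun_cst].
have e2 : `|Q - \int[m1]_(x in D1) (s (tau x) * p x)| <= N.+1%:R^-1 * \int[m1]_(x in D1) `|p x|.
  rewrite -(bm_B mD1 fD1 bht bst) -(bm_Z mD1 fD1 _ (bmfun_norm bp)).
  apply: (bm_norm_le mD1 fD1) => //; [exact: bmfunB| |].
    by apply: bmfunM; [exact: bmfun_cst|exact: bmfun_norm].
  move=> x Dx; rewrite -mulrBl normrM ler_wpM2r //; apply: hA; exact: tauD.
rewrite -sE in e2; rewrite BE mulrC mulrDr; apply: le_trans (lerD e1 e2).
apply: le_trans (ler_distD (\int[m2]_(y in D2) s y) _ _) _.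
by rewrite lerD2l distrC.
Qed.

End transfer.

(** * Almost everywhere bounds *)

Section almost_everywhere.
Variables (R : realType) (n : nat).
Local Notation E := 'rV[R]_n.
Local Notation leb := (lebesgue_rV R n).
Variable (Omega : set E).
Hypothesis oO : open Omega.

(** A null set contains no dyadic cube, so P holds on a dense subset of Omega. *)
Lemma ae_everywhere (P : E -> Prop) (h : E -> R) K :
  {ae leb, forall x, Omega x -> P x} ->
  (forall x, Omega x -> P x -> h x <= K) ->
  (forall x, Omega x -> {for x, continuous h}) ->
  forall x, Omega x -> h x <= K.
Proof.
move=> [B [mB B0 PB]] Ph ch x Ox; rewrite leNgt; apply/negP => Kh.
have oS : open [set y | Omega y /\ K < h y] by exact: open_superlevel.
have [k hk] := open_dyadic_open oS (conj Ox Kh).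
pose Q : set E := dyadic_cube k (dyadic_index k x).
have QB : Q `<=` B.
  move=> y Qy; apply: PB => /= Py.
  have [Oy] : Omega y /\ K < h y by exact: hk.
  by rewrite ltNge Ph //; exact: Py.
have : (leb Q <= leb B)%E.
  by apply: le_measure => //; rewrite inE //; exact: measurable_dyadic_cube.
by rewrite B0 lebesgue_dyadic_cube lee_fin leNgt !exprn_gt0 ?invr_gt0 ?exprn_gt0.
Qed.

End almost_everywhere.

(** * The operator norm and the Hessian *)

Section operator_norm.
Variables (R : realType) (n : nat).
Local Notation E := 'rV[R]_n.
Implicit Types (x y v : E) (w h : E -> R).

Lemma coord_le_enorm x i : `|x ord0 i| <= enorm x.
Proof.
rewrite -(ler_pXn2r (_ : 0 < 2)%N) ?nnegrE ?enorm_ge0 // enorm_sqr real_normK ?num_real //.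
by rewrite /dot (bigD1 i) //= -expr2 lerDl; apply: sumr_ge0 => j _; rewrite -expr2 sqr_ge0.
Qed.

Lemma enormZ a x : enorm (a *: x) = `|a| * enorm x.
Proof.
by rewrite /enorm dotZl dotZr mulrA -expr2 sqrtrM ?sqr_ge0 // sqrtr_sqr.
Qed.

Lemma enorm_eq0 x : enorm x = 0 -> x = 0.
Proof. by move=> h; apply: dot_eq0; rewrite -enorm_sqr h expr0n. Qed.

Lemma norm_le_enorm x : `|x| <= enorm x.
Proof. by apply: norm_le_coord; [exact: enorm_ge0|exact: coord_le_enorm]. Qed.

Lemma enorm_le_norm x : enorm x <= n%:R * `|x|.
Proof.
rewrite -(ler_pXn2r (_ : 0 < 2)%N) ?nnegrE ?enorm_ge0 ?mulr_ge0 //.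
rewrite enorm_sqr; apply: le_trans (dot_norm_le x) _.
rewrite exprMn ler_wpM2r ?sqr_ge0 //.
by rewrite -natrX ler_nat; case: (n) => // m; rewrite expnS leq_pmulr.
Qed.

Lemma opnorm_ub (A : 'M[R]_n) x : enorm x <= 1 -> enorm (x *m A) <= opnorm A.
Proof.
move=> x1; apply: ub_le_sup; last by exists x.
exists (n%:R * \sum_i \sum_j `|A i j|) => _ [y y1 <-].
apply: le_trans (enorm_le_norm _) _; rewrite ler_wpM2l //.
apply: norm_le_coord; first by apply: sumr_ge0 => i _; apply: sumr_ge0.
move=> j; rewrite mxE; apply: le_trans (ler_norm_sum _ _ _) _.
apply: ler_sum => i _; rewrite normrM.
apply: le_trans (_ : `|A i j| <= _).
  by rewrite ler_piMl // (le_trans (coord_le_enorm _ _)).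
by rewrite (bigD1 j) //= lerDl; apply: sumr_ge0.
Qed.

Lemma opnorm_form (A : 'M[R]_n) x y : dot (x *m A) y <= opnorm A * enorm x * enorm y.
Proof.
have [x0|x0] := eqVneq (enorm x) 0.
  by rewrite x0 mulr0 mul0r (enorm_eq0 x0) mul0mx /dot big1 // => i _; rewrite mxE mul0r.
have xp : 0 < enorm x by rewrite lt_neqAle eq_sym x0 enorm_ge0.
apply: le_trans (dot_le_enorm _ _) _; rewrite ler_wpM2r ?enorm_ge0 //.
have := @opnorm_ub A ((enorm x)^-1 *: x).
rewrite enormZ ger0_norm ?invr_ge0 ?enorm_ge0 // mulVf // => /(_ (lexx _)).
rewrite -scalemxAl enormZ ger0_norm ?invr_ge0 ?enorm_ge0 //.
by rewrite ler_pdivrMl // mulrC.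
Qed.

End operator_norm.

Section hessian_bound.
Variables (R : realType) (n : nat).
Local Notation E := 'rV[R]_n.
Implicit Types (x y v : E).
Variable (Omega : set E).
Hypotheses (oO : open Omega) (bO : bounded_set Omega).
Hypothesis cO : convex_set (Omega : set (convex_lmodType E)).
Variables (w : E -> R) (K : R).
Hypothesis sw : smooth_closure Omega w.
Hypothesis hK : ae_upper_bound Omega (fun x => opnorm (hessian w x)) K.

(** The operator norm is a supremum of quadratic expressions in the Hessian that are
    continuous in x, so the bound extends to all of Omega for each of them. *)
Lemma hessian_form_le x v v' : Omega x ->
  dot (v *m hessian w x) v' <= K * enorm v * enorm v'.
Proof.
apply: (ae_everywhere oO (h := fun x => dot (v *m hessian w x) v') hK) => [{}x Ox hx|{}x Ox].
  by apply: le_trans (opnorm_form _ _ _) _; rewrite ler_wpM2r ?enorm_ge0 // ler_wpM2r ?enorm_ge0.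
apply: (ext_cont oO bO) => //; rewrite /dot.
apply: ext_sum => j; apply: ext_M => //; last exact: ext_cst.
apply: (eq_ext (h := fun x => \sum_i v ord0 i * partial i (partial j w) x)).
  by move=> y Oy; rewrite mxE; apply: eq_bigr => i _; rewrite mxE.
apply: ext_sum => i; apply: ext_M => //; first exact: ext_cst.
by have [_ /(_ i)[]] := smooth_C1_partial j sw.
Qed.

Lemma hessian_entry_le x i j : Omega x -> `|hessian w x i j| <= K.
Proof.
move=> Ox.
have d1 k : enorm (delta_mx ord0 k : E) = 1.
  rewrite /enorm /dot (bigD1 k) //= !mxE !eqxx /= mulr1 big1 ?addr0 ?sqrtr1 // => l lk.
  by rewrite !mxE (negbTE lk) andbF mulr0.
have e (s : R) : dot (s *: delta_mx ord0 i *m hessian w x) (delta_mx ord0 j) = s * hessian w x i j.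
  rewrite -scalemxAl dotZl; congr (_ * _).
  rewrite -rowE /dot (bigD1 j) //= !mxE !eqxx mulr1 big1 ?addr0 // => l lj.
  by rewrite !mxE (negbTE lj) andbF mulr0.
have := hessian_form_le (1 *: delta_mx ord0 i) (delta_mx ord0 j) Ox.
have := hessian_form_le (-1 *: delta_mx ord0 i) (delta_mx ord0 j) Ox.
rewrite !e !enormZ !d1 normrN normr1 !mulr1 => h1 h2.
by rewrite ler_norml; apply/andP; split; lra.
Qed.

(** The mean value theorem along the segment, for the scalar function z |-> grad w z . v. *)
Lemma grad_lipschitz x y v : Omega x -> Omega y ->
  dot (grad w y - grad w x) v <= K * enorm (y - x) * enorm v.
Proof.
move=> Ox Oy; pose h (z : E) := \sum_j v ord0 j * partial j w z.
have Z j := C1ext_Z bO (v ord0 j) (smooth_C1_partial j sw).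
have gh (z : E) : Omega z -> forall i, is_derive z (delta_mx ord0 i) h
    (\sum_j v ord0 j * partial i (partial j w) z).
  move=> Oz i; have -> : h = \sum_j (fun z => v ord0 j * partial j w z).
    by apply/funext => t; rewrite fct_sumE.
  apply: is_derive_sum => j.
  have [[_ /(_ i)[_ /(_ z Oz) dz]] /(_ i z Oz) pz] := Z j.
  by rewrite -pz; exact: derivableP.
have C1h : C1on Omega h.
  move=> z Oz i; split; first by have [] := gh z Oz i.
  apply: (ext_cont oO bO) => //.
  apply: (eq_ext (h := fun z => \sum_j v ord0 j * partial i (partial j w) z)).
    by move=> t Ot; rewrite /partial; have [_ ->] := gh t Ot i.
  apply: ext_sum => j; apply: ext_M => //; first exact: ext_cst.
  by have [_ /(_ i)[]] := smooth_C1_partial j sw.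
have [s /andP[s0 s1]] := C1_MVT oO C1h (fun s hs => convex_segment cO Ox Oy hs).
rewrite (addrC x) subrK => hE.
have -> : dot (grad w y - grad w x) v = h y - h x.
  by rewrite dotBl /dot /h; congr (_ - _); apply: eq_bigr => i _; rewrite mxE mulrC.
have Os : Omega (x + s *: (y - x)) by apply: convex_segment => //; rewrite !ltW.
rewrite hE; apply: le_trans (hessian_form_le (y - x) v Os); rewrite le_eqVlt; apply/orP; left; apply/eqP.
have pd i : partial i h (x + s *: (y - x)) =
    \sum_j v ord0 j * partial i (partial j w) (x + s *: (y - x)).
  by rewrite {1}/partial; have [_ ->] := gh _ Os i.
rewrite /dot; under eq_bigr => i _ do rewrite mxE pd mulr_suml.
rewrite exchange_big /=; apply: eq_bigr => j _; rewrite mxE mulr_suml.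
by apply: eq_bigr => i _; rewrite [hessian _ _ _ _]mxE; ring.
Qed.

Lemma taylor_bound x y : 0 <= K -> Omega x -> Omega y ->
  `|w y - w x - dot (grad w x) (y - x)| <= K * dot (y - x) (y - x).
Proof.
move=> K0 Ox Oy.
have [s /andP[s0 s1]] := C1_MVT oO (C1ext_C1on oO bO (smooth_C1 sw)) (fun s hs => convex_segment cO Ox Oy hs).
rewrite (addrC x) subrK addrC => ->.
have Oz : Omega (x + s *: (y - x)) by apply: convex_segment => //; rewrite !ltW.
have h v : enorm v = enorm (y - x) ->
    dot (grad w (x + s *: (y - x)) - grad w x) v <= K * dot (y - x) (y - x).
  move=> vE; apply: le_trans (grad_lipschitz v Ox Oz) _.
  rewrite addrAC subrr add0r enormZ vE -enorm_sqr expr2 mulrA ler_wpM2r ?enorm_ge0 //.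
  by rewrite ler_wpM2l // ler_piMl ?enorm_ge0 // gtr0_norm // ltW.
have dN (a b : E) : - dot a b = dot a (-1 *: b) by rewrite dotZr mulN1r.
rewrite -dotBl ler_norml lerNl dN !h //.
by rewrite enormZ normrN normr1 mul1r.
Qed.

End hessian_bound.

(** * The determinant *)

Section determinant.
Variables (R : realDomainType) (n : nat).

Lemma prod_lipschitz (I : Type) (r : seq I) (a b : I -> R) (M d : R) : 1 <= M ->
  (forall i, `|a i| <= M) -> (forall i, `|b i| <= M) -> (forall i, `|a i - b i| <= d) ->
  `|\prod_(i <- r) a i - \prod_(i <- r) b i| <= (size r)%:R * M ^+ size r * d.
Proof.
move=> M1 aM bM abd; have M0 : 0 <= M by apply: le_trans M1.
have p1 m : 1 <= M ^+ m by exact: exprn_ege1.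
elim: r => [|i r IH]; first by rewrite !big_nil subrr normr0 !mul0r.
have pb : `|\prod_(j <- r) b j| <= M ^+ size r.
  elim: (r) => [|j r' IH']; first by rewrite big_nil normr1.
  by rewrite big_cons /= exprS normrM ler_pM.
have d0 : 0 <= d by apply: le_trans (abd i).
rewrite !big_cons /=.
have -> : a i * \prod_(j <- r) a j - b i * \prod_(j <- r) b j =
  a i * (\prod_(j <- r) a j - \prod_(j <- r) b j) + (a i - b i) * \prod_(j <- r) b j by ring.
apply: le_trans (ler_normD _ _) _; rewrite !normrM.
have h1 : `|a i| * `|\prod_(j <- r) a j - \prod_(j <- r) b j| <= M * ((size r)%:R * M ^+ size r * d).
  by apply: ler_pM.
have h2 : `|a i - b i| * `|\prod_(j <- r) b j| <= d * M ^+ size r by apply: ler_pM.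
apply: le_trans (lerD h1 h2) _.
rewrite -natr1 exprS !mulrDl mul1r !mulrA lerD //; first by rewrite (mulrC M).
by rewrite mulrC ler_wpM2r // ler_peMl // (le_trans ler01).
Qed.

(** Leibniz formula: a sum of n! products of n entries. *)
Lemma det_lipschitz (A B : 'M[R]_n) (M d : R) : 1 <= M ->
  (forall i j, `|A i j| <= M) -> (forall i j, `|B i j| <= M) -> (forall i j, `|A i j - B i j| <= d) ->
  `|\det A - \det B| <= (n`!)%:R * (n%:R * M ^+ n * d).
Proof.
move=> M1 aM bM abd; rewrite /determinant -sumrB.
apply: le_trans (ler_norm_sum _ _ _) _.
rewrite mulr_natl -[in leRHS]card_Sn -sumr_const; apply: ler_sum => s _.
rewrite -mulrBr normrM normrX normrN1 expr1n mul1r.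
have := @prod_lipschitz _ (index_enum 'I_n) (fun i => A i (s i)) (fun i => B i (s i)) M d M1.
by rewrite -[index_enum _]enumT size_enum_ord; apply.
Qed.

End determinant.

(** * Densities and push-forwards *)

(** Setting h to 0 outside D reduces this to functions that are measurable everywhere. *)
Lemma measurable_rV_on (R : realType) (n : nat) d (T : measurableType d) (D : set T) (h : T -> 'rV[R]_n) :
  measurable D -> (forall i, measurable_fun D (fun x => h x ord0 i)) -> measurable_fun D h.
Proof.
move=> mD mh; pose k x := if x \in D then h x else 0.
suff : measurable_fun D k.
  by apply: eq_measurable_fun => x xD; rewrite /k xD.
apply: measurable_funTS; apply: measurable_fun_rV => i.
have -> : rV_coord i \o k = (fun x => h x ord0 i) \_ D.
  by apply/funext => x; rewrite /rV_coord /k patchE /=; case: ifP => //; rewrite mxE.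
exact/(measurable_restrictT _ mD).
Qed.

Section densities.
Variables (R : realType) (n : nat).
Local Notation E := 'rV[R]_n.
Local Notation leb := (lebesgue_rV R n).
Implicit Types (h : E -> R).
Variable (Omega : set E).
Hypotheses (oO : open Omega) (bO : bounded_set Omega).

Let mO : measurable Omega. Proof. exact: open_measurable_rV. Qed.
Let fO : (leb Omega < +oo)%E. Proof. exact: bounded_finite_measure. Qed.

Section one_density.
Variables (mu : probability E R) (f : E -> R).
Hypotheses (df : has_density Omega mu f) (bf : bmfun Omega f).

Lemma density_setE A : measurable A -> A `<=` Omega ->
  mu A = (\int[leb]_(x in A) f x)%:E.
Proof.
move=> mA AO; rewrite df // (setIidl AO) (bmfun_integralE mA) //.
  by apply: le_lt_trans fO; apply: le_measure; rewrite ?inE.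
exact: bmfun_sub bf.
Qed.

Lemma density_total : mu Omega = 1%E /\ \int[leb]_(x in Omega) f x = 1.
Proof.
have h : mu Omega = 1%E by rewrite -(@probability_setT _ _ _ mu) !df // setIid setTI.
by split => //; apply: EFin_inj; rewrite -density_setE.
Qed.

Lemma density_integral h : bmfun Omega h ->
  \int[mu]_(x in Omega) h x = \int[leb]_(x in Omega) (h x * f x).
Proof.
move=> bh; have mufin : (mu Omega < +oo)%E by rewrite density_total.1 ltry.
apply: (bm_transfer mO fO mO mufin (@measurable_id _ _ _) (fun x Ox => Ox) bf) => //.
move=> A mA AO; transitivity (fine (mu A)) => //; rewrite density_setE //=.
rewrite (integral_outside (D := A) mO mA AO fO).
- by apply: (bm_eq leb) => x Ax; rewrite indicE mem_set // mul1r.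
- by apply: bmfunM => //; case: (bm_indic leb mO mA).
- by move=> x Ox nA; rewrite indicE memNset // mul0r.
Qed.

End one_density.

Section transport_map.
Variables (mu nu : probability E R) (f g : E -> R) (T : E -> E).
Hypotheses (df : has_density Omega mu f) (bf : bmfun Omega f).
Hypotheses (dg : has_density Omega nu g) (bg : bmfun Omega g).
Hypothesis f0 : forall x, Omega x -> 0 <= f x.
Hypothesis mT : measurable_fun Omega T.
Hypothesis push : pushes_forward Omega mu nu T.

(** T maps almost all of Omega to Omega, since nu has total mass 1 there; integrals of
    functions composed with T are taken on this subset. *)
Definition stays := Omega `&` T @^-1` Omega.

Lemma measurable_stays : measurable stays.
Proof. exact: mT. Qed.

Lemma stays_sub : stays `<=` Omega.
Proof. by move=> x []. Qed.

Lemma stays_finite : (leb stays < +oo)%E.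
Proof.
by apply: le_lt_trans fO; apply: le_measure; rewrite ?inE //; [exact: measurable_stays|exact: stays_sub].
Qed.

Lemma stays_map : measurable_fun stays T.
Proof. by apply: measurable_funS mT => //; exact: stays_sub. Qed.

Let bS h : bmfun Omega h -> bmfun stays h.
Proof.
move=> [mh [M hM]]; split; last by exists M => x [/hM].
by apply: measurable_funS mh => //; exact: stays_sub.
Qed.

Lemma push_stays A : measurable A -> A `<=` Omega -> nu A = mu (stays `&` T @^-1` A).
Proof.
move=> mA AO; rewrite push //; congr (mu _); apply/seteqP; split => x /=.
  by move=> [Ox Ax]; do 2?split => //; exact: AO.
by move=> [[]].
Qed.

Lemma mu_stays : mu stays = 1%E.
Proof. by rewrite -(density_total dg bg).1 push_stays // /stays -setIA setIid. Qed.

Lemma push_integral h : bmfun Omega h ->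
  \int[leb]_(x in Omega) (h x * g x) = \int[leb]_(x in stays) (h (T x) * f x).
Proof.
move=> bh; rewrite -(density_integral dg bg bh).
have mS := measurable_stays; have mTS := stays_map.
have nufin : (nu Omega < +oo)%E by rewrite (density_total dg bg).1 ltry.
apply: (bm_transfer mS stays_finite mO nufin mTS _ (bS bf)) => //; first by move=> x [].
move=> A mA AO; have mSA : measurable (stays `&` T @^-1` A) by exact: mTS.
have SO : stays `&` T @^-1` A `<=` Omega by move=> x [[]].
transitivity (fine (nu A)) => //; rewrite push_stays // (density_setE df bf mSA SO) /=.
rewrite (integral_outside (D := stays `&` T @^-1` A) mS mSA _ stays_finite).
- by apply: (bm_eq leb) => x [_ Ax]; rewrite indicE mem_set // mul1r.
- by move=> x [].
- apply: bmfunM; last exact: bS.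
  split; last by exists 1 => x _; rewrite indicE; case: (_ \in _); rewrite ?normr1 ?normr0.
  by apply: (measurable_comp (F := setT)) => //; exact: measurable_indic.
- by move=> x Sx nA; rewrite indicE memNset ?mul0r // => Ax; exact: nA.
Qed.

(** Omega minus this subset is a null set for mu, since both have mu-mass 1. *)
Lemma stays_full h : bmfun Omega h ->
  \int[leb]_(x in stays) (h x * f x) = \int[leb]_(x in Omega) (h x * f x).
Proof.
move=> bh; have mS := measurable_stays.
have mSc : measurable (Omega `\` stays) by exact: measurableD.
pose k x : R := \1_(Omega `\` stays) x.
have [bk _] := bm_indic leb mO mSc.
have k0 : \int[leb]_(x in Omega) (k x * f x) = 0.
  rewrite -(density_integral df bf bk) /Rintegral integral_indic //.
  rewrite (setIidl (@subDsetl _ _ _)); transitivity (fine (mu (Omega `\` stays))) => //.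
  rewrite measureD //; last by apply: le_lt_trans (probability_le1 _ _) _ => //; exact: ltry.
  have e1 := (density_total df bf).1; have e2 := mu_stays.
  rewrite (setIidr stays_sub); move: e1 e2 => /= -> ->; by rewrite subee.
have [_ [M hM]] := bh.
have [S SE] : exists S : set E, S = stays by eexists.
have e : \int[leb]_(x in stays) (h x * f x) =
    \int[leb]_(x in Omega) ((1 - k x) * (h x * f x)).
  rewrite [RHS](integral_outside (D := stays) mO mS stays_sub fO).
  - apply: (bm_eq leb) => x Sx; rewrite /k indicE memNset ?subr0 ?mul1r //.
    by move=> [].
  - by apply: bmfunM; [apply: bmfunB => //; exact: bmfun_cst|exact: bmfunM].
  - by move=> x Ox nS; rewrite /k indicE mem_set ?subrr ?mul0r.
rewrite e; apply/esym/eqP; rewrite -subr_eq0 -normr_le0.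
rewrite -(bm_B mO fO); first last.
- by apply: bmfunM; [apply: bmfunB => //; exact: bmfun_cst|exact: bmfunM].
- exact: bmfunM.
rewrite -(mulr0 M) -k0 -(bm_Z mO fO M (bmfunM bk bf)).
apply: (bm_norm_le mO fO).
- apply: bmfunB; first exact: bmfunM.
  by apply: bmfunM; [apply: bmfunB => //; exact: bmfun_cst|exact: bmfunM].
- by apply: bmfunM; [exact: bmfun_cst|exact: bmfunM].
move=> x Ox; have -> : h x * f x - (1 - k x) * (h x * f x) = h x * (k x * f x) by ring.
rewrite normrM [`|k x * f x|]ger0_norm; last by rewrite mulr_ge0 ?f0 // /k indicE.
by rewrite ler_wpM2r ?hM // mulr_ge0 ?f0 // /k indicE.
Qed.

End transport_map.
End densities.

(** * Pointwise inequalities *)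

Section cutoff.
Variable (R : realFieldType).
Implicit Types (a b d k e : R).

(** A Lipschitz function of the density: 1 below d, 0 above 2 d. *)
Definition cutoff d a := Num.min 1 (Num.max 0 (2 - a / d)).

Lemma cutoff_bounds d a : 0 <= cutoff d a <= 1.
Proof.
by rewrite /cutoff le_min ler01 /= ge_min lexx /= andbT le_max lexx.
Qed.

Lemma cutoff_eq1 d a : 0 < d -> a <= d -> cutoff d a = 1.
Proof.
move=> d0 ad; apply/min_idPl; rewrite le_max; apply/orP; right.
have : a / d <= 1 by rewrite ler_pdivrMr // mul1r.
lra.
Qed.

Lemma cutoff_eq0 d a : 0 < d -> 2 * d <= a -> cutoff d a = 0.
Proof.
move=> d0 ad; rewrite /cutoff; have h : 2 <= a / d by rewrite ler_pdivlMr.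
by rewrite (max_idPl _) ?(min_idPr _) //; lra.
Qed.

Lemma cutoff_lipschitz d a b : 0 < d -> `|cutoff d a - cutoff d b| <= `|a - b| / d.
Proof.
move=> d0; have -> : `|a - b| / d = `|(2 - a / d) - (2 - b / d)|.
  have -> : (2 - a / d) - (2 - b / d) = (b - a) * d^-1 by ring.
  by rewrite normrM (gtr0_norm (_ : 0 < d^-1)) ?invr_gt0 // distrC.
rewrite /cutoff; move: (2 - a / d) (2 - b / d) => p q.
have maxl (x y : R) : `|Num.max 0 x - Num.max 0 y| <= `|x - y|.
  have := ler_norm (x - y); have := ler_norm (- (x - y)); rewrite normrN => h1 h2.
  rewrite !maxEle ler_norml; case: (leP 0 x) => ?; case: (leP 0 y) => ?; apply/andP; split; lra.
have minl (x y : R) : `|Num.min 1 x - Num.min 1 y| <= `|x - y|.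
  have := ler_norm (x - y); have := ler_norm (- (x - y)); rewrite normrN => h1 h2.
  rewrite !minEle ler_norml; case: (leP 1 x) => ?; case: (leP 1 y) => ?; apply/andP; split; lra.
exact: le_trans (minl _ _) (maxl _ _).
Qed.

(** When a and b are comparable, the cutoffs differ only if b <= 4 d, and then by at most
    |a - b| / d. *)
Lemma cutoff_comparable d a b k e : 0 < d -> 0 < a -> 0 < b -> `|a - b| <= k * e * b -> 0 <= k * e -> 4 * (k * e) <= 1 ->
  `|cutoff d a - cutoff d b| <= 4 * (k * e) * (b <= 4 * d)%R%:R.
Proof.
move=> d0 a0 b0 ab ke0 ke; move: (k * e) ab ke0 ke => s ab s0 s1.
have [bd|bd] := leP b (4 * d).
  rewrite mulr1; apply: le_trans (cutoff_lipschitz _ _ d0) _.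
  rewrite ler_pdivrMr //; apply: le_trans ab _.
  rewrite (mulrC 4) -mulrA ler_wpM2l //.
have h : 2 * d <= a.
  move: ab; rewrite ler_norml => /andP[ab _].
  have : s * b <= 4^-1 * b by apply: ler_wpM2r; [exact: ltW|lra].
  lra.
by rewrite !cutoff_eq0 ?subrr ?normr0 ?mulr0 //; lra.
Qed.

(** Young's inequality with weight r = b / a. Here a and b are the densities at x and at
    T_t x, G and H the squared gradients, and p the scalar
    product of the gradients. Since q = C2 e^2 is at most
    a / 4, the bound b >= a (1 - s) - q, with s = C1 e <= 1 / 4, can be inverted into
    a^2 <= b (a (1 + 2 s) + 2 q), which says without quotients that
    1 / r <= 1 + 2 s + 2 q / a. *)
Lemma action_arith a b p G H A' w C1 C2 e : 0 < a -> 0 <= w <= 1 -> 0 < A' -> 0 <= G -> 0 <= H ->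
  0 <= C1 * e -> 4 * (C1 * e) <= 1 -> 0 <= C2 -> p ^+ 2 <= G * H -> 0 <= b ->
  (w = 0 \/ (4 * (C2 * e ^+ 2) <= a)) ->
  a * (1 - C1 * e) - C2 * e ^+ 2 <= b ->
  w * p * a <= A' / 2 * (G * b) + (2 * A')^-1 * (H * (a * (1 + 2 * (C1 * e)) + 2 * (C2 * e ^+ 2))).
Proof.
move=> a0 /andP[w0 w1] A0 G0 H0 s0 s1 C20 pGH b0 hw hb.
have q0 : 0 <= C2 * e ^+ 2 by rewrite mulr_ge0 ?sqr_ge0.
move: (C1 * e) (C2 * e ^+ 2) s0 s1 q0 hw hb => s q s0 s1 q0 hw hb.
have Q0 : 0 <= a * (1 + 2 * s) + 2 * q by apply: addr_ge0; [apply: mulr_ge0; [exact: ltW|lra]|lra].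
have rhs0 : 0 <= A' / 2 * (G * b) + (2 * A')^-1 * (H * (a * (1 + 2 * s) + 2 * q)).
  have i0 : 0 <= (2 * A')^-1 by rewrite invr_ge0 mulr_ge0 // ltW.
  by apply: addr_ge0; apply: mulr_ge0 => //; [exact: divr_ge0 (ltW A0) _|exact: mulr_ge0|exact: mulr_ge0].
case: hw => [->|hw]; first by rewrite !mul0r.
set Q := a * _ + _ in Q0 rhs0 *.
have aa : a ^+ 2 <= b * Q.
  apply: (@le_trans _ _ ((a * (1 - s) - q) * Q)); last by rewrite ler_wpM2r.
  rewrite /Q; have qa : q <= a / 4 by lra.
  have h1 : 0 <= a * s * (a * (1 - 2 * s)) by rewrite !mulr_ge0 ?(ltW a0) //; lra.
  have h2 : 0 <= q * (a / 4 - q) by rewrite mulr_ge0 // subr_ge0.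
  have h3 : 0 <= (q * a) * (1 - 4 * s) by rewrite !mulr_ge0 ?(ltW a0) //; lra.
  nra.
have h : w * p * a <= `|p * a|.
  rewrite -mulrA; apply: le_trans (ler_norm _) _; rewrite normrM ger0_norm //.
  by rewrite ler_piMl.
apply: le_trans h _; rewrite -(ler_pXn2r (_ : 0 < 2)%N) ?nnegrE // -normrX ger0_norm ?sqr_ge0 //.
rewrite exprMn.
have h1 : p ^+ 2 * a ^+ 2 <= (G * b) * (H * Q).
  have -> : (G * b) * (H * Q) = (G * H) * (b * Q) by ring.
  by rewrite ler_pM ?sqr_ge0.
apply: le_trans h1 _; move: (G * b) (H * Q) => X Y.
rewrite -subr_ge0.
have -> : (A' / 2 * X + (2 * A')^-1 * Y) ^+ 2 - X * Y = (A' / 2 * X - (2 * A')^-1 * Y) ^+ 2.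
  by field; rewrite gt_eqF.
exact: sqr_ge0.
Qed.

(** The weight A + e rather than A keeps e^2 / (A + e) below e even when A = 0. *)
Lemma budget_arith A e K1 k1 C1 C2 V : 0 < e <= 1 -> 0 <= A <= K1 -> 0 <= k1 -> 0 <= C1 -> 0 <= C2 -> 0 <= V ->
  (A + e) / 2 * (1 + k1 * e) + (2 * (A + e))^-1 *
    (A ^+ 2 * (1 + 2 * (C1 * e)) + 2 * (C2 * e ^+ 2) * (K1 ^+ 2 * V)) <=
  A + e * (2^-1 + (K1 + 1) * k1 / 2 + C1 * K1 + C2 * (K1 ^+ 2 * V)).
Proof.
move=> /andP[e0 e1] /andP[A0 AK] k0 C10 C20 V0.
have Ae : 0 < A + e by lra.
have kv0 : 0 <= C2 * (K1 ^+ 2 * V) by rewrite mulr_ge0 // mulr_ge0 ?sqr_ge0.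
have -> : 2 * (C2 * e ^+ 2) * (K1 ^+ 2 * V) = 2 * e ^+ 2 * (C2 * (K1 ^+ 2 * V)) by ring.
move: (C2 * _) kv0 => W W0.
have h1 : (2 * (A + e))^-1 * (A ^+ 2 * (1 + 2 * (C1 * e)) + 2 * e ^+ 2 * W) <= A / 2 + C1 * K1 * e + e * W.
  rewrite ler_pdivrMl ?mulr_gt0 //.
  have a1 : A ^+ 2 <= (A + e) * A by rewrite expr2 ler_wpM2r //; lra.
  have a2 : A ^+ 2 * (C1 * e) <= (A + e) * (K1 * (C1 * e)).
    rewrite [leRHS]mulrA; apply: ler_wpM2r; first by rewrite mulr_ge0 // ltW.
    by rewrite expr2; apply: ler_pM => //; lra.
  have a3 : e ^+ 2 * W <= (A + e) * (e * W).
    rewrite expr2 -[leLHS]mulrA; apply: ler_wpM2r; last by lra.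
    by rewrite mulr_ge0 // ltW.
  nra.
have h2 : (A + e) / 2 * (1 + k1 * e) <= A / 2 + e / 2 + e * ((K1 + 1) * k1 / 2).
  have : (A + e) * (k1 * e) <= (K1 + 1) * (k1 * e) by apply: ler_wpM2r; [rewrite mulr_ge0 // ltW|lra].
  nra.
nra.
Qed.

Lemma bernoulli_inv (N : nat) (x : R) : 0 <= x <= 1 -> 2 * (N%:R * x) <= 1 ->
  2^-1 <= (1 - x) ^+ N /\ ((1 - x) ^+ N)^-1 <= 1 + 2 * (N%:R * x).
Proof.
move=> /andP[x0 x1] h.
have b : 1 - N%:R * x <= (1 - x) ^+ N.
  elim: N {h} => [|N IH]; first by rewrite mul0r subr0 expr0.
  rewrite exprS; have := ler_wpM2l (_ : 0 <= 1 - x) IH; rewrite subr_ge0 => /(_ x1).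
  apply: le_trans; rewrite -natr1.
  have : 0 <= N%:R * (x * x) by rewrite !mulr_ge0.
  nra.
have y0 : 0 <= N%:R * x by rewrite mulr_ge0.
move: (N%:R * x) y0 h b => y y0 h b.
have c0 : 0 < (1 - x) ^+ N by lra.
split; first lra.
rewrite -[leLHS]mul1r ler_pdivrMr //.
have : (1 + 2 * y) * (1 - y) <= (1 + 2 * y) * (1 - x) ^+ N by rewrite ler_wpM2l //; lra.
nra.
Qed.

End cutoff.

(** * The dual norm tested against smooth functions *)

Lemma cutoff_budget (R : realFieldType) (C1 Ku e X Y Z W M : R) : 0 < e -> 0 <= C1 -> 0 <= Ku ->
  X <= 4 * (C1 * e) * Y -> Y <= (1 + Ku) * W -> Z <= Ku * W -> W <= e * M ->
  X + e * Z <= e ^+ 2 * ((4 * C1 * (1 + Ku) + Ku) * M).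
Proof.
move=> e0 C10 Ku0 e2 e3 e4 e5.
have Ce : 0 <= 4 * (C1 * e) by rewrite !mulr_ge0 // ltW.
have h1 : (1 + Ku) * W <= (1 + Ku) * (e * M) by rewrite ler_wpM2l // addr_ge0.
have h2 : Ku * W <= Ku * (e * M) by rewrite ler_wpM2l.
have h3 : X <= 4 * (C1 * e) * ((1 + Ku) * (e * M)).
  by apply: le_trans e2 _; rewrite ler_wpM2l // (le_trans e3).
have h4 : e * Z <= e * (Ku * (e * M)) by rewrite ler_wpM2l ?(ltW e0) // (le_trans e4).
apply: le_trans (lerD h3 h4) _; rewrite le_eqVlt; apply/orP; left; apply/eqP; ring.
Qed.

(** Here a, fT and fz stand for the values of f at x, T x and T_t x, q for |T x - x|^2, and
    p for the derivative of f at T_t x along T x - x. *)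
Lemma chord_arith (R : realFieldType) (t K q qm p a fT fz s : R) : 0 <= q -> q <= qm ->
  0 <= t -> t <= 1 -> 0 <= K -> a * (1 - s) <= fT -> 0 < a -> 0 <= s ->
  fT - fz - (1 - t) * p <= K * ((1 - t) * ((1 - t) * q)) ->
  a - fz - (- t * p) <= K * (- t * (- t * q)) ->
  a * (1 - s) - K * qm <= fz.
Proof.
move=> q0 q1 t0 t1 K0 h a0 s0 h1 h2.
have t1' : 0 <= 1 - t by lra.
have m1 : t * (fT - fz - (1 - t) * p) <= t * (K * ((1 - t) * ((1 - t) * q))) by rewrite ler_wpM2l.
have m2 : (1 - t) * (a - fz - (- t * p)) <= (1 - t) * (K * (- t * (- t * q))) by rewrite ler_wpM2l.
have m3 : t * (a * (1 - s)) <= t * fT by rewrite ler_wpM2l.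
have m4 : (1 - t) * (a * (1 - s)) <= (1 - t) * a.
  by rewrite ler_wpM2l // ler_piMr ?(ltW a0) //; lra.
have m5 : t * (1 - t) * (K * q) <= 1 * (K * qm).
  have tt : 0 <= t * t by rewrite mulr_ge0.
  apply: ler_pM; rewrite ?mulr_ge0 ?ler_wpM2l //.
  have -> : t * (1 - t) = t - t * t by ring.
  lra.
have e1 : K * ((1 - t) * ((1 - t) * q)) * t + K * (- t * (- t * q)) * (1 - t) = t * (1 - t) * (K * q) by ring.
nra.
Qed.

Section transport.
Variables (R : realType) (n : nat).
Local Notation E := 'rV[R]_n.
Local Notation leb := (lebesgue_rV R n).
Implicit Types (x y : E) (h w : E -> R).
Variable (Omega : set E).
Hypotheses (oO : open Omega) (bO : bounded_set Omega).
Hypothesis cO : convex_set (Omega : set (convex_lmodType E)).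
Variables (f u psi : E -> R) (eps : R).
Hypotheses (C1f : C1ext Omega f) (f0 : forall x, Omega x -> 0 < f x).
Hypothesis (If1 : \int[leb]_(x in Omega) f x = 1).
Hypothesis (C1psi : C1ext Omega psi).
Hypotheses (eps0 : 0 < eps).

Definition displaced x : E := x + eps *: grad psi x.
Local Notation T := displaced.
Local Notation S := (stays Omega T).
Local Notation I h := (\int[leb]_(x in Omega) (h x * f x)).
Local Notation IS h := (\int[leb]_(x in S) (h x * f x)).

Lemma measurable_displaced : measurable_fun Omega T.
Proof.
apply: measurable_rV_on; first exact: open_measurable_rV.
move=> i; apply: (eq_measurable_fun (fun x => x ord0 i + eps * partial i psi x)).
  by move=> x _; rewrite !mxE.
apply: measurable_funD; first exact: measurable_funTS (@measurable_rV_coord R n i).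
apply: measurable_funM => //; apply: (ext_measurable oO bO).
by have [_ /(_ i)[]] := C1psi.
Qed.

Hypothesis bu : bmfun Omega u.
Hypothesis full : forall h, bmfun Omega h -> IS h = I h.
Hypothesis push : forall h, bmfun Omega h ->
  I (fun x => h x * (1 + eps * u x)) = IS (fun x => h (T x)).

Let mO : measurable Omega. Proof. exact: open_measurable_rV. Qed.
Let fO : (leb Omega < +oo)%E. Proof. exact: bounded_finite_measure. Qed.
Let mS : measurable S. Proof. exact: (measurable_stays oO measurable_displaced). Qed.
Let fS : (leb S < +oo)%E. Proof. exact: (stays_finite oO bO measurable_displaced). Qed.
Let bf : bmfun Omega f. Proof. by apply: (ext_bm oO bO); case: C1f. Qed.

Lemma bmfun_stays h : bmfun Omega h -> bmfun S h.
Proof.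
move=> [mh [M hM]]; split; last by exists M => x [/hM].
by apply: measurable_funS mh => // x [].
Qed.

Lemma bmfun_displaced h : bmfun Omega h -> bmfun S (fun x => h (T x)).
Proof.
move=> bh; apply: (bmfun_comp mO _ _ bh); last by move=> x [].
exact: (stays_map oO measurable_displaced).
Qed.

Let bfS : bmfun S f. Proof. exact: bmfun_stays. Qed.

(** Push-forward: int h (1 + eps u) dmu = int h dnu = int h o T dmu. *)
Lemma increment_integral h : bmfun Omega h ->
  IS (fun x => h (T x) - h x) = eps * I (fun x => u x * h x).
Proof.
move=> bh.
have b1 : bmfun Omega (fun x => h x * (1 + eps * u x) * f x).
  apply: bmfunM => //; apply: bmfunM => //; apply: bmfunD; first exact: bmfun_cst.
  by apply: bmfunM => //; exact: bmfun_cst.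
have b2 : bmfun Omega (fun x => h x * f x) by exact: bmfunM.
have b3 : bmfun Omega (fun x => u x * h x * f x) by apply: bmfunM => //; exact: bmfunM.
have -> : IS (fun x => h (T x) - h x) = IS (fun x => h (T x)) - IS h.
  rewrite -(bm_B mS fS); first by apply: (bm_eq leb) => x _; rewrite mulrBl.
    by apply: bmfunM => //; exact: bmfun_displaced.
  exact: bmfun_stays.
rewrite -push // full // -(bm_B mO fO b1 b2) -(bm_Z mO fO _ b3).
by apply: (bm_eq leb) => x _; ring.
Qed.

Lemma displacedB x : T x - x = eps *: grad psi x.
Proof. by rewrite addrAC subrr add0r. Qed.

Let bgrad2 : bmfun Omega (grad2 psi).
Proof. by apply: (ext_bm oO bO); exact: ext_grad2. Qed.

(** Taylor bound of psi between x and T x = x + eps grad psi x. *)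
Lemma energy_lower K2 : (forall x y, Omega x -> Omega y ->
    `|psi y - psi x - dot (grad psi x) (y - x)| <= K2 * dot (y - x) (y - x)) ->
  (1 - eps * K2) * I (grad2 psi) <= I (fun x => u x * psi x).
Proof.
move=> hK; have bpsi : bmfun Omega psi by apply: (ext_bm oO bO); case: C1psi.
have b2 : bmfun Omega (fun x => grad2 psi x * f x) by exact: bmfunM.
rewrite -(ler_pM2l eps0) -increment_integral // mulrA -full // -(bm_Z mS fS).
  apply: (bm_le mS fS).
  - by apply: bmfunM; [exact: bmfun_cst|exact: bmfun_stays].
  - by apply: bmfunM => //; apply: bmfunB; [exact: bmfun_displaced|exact: bmfun_stays].
  move=> x [Ox OTx]; rewrite mulrA ler_wpM2r ?(ltW (f0 _)) //.
  have := hK x (T x) Ox OTx; rewrite displacedB dotZr dotZl dotZr ler_norml => /andP[+ _].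
  rewrite -/(grad2 psi x); lra.
exact: bmfun_stays.
Qed.

Variables (C1 Ku V Lam B : R) (phi : E -> R).
Hypotheses (C1ge0 : 0 <= C1) (C1small : 4 * (C1 * eps) <= 1) (eps1 : eps <= 1).
Hypothesis monge_ampere : forall x, S x -> `|f x - f (T x)| <= C1 * eps * f (T x).
Hypotheses (hKu : forall x, Omega x -> `|u x| <= Ku) (Ku0 : 0 <= Ku).
Hypothesis hV : fine (leb Omega) <= V.
Hypotheses (C1phi : C1ext Omega phi) (hLam : I (fun x => phi x ^+ 2) <= Lam).
Hypothesis B0 : 0 < B.

Let d := B * eps ^+ 2.
Let c x := cutoff d (f x).
Let b x : R := (f x <= 4 * d)%R%:R.
Let d0 : 0 < d. Proof. by rewrite mulr_gt0 // exprn_gt0. Qed.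

Lemma bmfun_cutoff : bmfun Omega c.
Proof.
split; last first.
  exists 1 => x Ox; have /andP[c0 c1] := cutoff_bounds d (f x).
  by rewrite ger0_norm.
rewrite /c /cutoff; apply: measurable_minr => //; apply: measurable_maxr => //.
apply: measurable_funB => //; apply: measurable_funM => //.
by case: bf.
Qed.

Lemma bmfun_low : bmfun Omega b.
Proof.
have mL : measurable (Omega `&` f @^-1` `]-oo, 4 * d]%classic) by apply: (proj1 bf).
have [h _] := bm_indic leb mO mL; apply: eq_bmfun h => x Ox.
rewrite indicE /b; suff -> : (x \in Omega `&` f @^-1` `]-oo, 4 * d]%classic) = (f x <= 4 * d) by [].
rewrite in_setI (mem_set Ox) /=; apply/idP/idP.
  by move=> /set_mem /=; rewrite in_itv.
by move=> fd; apply/mem_set; rewrite /= in_itv.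
Qed.

Let bphi : bmfun Omega phi. Proof. by apply: (ext_bm oO bO); case: C1phi. Qed.
Let blow : bmfun Omega (fun x => b x * `|phi x|).
Proof. by apply: bmfunM; [exact: bmfun_low|exact: bmfun_norm]. Qed.

Lemma b_ge0 x : 0 <= b x. Proof. by rewrite /b ler0n. Qed.

(** On the set f <= 4 d, Young's inequality gives |phi| <= (1 / eps + eps phi^2) / 2, and
    the mass of this set is at most 4 d |Omega| = O(eps^2). *)
Lemma low_density_mass : I (fun x => b x * `|phi x|) <= eps * ((4 * B * V + Lam) / 2).
Proof.
have b1 : bmfun Omega (fun x => phi x ^+ 2 * f x) by apply: bmfunM => //; exact: bmfunX.
apply: le_trans (_ : \int[leb]_(x in Omega) (2 * B * eps + eps / 2 * (phi x ^+ 2 * f x)) <= _).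
  apply: (bm_le mO fO); [exact: bmfunM| |].
    by apply: bmfunD; [exact: bmfun_cst|apply: bmfunM => //; exact: bmfun_cst].
  move=> x Ox; have fx := f0 Ox; rewrite /b; case: (leP (f x) (4 * d)) => fd; last first.
    rewrite /= !mul0r addr_ge0 //; first by rewrite mulr_ge0 ?mulr_ge0 ?(ltW B0) ?(ltW eps0).
    by rewrite mulr_ge0 ?divr_ge0 ?(ltW eps0) // mulr_ge0 ?sqr_ge0 // ltW.
  rewrite mul1r; move: (sqr_ge0 (1 - eps * `|phi x|)).
  rewrite -(real_normK (num_real (phi x))).
  move: fd; rewrite /d; move: `|phi x| (f x) fx => p a a0 ad h.
  rewrite -(ler_pM2l eps0).
  have h1 : 0 <= a * (1 - eps * p) ^+ 2 by rewrite mulr_ge0 // ltW.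
  nra.
rewrite (bm_D mO fO); [|exact: bmfun_cst|by apply: bmfunM => //; exact: bmfun_cst].
rewrite (bm_cst leb mO) (bm_Z mO fO _ b1).
have h1 : 2 * B * eps * fine (leb Omega) <= 2 * B * eps * V.
  by rewrite ler_wpM2l // !mulr_ge0 ?ltW.
have h2 : eps / 2 * I (fun x => phi x ^+ 2) <= eps / 2 * Lam.
  by rewrite ler_wpM2l // divr_ge0 ?ltW.
apply: le_trans (lerD h1 h2) _.
have -> // : 2 * B * eps * V + eps / 2 * Lam = eps * ((4 * B * V + Lam) / 2) by field.
Qed.

(** Push-forward applied to c phi trades the increment of phi for that of c, which is small
    because f and f o T are comparable; integrating phi o T - phi directly would need its
    gradient along the segment, where the density is not controlled. *)
Lemma cutoff_part : IS (fun x => c x * (phi (T x) - phi x)) <=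
  eps ^+ 2 * ((4 * C1 * (1 + Ku) + Ku) * ((4 * B * V + Lam) / 2)).
Proof.
have bc := bmfun_cutoff.
have bcp : bmfun Omega (fun x => c x * phi x) by exact: bmfunM.
have bphiT := bmfun_displaced bphi; have bphiS := bmfun_stays bphi.
have bcT := bmfun_displaced bc; have bcS := bmfun_stays bc.
have b1 : bmfun S (fun x => (c x - c (T x)) * phi (T x) * f x).
  by apply: bmfunM => //; apply: bmfunM => //; exact: bmfunB.
have b2 : bmfun S (fun x => (c (T x) * phi (T x) - c x * phi x) * f x).
  by apply: bmfunM => //; apply: bmfunB; exact: bmfunM.
have blowT := bmfun_displaced blow.
have b3 : bmfun S (fun x => b (T x) * `|phi (T x)| * f x) by exact: bmfunM.
have b4 : bmfun Omega (fun x => b x * `|phi x| * f x) by exact: bmfunM.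
have -> : IS (fun x => c x * (phi (T x) - phi x)) =
    IS (fun x => (c x - c (T x)) * phi (T x)) + eps * I (fun x => u x * (c x * phi x)).
  rewrite -(increment_integral bcp) -(bm_D mS fS b1 b2).
  by apply: (bm_eq leb) => x _; ring.
have e2 : IS (fun x => (c x - c (T x)) * phi (T x)) <=
    4 * (C1 * eps) * IS (fun x => b (T x) * `|phi (T x)|).
  rewrite -(bm_Z mS fS _ b3); apply: (bm_le mS fS) => //.
    by apply: bmfunM => //; exact: bmfun_cst.
  move=> x Sx; have [Ox OTx] := Sx; rewrite [leRHS]mulrA ler_wpM2r ?(ltW (f0 Ox)) //.
  apply: le_trans (ler_norm _) _; rewrite normrM [leRHS]mulrA ler_wpM2r //.
  by apply: cutoff_comparable => //; rewrite ?f0 // ?monge_ampere // mulr_ge0 // ltW.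
have e3 : IS (fun x => b (T x) * `|phi (T x)|) <= (1 + Ku) * I (fun x => b x * `|phi x|).
  rewrite -(push blow) -(bm_Z mO fO _ b4); apply: (bm_le mO fO).
  - apply: bmfunM => //; apply: bmfunM => //; apply: bmfunD; first exact: bmfun_cst.
    by apply: bmfunM => //; exact: bmfun_cst.
  - by apply: bmfunM => //; exact: bmfun_cst.
  move=> x Ox; rewrite [leRHS]mulrA ler_wpM2r ?(ltW (f0 Ox)) // [leRHS]mulrC ler_wpM2l ?mulr_ge0 ?b_ge0 //.
  rewrite lerD2l; apply: le_trans (ler_norm _) _; rewrite normrM (gtr0_norm eps0).
  by apply: le_trans (hKu Ox); rewrite ler_piMl.
have e4 : I (fun x => u x * (c x * phi x)) <= Ku * I (fun x => b x * `|phi x|).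
  rewrite -(bm_Z mO fO _ b4); apply: (bm_le mO fO).
  - by apply: bmfunM => //; exact: bmfunM.
  - by apply: bmfunM => //; exact: bmfun_cst.
  move=> x Ox; rewrite [leRHS]mulrA ler_wpM2r ?(ltW (f0 Ox)) //.
  apply: le_trans (ler_norm _) _; rewrite !normrM; apply: ler_pM => //; first exact: hKu.
  rewrite ler_wpM2r //; have /andP[c0 c1] := cutoff_bounds d (f x).
  rewrite /c /b (ger0_norm c0); case: (leP (f x) (4 * d)) => // fd.
  rewrite (cutoff_eq0 d0) //; apply: ltW; apply: le_lt_trans fd.
  by rewrite ler_wpM2r ?(ltW d0) // ler_nat.
have e5 := low_density_mass.
exact: cutoff_budget e2 e3 e4 e5.
Qed.

Variables (K1 K2 KF : R).
Hypotheses (K10 : 0 <= K1) (K20 : 0 <= K2) (KF0 : 0 <= KF).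
Hypothesis taylor_f : forall x y, Omega x -> Omega y ->
  `|f y - f x - dot (grad f x) (y - x)| <= KF * dot (y - x) (y - x).
Hypothesis lip_psi : forall x y v, Omega x -> Omega y ->
  dot (grad psi y - grad psi x) v <= K2 * enorm (y - x) * enorm v.
Hypothesis hK1 : forall x, Omega x -> grad2 psi x <= K1 ^+ 2.
Hypothesis noncon : 2 * (n%:R * (eps * (K2 * n%:R))) <= 1.
Hypothesis n0 : (0 < n)%N.

(** Displacement interpolation between the identity and T. *)
Definition partway (t : R) x : E := x + t *: (T x - x).

Lemma partway_in x t : S x -> 0 <= (t : R) <= 1 -> Omega (partway t x).
Proof. by move=> [Ox OTx] ht; exact: convex_segment. Qed.

(** The Taylor expansions of f at T_t x towards x and towards T x, combined with weights
    1 - t and t: the first order terms cancel. *)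
Lemma partway_density x t : S x -> 0 <= (t : R) <= 1 ->
  f x * (1 - C1 * eps) - KF * K1 ^+ 2 * eps ^+ 2 <= f (partway t x).
Proof.
move=> Sx ht; have Oz := partway_in Sx ht; have [Ox OTx] := Sx; have /andP[t0 t1] := ht.
have vE := displacedB x; set v := T x - x in vE *.
have zx : x - partway t x = - t *: v by rewrite /partway opprD addrA subrr add0r scaleNr.
have Tz : T x - partway t x = (1 - t) *: v.
  by rewrite /partway opprD addrA -/v scalerBl scale1r.
have := taylor_f Oz Ox; have := taylor_f Oz OTx.
rewrite zx Tz !dotZr !dotZl; set p := dot _ v.
have q1 : 0 <= dot v v <= K1 ^+ 2 * eps ^+ 2.
  rewrite dot_ge0 /= vE dotZl dotZr mulrA -expr2 mulrC ler_wpM2r ?sqr_ge0 //.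
  exact: hK1.
have fT : f x * (1 - C1 * eps) <= f (T x).
  have := monge_ampere Sx; rewrite ler_norml => /andP[_ h].
  have s0 : 0 <= C1 * eps by rewrite mulr_ge0 // ltW.
  have := f0 OTx; move: (C1 * eps) s0 C1small h => s s0 s1 h fT.
  have h1 : (1 - s) * f x <= (1 - s) * ((1 + s) * f (T x)) by rewrite ler_wpM2l //; lra.
  have h2 : 0 <= s * s * f (T x) by rewrite !mulr_ge0 // ltW.
  nra.
have fx := f0 Ox; move: fT q1 t0 t1 KF0.
move: (f (partway t x)) (f (T x)) (f x) fx (dot v v) => fz fT a a0 q fTa /andP[q0 q1] t0 t1 K0.
rewrite !ler_norml => /andP[_ h1] /andP[_ h2].
have C1e : 0 <= C1 * eps by rewrite mulr_ge0 // ltW.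
by rewrite -mulrA; apply: chord_arith q0 q1 t0 t1 K0 fTa a0 C1e h1 h2.
Qed.

Lemma partway_noncontracting x y t : Omega x -> Omega y -> 0 <= (t : R) <= 1 ->
  (1 - eps * (K2 * n%:R)) * `|x - y| <= `|partway t x - partway t y|.
Proof.
move=> Ox Oy /andP[t0 t1].
have -> : partway t x - partway t y = (x - y) + (t * eps) *: (grad psi x - grad psi y).
  by rewrite /partway !displacedB !scalerA scalerBr opprD addrACA.
have h : `|grad psi x - grad psi y| <= K2 * n%:R * `|x - y|.
  apply: le_trans (norm_le_enorm _) _; have := lip_psi (grad psi x - grad psi y) Oy Ox.
  rewrite -enorm_sqr expr2 => h.
  have {}h : enorm (grad psi x - grad psi y) <= K2 * enorm (x - y).
    have [e0|e0] := eqVneq (enorm (grad psi x - grad psi y)) 0.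
      by rewrite e0 mulr_ge0 ?enorm_ge0.
    by rewrite -(ler_pM2r (_ : 0 < enorm (grad psi x - grad psi y))) // lt_neqAle eq_sym e0 enorm_ge0.
  by apply: le_trans h _; rewrite -mulrA ler_wpM2l // enorm_le_norm.
have h2 : `|(t * eps) *: (grad psi x - grad psi y)| <= eps * (K2 * n%:R * `|x - y|).
  rewrite normrZ ger0_norm ?mulr_ge0 ?(ltW eps0) //.
  by apply: ler_pM; rewrite ?mulr_ge0 ?(ltW eps0) // ler_piMl // ltW.
have := ler_normB (x - y + (t * eps) *: (grad psi x - grad psi y)) ((t * eps) *: (grad psi x - grad psi y)).
rewrite addrK => h3.
have -> : (1 - eps * (K2 * n%:R)) * `|x - y| = `|x - y| - eps * (K2 * n%:R * `|x - y|) by ring.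
lra.
Qed.

Let F x := grad2 phi x * f x.

(** The power n of the contraction factor is estimated by Bernoulli's inequality, hence the
    smallness condition on eps. *)
Lemma partway_energy (t : R) : 0 <= t <= 1 ->
  bmfun S (fun x => F (partway t x)) /\ \int[leb]_(x in S) F (partway t x) <=
    (1 + 2 * (n%:R * (eps * (K2 * n%:R)))) * \int[leb]_(x in Omega) F x.
Proof.
move=> ht; have K2n : 0 <= eps * (K2 * n%:R) by rewrite !mulr_ge0 // ltW.
have n1 : 1 <= n%:R :> R by rewrite ler1n.
have c1 : eps * (K2 * n%:R) <= 1.
  have : eps * (K2 * n%:R) <= n%:R * (eps * (K2 * n%:R)) by rewrite ler_peMl.
  move=> h; apply: le_trans h _; have y0 : 0 <= n%:R * (eps * (K2 * n%:R)) by rewrite mulr_ge0.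
  by apply: le_trans noncon; rewrite ler_peMl // ler1n.
have [b1 b2] := bernoulli_inv (introT andP (conj K2n c1)) noncon.
have c0 : 0 < 1 - eps * (K2 * n%:R).
  rewrite lt_neqAle subr_ge0 c1 andbT; apply/eqP => e; move: b1.
  by rewrite -e expr0n gtn_eqF // mulr0n /= leNgt invr_gt0 ltr0n.
have egF : extends_continuously Omega F.
  by apply: (ext_M bO); [exact: ext_grad2|case: C1f].
have mtau : measurable_fun S (partway t).
  apply: measurable_rV_on => // i.
  apply: (eq_measurable_fun (fun x => x ord0 i + t * (eps * partial i psi x))).
    by move=> x _; rewrite /partway displacedB !mxE.
  apply: measurable_funD; first exact: measurable_funTS (@measurable_rV_coord R n i).
  apply: measurable_funM => //; apply: measurable_funM => //.
  have h : measurable_fun Omega (partial i psi).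
    by apply: (ext_measurable oO bO); have [_ /(_ i)[]] := C1psi.
  by apply: measurable_funS h => // x [].
have F0 x : Omega x -> 0 <= F x by move=> Ox; rewrite mulr_ge0 ?dot_ge0 // ltW // f0.
have [_ bF le] := noncontracting_integral mS mtau c0
  (fun x y Sx Sy => partway_noncontracting (proj1 Sx) (proj1 Sy) ht)
  (fun x Sx => partway_in Sx ht) fO
  (fun s => open_dyadic_open (@open_superlevel _ _ _ _ s oO (fun x Ox => ext_cont oO bO egF Ox)))
  (ext_bm oO bO egF) F0.
split => //; have cn : 0 < (1 - eps * (K2 * n%:R)) ^+ n by rewrite exprn_gt0.
rewrite -ler_pdivlMl // in le; apply: le_trans le _.
by apply: ler_wpM2r b2; apply: bm_ge0.
Qed.

Hypothesis hD : I (grad2 phi) <= 1.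
Hypothesis hB : 4 * (KF * K1 ^+ 2) <= B.
Let A := Num.sqrt (I (grad2 psi)).

Let A0 : 0 <= A. Proof. exact: sqrtr_ge0. Qed.

Lemma energy_sqr : A ^+ 2 = I (grad2 psi).
Proof.
by rewrite sqr_sqrtr //; apply: bm_ge0 => x Ox; rewrite mulr_ge0 ?dot_ge0 // ltW // f0.
Qed.

Lemma energy_le : A <= K1.
Proof.
rewrite -(ler_pXn2r (_ : 0 < 2)%N) ?nnegrE // energy_sqr -[leRHS]mulr1 -If1.
rewrite -(bm_Z mO fO _ bf); apply: (bm_le mO fO); [exact: bmfunM| |].
  by apply: bmfunM => //; exact: bmfun_cst.
by move=> x Ox; rewrite ler_wpM2r ?hK1 // ltW // f0.
Qed.

Let G2 x := (2 * (A + eps))^-1 *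
  (grad2 psi x * (f x * (1 + 2 * (C1 * eps)) + 2 * (KF * K1 ^+ 2 * eps ^+ 2))).

Let bg2S : bmfun S (grad2 psi). Proof. exact: bmfun_stays. Qed.

Let bG2 : bmfun S G2.
Proof.
apply: bmfunM; first exact: bmfun_cst.
apply: bmfunM => //; apply: bmfunD; last exact: bmfun_cst.
by apply: bmfunM => //; exact: bmfun_cst.
Qed.

Lemma remainder_integral : \int[leb]_(x in S) G2 x <= (2 * (A + eps))^-1 *
  (A ^+ 2 * (1 + 2 * (C1 * eps)) + 2 * (KF * K1 ^+ 2 * eps ^+ 2) * (K1 ^+ 2 * V)).
Proof.
have i0 : 0 <= (2 * (A + eps))^-1 by rewrite invr_ge0 mulr_ge0 // addr_ge0 // ltW.
have b1 : bmfun S (fun x => grad2 psi x * f x) by exact: bmfunM.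
have b2 a : bmfun S (fun x => a * (grad2 psi x * f x)) by apply: bmfunM => //; exact: bmfun_cst.
have b3 a : bmfun S (fun x => a * grad2 psi x) by apply: bmfunM => //; exact: bmfun_cst.
have [k1 k1E] : exists k1, k1 = 1 + 2 * (C1 * eps) by eexists.
have [k2 k2E] : exists k2, k2 = 2 * (KF * K1 ^+ 2 * eps ^+ 2) by eexists.
have k20 : 0 <= k2 by rewrite k2E mulr_ge0 // mulr_ge0 ?sqr_ge0 // mulr_ge0 ?sqr_ge0.
have -> : \int[leb]_(x in S) G2 x =
    (2 * (A + eps))^-1 * (k1 * IS (grad2 psi) + k2 * \int[leb]_(x in S) grad2 psi x).
  rewrite -(bm_Z mS fS _ b1) -(bm_Z mS fS _ bg2S) -(bm_D mS fS (b2 _) (b3 _)).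
  rewrite -(bm_Z mS fS _ (bmfunD (b2 _) (b3 _))).
  by apply: (bm_eq leb) => x _; rewrite /G2 k1E k2E; ring.
rewrite ler_wpM2l // full // energy_sqr -k1E -k2E mulrC lerD2l ler_wpM2l //.
have hS : fine (leb S) <= V.
  apply: le_trans hV; apply: fine_le; rewrite ?ge0_fin_numE //.
  by apply: le_measure; rewrite ?inE // => x [].
apply: le_trans (_ : K1 ^+ 2 * fine (leb S) <= _); last by rewrite ler_wpM2l ?sqr_ge0.
rewrite -(bm_cst leb mS); apply: (bm_le mS fS) => //; first exact: bmfun_cst.
by move=> x [Ox _]; exact: (hK1 Ox).
Qed.

Lemma action_pointwise x t : S x -> 0 <= (t : R) <= 1 ->
  (1 - c x) * dot (grad phi (partway t x)) (grad psi x) * f x <=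
  (A + eps) / 2 * F (partway t x) + G2 x.
Proof.
move=> Sx ht; have Oz := partway_in Sx ht; have [Ox _] := Sx.
have /andP[c0 c1] := cutoff_bounds d (f x).
apply: action_arith => //.
- exact: f0.
- by rewrite subr_ge0 c1 lerBlDr lerDl.
- by rewrite ltr_wpDl.
- exact: dot_ge0.
- exact: dot_ge0.
- by rewrite mulr_ge0 // ltW.
- by rewrite mulr_ge0 // sqr_ge0.
- exact: cauchy_schwarz_dot.
- exact/ltW/f0.
- have [fd|fd] := leP (f x) d; first by left; rewrite /c cutoff_eq1 ?subrr.
  right; apply: le_trans (ltW fd).
  by rewrite mulrA ler_wpM2r ?sqr_ge0.
- exact: partway_density.
Qed.

Let k1 := 2 * (n%:R * (K2 * n%:R)).
Let Cg := 2^-1 + (K1 + 1) * k1 / 2 + C1 * K1 + KF * K1 ^+ 2 * (K1 ^+ 2 * V).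

(** Riemann sums for the increments, action_pointwise for each node, and partway_energy for
    the energies at the nodes. *)
Lemma transported_part : IS (fun x => (1 - c x) * (phi (T x) - phi x)) <= eps * (A + eps * Cg).
Proof.
apply/ler_addgt0Pr => e e0; have [m hm] := C1_riemann oO bO cO C1phi e0.
pose t (j : 'I_m.+1) : R := j%:R / m.+1%:R.
have ht j : 0 <= t j <= 1.
  by rewrite divr_ge0 //= ler_pdivrMr // mul1r ler_nat ltnW.
have bF j : bmfun S (fun x => F (partway (t j) x)) := proj1 (partway_energy (ht j)).
have b1 j : bmfun S (fun x => (A + eps) / 2 * F (partway (t j) x)).
  by apply: bmfunM => //; exact: bmfun_cst.
have b2 j : bmfun S (fun x => (A + eps) / 2 * F (partway (t j) x) + G2 x) by exact: bmfunD.
have b3 : bmfun S (fun x => \sum_j ((A + eps) / 2 * F (partway (t j) x) + G2 x)) by exact: bmfun_sum.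
have b4 : bmfun S (fun x => eps / m.+1%:R * \sum_j ((A + eps) / 2 * F (partway (t j) x) + G2 x)).
  by apply: bmfunM => //; exact: bmfun_cst.
have b5 : bmfun S (fun x => e * f x) by apply: bmfunM => //; exact: bmfun_cst.
have bc := bmfun_cutoff.
apply: le_trans (_ : \int[leb]_(x in S) (e * f x + eps / m.+1%:R *
    \sum_j ((A + eps) / 2 * F (partway (t j) x) + G2 x)) <= _).
  apply: (bm_le mS fS); last 1 first.
  - move=> x Sx; have [Ox OTx] := Sx.
    have := hm x (T x) Ox OTx; rewrite ler_norml => /andP[_]; rewrite lerBlDr => h.
    have /andP[c0 c1] := cutoff_bounds d (f x).
    have w0 : 0 <= (1 - c x) * f x by rewrite mulr_ge0 ?subr_ge0 // ltW // f0.
    have -> : (1 - c x) * (phi (T x) - phi x) * f x = (1 - c x) * f x * (phi (T x) - phi x) by ring.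
    apply: le_trans (ler_wpM2l w0 h) _; rewrite mulrDr; apply: lerD.
      rewrite mulrC ler_wpM2l ?(ltW e0) // ler_piMl ?(ltW (f0 Ox)) //.
      by rewrite lerBlDr lerDl.
    have swap (q r s : R) : q / r * s = r^-1 * (q * s) by ring.
    rewrite mulrCA swap ler_wpM2l ?invr_ge0 // !mulr_sumr.
    apply: ler_sum => j _; rewrite displacedB dotZr -/(t j).
    have -> : x + t j *: (eps *: grad psi x) = partway (t j) x by rewrite /partway displacedB.
    have -> (p : R) : (1 - c x) * f x * (eps * p) = eps * ((1 - c x) * p * f x) by ring.
    by rewrite ler_wpM2l ?(ltW eps0) // action_pointwise.
  - apply: bmfunM => //; apply: bmfunM; last by apply: bmfunB; [exact: bmfun_displaced|exact: bmfun_stays].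
    by apply: bmfunB; [exact: bmfun_cst|exact: bmfun_stays].
  - exact: bmfunD.
rewrite (bm_D mS fS b5 b4) (bm_Z mS fS _ bfS) (bm_Z mS fS _ b3) (bm_sum mS fS) //.
have IS1 : \int[leb]_(x in S) f x = 1.
  rewrite -If1 -[RHS](_ : I (fun=> 1) = _); last by apply: (bm_eq leb) => x _; rewrite mul1r.
  by rewrite -full; [apply: (bm_eq leb) => x _; rewrite mul1r|exact: bmfun_cst].
rewrite IS1 mulr1 addrC lerD2r.
have hX j : \int[leb]_(x in S) ((A + eps) / 2 * F (partway (t j) x) + G2 x) <= A + eps * Cg.
  rewrite (bm_D mS fS (b1 j) bG2) (bm_Z mS fS _ (bF j)).
  apply: le_trans (lerD (_ : _ <= (A + eps) / 2 * (1 + k1 * eps)) remainder_integral) _.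
    rewrite ler_wpM2l ?divr_ge0 ?addr_ge0 ?(ltW eps0) //.
    have [_ h] := partway_energy (ht j); apply: le_trans h _.
    have -> : 1 + k1 * eps = 1 + 2 * (n%:R * (eps * (K2 * n%:R))) by rewrite /k1; ring.
    rewrite ler_piMr // addr_ge0 // !mulr_ge0 // ltW //.
  apply: budget_arith => //.
  - by rewrite eps0.
  - by rewrite A0 energy_le.
  - by rewrite /k1 !mulr_ge0.
  - by rewrite mulr_ge0 ?sqr_ge0.
  - exact: le_trans (fine_ge0 (measure_ge0 _ _)) hV.
have m0 : 0 < m.+1%:R :> R by rewrite ltr0n.
rewrite -mulrA ler_wpM2l ?(ltW eps0) // ler_pdivrMl //.
apply: le_trans (ler_sum _ (fun j _ => hX j)) _.
by rewrite sumr_const card_ord mulr_natl.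
Qed.

(** The increment of phi is split according to c + (1 - c) = 1. *)
Theorem dual_norm_upper : I (fun x => u x * phi x) <=
  A + eps * (Cg + (4 * C1 * (1 + Ku) + Ku) * ((4 * B * V + Lam) / 2)).
Proof.
rewrite -(ler_pM2l eps0) -increment_integral //.
have bc := bmfun_stays bmfun_cutoff.
have bi : bmfun S (fun x => phi (T x) - phi x).
  by apply: bmfunB; [exact: bmfun_displaced|exact: bmfun_stays].
have b1 : bmfun S (fun x => c x * (phi (T x) - phi x) * f x).
  by apply: bmfunM => //; exact: bmfunM.
have b2 : bmfun S (fun x => (1 - c x) * (phi (T x) - phi x) * f x).
  by apply: bmfunM => //; apply: bmfunM => //; apply: bmfunB => //; exact: bmfun_cst.
have -> : IS (fun x => phi (T x) - phi x) =
    IS (fun x => (1 - c x) * (phi (T x) - phi x)) + IS (fun x => c x * (phi (T x) - phi x)).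
  by rewrite -(bm_D mS fS b2 b1); apply: (bm_eq leb) => x _; ring.
apply: le_trans (lerD transported_part cutoff_part) _.
by rewrite le_eqVlt; apply/orP; left; apply/eqP; ring.
Qed.

End transport.

(** * Couplings *)

Lemma probability_restrict d (T : measurableType d) (R : realType) (P : probability T R) (D B : set T) :
  measurable D -> measurable B -> P D = 1%E -> P (B `&` D) = P B.
Proof.
move=> mD mB PD.
have h : P (B `\` D) = 0%E.
  apply/eqP; rewrite -measure_le0 (_ : 0%E = P (~` D)); last by rewrite probability_setC // PD subee.
  apply: le_measure; rewrite ?inE; [exact: measurableD|exact: measurableC|by move=> x []].
rewrite [RHS](measureDI _ mB mD) /= h add0e //.
Qed.

Section couplings.
Variables (R : realType) (n : nat).
Local Notation E := 'rV[R]_n.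
Local Notation leb := (lebesgue_rV R n).
Implicit Types (x y : E) (h w : E -> R).
Variable (Omega : set E).
Hypotheses (oO : open Omega) (bO : bounded_set Omega).
Let mO : measurable Omega. Proof. exact: open_measurable_rV. Qed.

Let sqdist (z : E * E) : R := enorm (z.1 - z.2) ^+ 2.

Lemma bmfun_sqdist : bmfun (Omega `*` Omega) sqdist.
Proof.
split.
  have -> : sqdist = (fun z => \sum_i (z.1 ord0 i - z.2 ord0 i) ^+ 2).
    apply/funext => z; rewrite /sqdist enorm_sqr /dot; apply: eq_bigr => i _.
    by rewrite !mxE expr2.
  apply: measurable_funTS; apply: measurable_sum => i; apply: measurable_funX.
  apply: measurable_funB.
    exact: (measurableT_comp (@measurable_rV_coord R n i) measurable_fst).
  exact: (measurableT_comp (@measurable_rV_coord R n i) measurable_snd).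
have [B B0 hB] := bounded_diameter bO.
exists ((n%:R * B) ^+ 2) => z [Oz1 Oz2]; rewrite ger0_norm ?sqr_ge0 //.
rewrite ler_pXn2r ?nnegrE ?enorm_ge0 ?mulr_ge0 ?(ltW B0) //.
by apply: le_trans (enorm_le_norm _) _; rewrite ler_wpM2l // hB.
Qed.

Section marginals.
Variables (mu nu : probability E R) (pi : probability (E * E)%type R).
Hypotheses (mu1 : mu Omega = 1%E) (nu1 : nu Omega = 1%E).
Hypothesis hpi : coupling Omega mu nu pi.

Let mOO : measurable (Omega `*` Omega). Proof. exact: measurableX. Qed.
Let pi1 : pi (Omega `*` Omega) = 1%E. Proof. by case: hpi. Qed.
Let fOO : (pi (Omega `*` Omega) < +oo)%E. Proof. by move: pi1 => /= ->; exact: ltry. Qed.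

(** A coupling is carried by Omega x Omega, so its marginals restrict to it. *)
Lemma coupling_fst h : bmfun Omega h ->
  bmfun (Omega `*` Omega) (fun z => h z.1) /\
  \int[mu]_(x in Omega) h x = \int[pi]_(z in Omega `*` Omega) h z.1.
Proof.
move=> bh; have m1 : measurable_fun (Omega `*` Omega) (@fst E E) by exact: measurable_funTS.
have s1 z : (Omega `*` Omega) z -> Omega z.1 by case.
split; first exact: (bmfun_comp mO m1 s1 bh).
have fmu : (mu Omega < +oo)%E by move: mu1 => /= ->; exact: ltry.
etransitivity; first apply: (bm_transfer mOO fOO mO fmu m1 s1 (bmfun_cst _ 1)) => //.
  move=> A mA AO.
  have mAT : measurable ((A `*` setT) : set (E * E)) by exact: measurableX.
  have [_ + _] := hpi => /(_ A mA) hA.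
  transitivity (fine (pi (A `*` setT))); first by congr fine.
  have [_ e] := bm_indic pi mOO mAT.
  transitivity (fine (pi ((A `*` setT) `&` (Omega `*` Omega)))).
    by congr fine; exact/esym/(probability_restrict mOO mAT pi1).
  rewrite -[LHS]e; apply: (bm_eq pi) => z _; rewrite mulr1 !indicE; suff -> : (z \in A `*` setT) = (z.1 \in A) by [].
  by apply/idP/idP => /set_mem h2; apply/mem_set => //; case: h2.
by apply: (bm_eq pi) => z _; rewrite mulr1.
Qed.

Lemma coupling_snd h : bmfun Omega h ->
  bmfun (Omega `*` Omega) (fun z => h z.2) /\
  \int[nu]_(x in Omega) h x = \int[pi]_(z in Omega `*` Omega) h z.2.
Proof.
move=> bh; have m1 : measurable_fun (Omega `*` Omega) (@snd E E) by exact: measurable_funTS.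
have s1 z : (Omega `*` Omega) z -> Omega z.2 by case.
split; first exact: (bmfun_comp mO m1 s1 bh).
have fnu : (nu Omega < +oo)%E by move: nu1 => /= ->; exact: ltry.
etransitivity; first apply: (bm_transfer mOO fOO mO fnu m1 s1 (bmfun_cst _ 1)) => //.
  move=> A mA AO.
  have mAT : measurable ((setT `*` A) : set (E * E)) by exact: measurableX.
  have [_ _ +] := hpi => /(_ A mA) hA.
  transitivity (fine (pi (setT `*` A))); first by congr fine.
  have [_ e] := bm_indic pi mOO mAT.
  transitivity (fine (pi ((setT `*` A) `&` (Omega `*` Omega)))).
    by congr fine; exact/esym/(probability_restrict mOO mAT pi1).
  rewrite -[LHS]e; apply: (bm_eq pi) => z _; rewrite mulr1 !indicE; suff -> : (z \in setT `*` A) = (z.2 \in A) by [].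
  by apply/idP/idP => /set_mem h2; apply/mem_set => //; case: h2.
by apply: (bm_eq pi) => z _; rewrite mulr1.
Qed.

(** The easy direction of Kantorovich duality, with potential psi: Taylor at z.1, then
    Young's inequality for grad psi z.1 . (z.2 - z.1). *)
Lemma coupling_cost_lower (psi : E -> R) eps K2 : 0 < eps -> 0 <= K2 ->
  bmfun Omega psi -> bmfun Omega (grad2 psi) ->
  (forall x y, Omega x -> Omega y ->
    `|psi y - psi x - dot (grad psi x) (y - x)| <= K2 * dot (y - x) (y - x)) ->
  \int[nu]_(x in Omega) psi x - \int[mu]_(x in Omega) psi x <=
  eps / 2 * \int[mu]_(x in Omega) grad2 psi x +
  ((2 * eps)^-1 + K2) * \int[pi]_(z in Omega `*` Omega) sqdist z.
Proof.
move=> e0 K20 bpsi bg hK.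
have [b1 ->] := coupling_fst bpsi; have [b2 ->] := coupling_snd bpsi.
have [b3 ->] := coupling_fst bg; have b4 := bmfun_sqdist.
have c1 a (h : E * E -> R) : bmfun (Omega `*` Omega) h -> bmfun (Omega `*` Omega) (fun z => a * h z).
  by move=> bh; apply: bmfunM => //; exact: bmfun_cst.
rewrite -(bm_B mOO fOO b2 b1) -(bm_Z mOO fOO _ b3) -(bm_Z mOO fOO _ b4).
rewrite -(bm_D mOO fOO (c1 _ _ b3) (c1 _ _ b4)); apply: (bm_le mOO fOO).
- exact: bmfunB.
- by apply: bmfunD; exact: c1.
move=> z [Oz1 Oz2]; have := hK _ _ Oz1 Oz2; rewrite ler_norml => /andP[_].
have -> : sqdist z = dot (z.2 - z.1) (z.2 - z.1).
  have dN (a : E) : dot (- a) (- a) = dot a a by rewrite -scaleN1r dotZl dotZr !mulN1r opprK.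
  by rewrite /sqdist enorm_sqr -opprB dN.
move: (z.2 - z.1) => v.
have : 0 <= dot (eps *: grad psi z.1 - v) (eps *: grad psi z.1 - v) by exact: dot_ge0.
rewrite dotBl !dotBr !dotZl !dotZr (dotC v) -/(grad2 psi z.1).
move: (dot (grad psi z.1) v) (grad2 psi z.1) (dot v v) (psi z.2 - psi z.1) => p g q s.
move=> h1 h2; rewrite lerBlDr in h2; apply: le_trans h2 _.
rewrite -(ler_pM2l (_ : 0 < 2 * eps)) ?mulr_gt0 //.
have -> : 2 * eps * (eps / 2 * g + ((2 * eps)^-1 + K2) * q) = eps * (eps * g) + q + 2 * eps * (K2 * q).
  by field; rewrite gt_eqF.
lra.
Qed.

End marginals.
End couplings.

(** * Bounds on the Wasserstein distance *)

Lemma pushforward_probability d d' (T : measurableType d) (T' : measurableType d') (R : realType)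
  (P : probability T R) (F : T -> T') : measurable_fun setT F ->
  exists Q : probability T' R, forall A, Q A = P (F @^-1` A).
Proof.
move=> mF; have mF' : F \in mfun by exact: mem_set.
by exists (distribution P (mfun_Sub mF')).
Qed.

Section wasserstein_bounds.
Variables (R : realType) (n : nat).
Local Notation E := 'rV[R]_n.
Local Notation leb := (lebesgue_rV R n).
Implicit Types (x y : E) (h w : E -> R).
Variable (Omega : set E).
Hypotheses (oO : open Omega) (bO : bounded_set Omega).
Variables (mu nu : probability E R) (f g : E -> R) (T : E -> E).
Hypotheses (df : has_density Omega mu f) (bf : bmfun Omega f).
Hypotheses (dg : has_density Omega nu g) (bg : bmfun Omega g).
Hypothesis mT : measurable_fun Omega T.
Hypothesis push : pushes_forward Omega mu nu T.
Local Notation S := (stays Omega T).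
Let mO : measurable Omega. Proof. exact: open_measurable_rV. Qed.
Let mOO : measurable (Omega `*` Omega). Proof. exact: measurableX. Qed.
Let mS : measurable S. Proof. exact: measurable_stays. Qed.

(** The image of mu under x |-> (x, T x); as T is measurable on Omega only, it is made
    constant outside. *)
Lemma map_coupling : exists2 pi : probability (E * E)%type R, coupling Omega mu nu pi &
  forall h : E * E -> R, bmfun (Omega `*` Omega) h ->
    \int[pi]_(z in Omega `*` Omega) h z = \int[leb]_(x in S) (h (x, T x) * f x).
Proof.
pose T' x := if x \in Omega then T x else 0.
have T'E x : Omega x -> T' x = T x by move=> Ox; rewrite /T' mem_set.
have mT' : measurable_fun setT T'.
  apply: measurable_fun_rV => i.
  have -> : rV_coord i \o T' = (fun x => T x ord0 i) \_ Omega.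
    by apply/funext => x; rewrite /rV_coord /= /T' patchE; case: ifP => //; rewrite mxE.
  apply/(measurable_restrictT _ mO).
  exact: (measurableT_comp (@measurable_rV_coord R n i) mT).
have mF : measurable_fun setT (fun x => (x, T' x)) by exact: measurable_fun_pair.
have [pi piE] := pushforward_probability mu mF.
have mu1 := (density_total oO bO df bf).1.
have pS A : A `<=` Omega `*` Omega -> (fun x => (x, T' x)) @^-1` A `<=` S.
  by move=> AO x /= /AO[/= Ox]; rewrite (T'E _ Ox).
have pi1 : pi (Omega `*` Omega) = 1%E.
  rewrite piE -(mu_stays oO bO dg bg push); congr (mu _).
  apply/seteqP; split => x /=; first by move=> [Ox]; rewrite T'E.
  by move=> [Ox OTx]; rewrite T'E.
exists pi.
  split => // A mA; rewrite piE.
    by congr (mu _); apply/seteqP; split => [x []|x Ax] //.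
  rewrite push // [X in mu X = _](_ : _ = T' @^-1` A); last first.
    by apply/seteqP; split => [x []|x Ax] //.
  rewrite -(probability_restrict mO _ mu1); last by rewrite -[X in measurable X]setTI; exact: mT'.
  by rewrite setIC; congr (mu _); apply/seteqP; split => x [Ox /=]; rewrite T'E.
move=> h bh; have fS := stays_finite oO bO mT.
have fOO : (pi (Omega `*` Omega) < +oo)%E by move: pi1 => /= ->; exact: ltry.
have mFS : measurable_fun S (fun x => (x, T' x)) by exact: measurable_funTS.
have SOO x : S x -> (Omega `*` Omega) (x, T' x) by move=> [Ox OTx]; split => //=; rewrite T'E.
have bfS : bmfun S f.
  case: bf => mf [M hM]; split; last by exists M => x [/hM].
  by apply: measurable_funS mf => // x [].
etransitivity; first apply: (bm_transfer mS fS mOO fOO mFS SOO bfS) => //.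
  move=> A mA AO; have mFA : measurable ((fun x => (x, T' x)) @^-1` A).
    by rewrite -[X in measurable X]setTI; exact: mF.
  transitivity (fine (pi A)) => //; rewrite piE (density_setE oO bO df bf mFA); last first.
    by move=> x /pS -/(_ AO)[].
  rewrite /= (integral_outside mS mFA _ fS).
  - by apply: (bm_eq leb) => x Ax; rewrite indicE mem_set // mul1r.
  - exact: pS.
  - apply: bmfunM => //; split; last by exists 1 => x _; rewrite indicE; case: (_ \in _); rewrite ?normr1 ?normr0.
    by apply: (measurable_comp (F := setT)) => //; exact: measurable_indic.
  - by move=> x Sx nA; rewrite indicE memNset ?mul0r.
by apply: (bm_eq leb) => x [Ox _]; rewrite T'E.
Qed.

Lemma sqrte_sqr_ge0 (a : R) : 0 <= a -> sqrte (a ^+ 2)%:E = a%:E.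
Proof. by move=> a0 /=; rewrite sqrtr_sqr ger0_norm. Qed.

Lemma W2_upper (a : R) : 0 <= a ->
  \int[leb]_(x in S) (enorm (x - T x) ^+ 2 * f x) <= a ^+ 2 ->
  (W2 Omega mu nu <= a%:E)%E.
Proof.
move=> a0 h; rewrite -(sqrte_sqr_ge0 a0) /W2 lee_sqrt ?lee_fin ?sqr_ge0 //.
have [pi cpi hpi] := map_coupling.
apply: ereal_inf_le; exists (\int[pi]_(z in Omega `*` Omega) (enorm (z.1 - z.2) ^+ 2)%:E)%E.
  by exists pi.
have bd := bmfun_sqdist bO.
have fOO : (pi (Omega `*` Omega) < +oo)%E by case: cpi => /= -> _ _; exact: ltry.
rewrite (bmfun_integralE mOO fOO bd) lee_fin.
by apply: le_trans h; rewrite hpi.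
Qed.

Lemma W2_lower (a : R) : 0 <= a -> (forall pi, coupling Omega mu nu pi ->
    a ^+ 2 <= \int[pi]_(z in Omega `*` Omega) (enorm (z.1 - z.2) ^+ 2)) ->
  (a%:E <= W2 Omega mu nu)%E.
Proof.
move=> a0 h; rewrite -(sqrte_sqr_ge0 a0) /W2.
have h2 : ((a ^+ 2)%:E <= ereal_inf [set (\int[pi]_(z in Omega `*` Omega) (enorm (z.1 - z.2) ^+ 2)%:E)%E
     | pi in coupling Omega mu nu])%E.
  apply: le_ereal_inf_tmp => _ [pi cpi <-].
  have fOO : (pi (Omega `*` Omega) < +oo)%E by case: cpi => /= -> _ _; exact: ltry.
  by rewrite (bmfun_integralE mOO fOO (bmfun_sqdist bO)) lee_fin h.
by rewrite lee_sqrt //; apply: le_trans h2; rewrite lee_fin sqr_ge0.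
Qed.

End wasserstein_bounds.

(** * The transport map of a potential *)

(** The first term bounds |det (I + eps H) - 1| / eps when the entries of H are at most K2
    and eps <= 1; the second one accounts for the factor 1 + eps u. *)
Definition jacobian_constant (R : realType) (n : nat) (K2 Ku : R) : R :=
  let Cd := (n`!)%:R * (n%:R * (1 + K2) ^+ n * K2) in Cd + Ku * (1 + Cd).

Section kantorovich_potential.
Variables (R : realType) (n : nat).
Local Notation E := 'rV[R]_n.
Implicit Types (x y v : E) (h w : E -> R).

Lemma is_derive_coord x v j : is_derive x v (fun y : E => y ord0 j) (v ord0 j).
Proof.
have := proj2 (is_derive_line (fun y : E => y ord0 j) x v 0 (v ord0 j)).
rewrite scale0r addr0; apply.
have -> : (fun t : R => (x + t *: v) ord0 j) = (fun t => x ord0 j + t * v ord0 j).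
  by apply/funext => t; rewrite !mxE.
by apply: is_derive_eq; rewrite /GRing.scale /=; ring.
Qed.

(** Along a line, |x|^2 / 2 is a quadratic polynomial. *)
Lemma is_derive_half_enorm x v : is_derive x v (fun y : E => enorm y ^+ 2 / 2) (dot x v).
Proof.
have := proj2 (is_derive_line (fun y : E => enorm y ^+ 2 / 2) x v 0 (dot x v)).
rewrite scale0r addr0; apply.
have -> : (fun t : R => enorm (x + t *: v) ^+ 2 / 2) =
   (fun t => dot x x / 2 + t * dot x v + t * t * (dot v v / 2)).
  by apply/funext => t; rewrite enorm_sqr dotDl !dotDr !dotZl !dotZr (dotC v x); field.
apply: is_derive_eq; rewrite /GRing.scale /=; ring.
Qed.

Variable (Omega : set E).
Hypotheses (oO : open Omega) (bO : bounded_set Omega).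

Lemma C1ext_coord j : C1ext Omega (fun y : E => y ord0 j) /\
  forall i x, partial i (fun y : E => y ord0 j) x = (j == i)%:R.
Proof.
have p i x : partial i (fun y : E => y ord0 j) x = (j == i)%:R.
  have [_ e] := is_derive_coord x (delta_mx ord0 i) j.
  by rewrite /partial e mxE.
split => //; split.
  exists (fun y : E => y ord0 j) => //.
  by apply: continuous_subspaceT => x; exact: coord_continuous.
move=> i; split; first by apply: (eq_ext _ (ext_cst _ (j == i)%:R)) => x _; rewrite p.
by move=> x _; have [] := is_derive_coord x (delta_mx ord0 i) j.
Qed.

Variables (psi phi : E -> R) (eps : R).
Hypothesis spsi : smooth_closure Omega psi.
Hypothesis phiE : forall x, phi x = enorm x ^+ 2 / 2 + eps * psi x.

Lemma partial_potential j x : Omega x -> partial j phi x = x ord0 j + eps * partial j psi x.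
Proof.
move=> Ox; rewrite /partial (_ : phi = (fun x => enorm x ^+ 2 / 2) + eps *: psi); last first.
  by apply/funext => y; rewrite phiE.
have [_ /(_ j)[_ /(_ x Ox) dpsi]] := smooth_C1 spsi.
have d1 := is_derive_half_enorm x (delta_mx ord0 j).
have d2 : is_derive x (delta_mx ord0 j : E) psi (partial j psi x) by exact: derivableP.
have [_ ->] : is_derive x (delta_mx ord0 j : E) ((fun x => enorm x ^+ 2 / 2) + eps *: psi)
  (dot x (delta_mx ord0 j) + eps *: partial j psi x) by exact: is_deriveD.
congr (_ + _); rewrite /dot (bigD1 j) //= !mxE !eqxx mulr1 big1 ?addr0 // => i ij.
by rewrite mxE (negbTE ij) andbF mulr0.
Qed.

Lemma grad_potential x : Omega x -> grad phi x = displaced psi eps x.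
Proof. by move=> Ox; apply/rowP => j; rewrite !mxE partial_potential. Qed.

Lemma hessian_potential x : Omega x -> hessian phi x = 1%:M + eps *: hessian psi x.
Proof.
move=> Ox; apply/matrixP => i j; rewrite !mxE.
have [_ /(_ i)[_ /(_ x Ox) dp]] := smooth_C1_partial j spsi.
have d1 := is_derive_coord x (delta_mx ord0 i) j.
have d2 : is_derive x (delta_mx ord0 i : E) (partial j psi) (partial i (partial j psi) x) by exact: derivableP.
have d3 : is_derive x (delta_mx ord0 i : E) ((fun y : E => y ord0 j) + eps *: partial j psi)
  ((delta_mx ord0 i : E) ord0 j + eps *: partial i (partial j psi) x) by exact: is_deriveD.
have [_ e] : is_derive x (delta_mx ord0 i : E) (partial j phi)
    ((delta_mx ord0 i : E) ord0 j + eps *: partial i (partial j psi) x).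
  apply: near_eq_is_derive d3.
  have : \forall y \near x, Omega y by exact: open_nbhs_nbhs.
  by apply: filterS => y Oy; rewrite partial_potential.
by rewrite {1}/partial e mxE eqxx eq_sym.
Qed.

(** The Monge-Ampere equation reads f x / f (T x) = (1 + eps u (T x)) det (I + eps H), and
    both factors are 1 + O(eps). *)
Lemma monge_ampere_comparable (f g u : E -> R) K2 Ku x :
  0 <= K2 -> 0 <= Ku -> 0 < eps <= 1 ->
  Omega x -> Omega (displaced psi eps x) -> 0 < f (displaced psi eps x) ->
  (forall i j, `|hessian psi x i j| <= K2) -> `|u (displaced psi eps x)| <= Ku ->
  g (displaced psi eps x) = (1 + eps * u (displaced psi eps x)) * f (displaced psi eps x) ->
  f x = g (grad phi x) * \det (hessian phi x) ->
  `|f x - f (displaced psi eps x)| <= jacobian_constant n K2 Ku * eps * f (displaced psi eps x).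
Proof.
move=> K20 Ku0 /andP[e0 e1] Ox OTx fT hH hu gE ma.
have [Cd CdE] : exists Cd : R, Cd = (n`!)%:R * (n%:R * (1 + K2) ^+ n * K2) by eexists.
rewrite /jacobian_constant -CdE.
have [y yE] : exists y, y = displaced psi eps x by eexists.
rewrite ma grad_potential // gE -yE hessian_potential //; rewrite -yE in OTx fT hu.
have Cd0 : 0 <= Cd by rewrite CdE !mulr_ge0 // exprn_ge0 // addr_ge0.
have hd : `|\det (1%:M + eps *: hessian psi x) - 1| <= Cd * eps.
  rewrite -[X in _ - X](det1 R n); apply: le_trans (det_lipschitz (M := 1 + K2) (d := eps * K2) _ _ _ _) _.
  - by rewrite lerDl.
  - move=> i j; rewrite !mxE; apply: le_trans (ler_normD _ _) _; apply: lerD.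
      by case: (i == j); rewrite ?mulr1n ?mulr0n ?normr1 ?normr0 ?lexx ?ler01.
    by rewrite normrM gtr0_norm // -[leRHS]mul1r ler_pM // ?(ltW e0) //; have := hH i j; rewrite mxE.
  - by move=> i j; rewrite mxE; case: (i == j); rewrite ?mulr1n ?mulr0n ?normr1 ?normr0 ?lerDl ?addr_ge0.
  - move=> i j; rewrite !mxE addrAC subrr add0r normrM gtr0_norm //.
    by rewrite ler_wpM2l ?(ltW e0) //; have := hH i j; rewrite mxE.
  by rewrite CdE le_eqVlt; apply/orP; left; apply/eqP; ring.
move: (\det _) hd (u y) hu (f y) fT => D hd v hv a a0.
have -> : (1 + eps * v) * a * D - a = ((D - 1) + eps * v * D) * a by ring.
rewrite normrM (gtr0_norm a0) ler_wpM2r ?(ltW a0) //.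
apply: le_trans (ler_normD _ _) _; rewrite mulrDl; apply: lerD => //.
rewrite !normrM (gtr0_norm e0) mulrC [leRHS]mulrC mulrCA ler_wpM2l ?(ltW e0) // mulrC.
apply: ler_pM => //.
have -> : D = (D - 1) + 1 by ring.
apply: le_trans (ler_normD _ _) _; rewrite normr1 addrC lerD2l; apply: le_trans hd _.
by rewrite ler_piMr.
Qed.

End kantorovich_potential.

(** * The dual norm *)

Section dual_norm.
Variables (R : realType) (n : nat).
Local Notation E := 'rV[R]_n.
Local Notation leb := (lebesgue_rV R n).
Implicit Types (x y : E) (h w : E -> R).
Variable (Omega : set E).
Hypotheses (oO : open Omega) (bO : bounded_set Omega).
Variables (mu : probability E R) (f u : E -> R).
Hypotheses (df : has_density Omega mu f) (C1f : C1ext Omega f).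
Hypothesis f0 : forall x, Omega x -> 0 < f x.
Hypothesis bu : bmfun Omega u.
Local Notation I h := (\int[leb]_(x in Omega) (h x * f x)).

Let mO : measurable Omega. Proof. exact: open_measurable_rV. Qed.
Let fO : (leb Omega < +oo)%E. Proof. exact: bounded_finite_measure. Qed.
Let bf : bmfun Omega f. Proof. by apply: (ext_bm oO bO); case: C1f. Qed.

Lemma mu_integralE h : bmfun Omega h -> (\int[mu]_(x in Omega) (h x)%:E)%E = (I h)%:E.
Proof.
move=> bh; have fmu : (mu Omega < +oo)%E.
  by move: (density_total oO bO df bf).1 => /= ->; exact: ltry.
by rewrite (bmfun_integralE mO fmu bh) (density_integral oO bO df bf bh).
Qed.

Lemma Hdot1_eq1 w : C1ext Omega w -> (Hdot1 Omega mu w = 1%E) <-> (I (grad2 w) = 1).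
Proof.
move=> C1w; have bg : bmfun Omega (grad2 w) by apply: (ext_bm oO bO); exact: ext_grad2.
have g0 : 0 <= I (grad2 w) by apply: bm_ge0 => x Ox; rewrite mulr_ge0 ?dot_ge0 // ltW // f0.
have -> : Hdot1 Omega mu w = (Num.sqrt (I (grad2 w)))%:E.
  rewrite /Hdot1 (_ : (\int[mu]_(x in Omega) _)%E = (I (grad2 w))%:E) //.
  by rewrite -(mu_integralE bg); apply: eq_integral => x _; rewrite enorm_sqr.
split=> [[h]|->]; last by rewrite sqrtr1.
by rewrite -(sqr_sqrtr g0) h expr1n.
Qed.

Lemma Hdotm1_ge w : {within closure Omega, continuous w} -> C1ext Omega w -> I (grad2 w) = 1 ->
  ((I (fun x => u x * w x))%:E <= Hdotm1 Omega mu u)%E.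
Proof.
move=> cw C1w Iw; apply: ereal_sup_ubound; exists w; last first.
  by apply: mu_integralE; apply: bmfunM => //; apply: (ext_bm oO bO); case: C1w.
by split; [apply/Ck1P|apply/Hdot1_eq1].
Qed.

Lemma Hdotm1_le a : (forall w, C1ext Omega w -> I (grad2 w) = 1 -> I (fun x => u x * w x) <= a) ->
  (Hdotm1 Omega mu u <= a%:E)%E.
Proof.
move=> h; apply: ge_ereal_sup => _ [w [/Ck1P[cw C1w] /(Hdot1_eq1 C1w) Iw] <-].
rewrite mu_integralE ?lee_fin; first exact: h.
by apply: bmfunM => //; apply: (ext_bm oO bO); case: C1w.
Qed.

Lemma energyZ a w : C1ext Omega w ->
  C1ext Omega (fun x => a * w x) /\ I (grad2 (fun x => a * w x)) = a ^+ 2 * I (grad2 w).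
Proof.
move=> C1w; have [C1aw pa] := C1ext_Z bO a C1w; split => //.
have bg : bmfun Omega (grad2 w) by apply: (ext_bm oO bO); exact: ext_grad2.
rewrite -(bm_Z mO fO _ (bmfunM bg bf)); apply: (bm_eq leb) => x Ox.
rewrite mulrA; congr (_ * _); rewrite /grad2 /dot mulr_sumr; apply: eq_bigr => i _.
by rewrite !mxE pa //; ring.
Qed.

Hypothesis If1 : \int[leb]_(x in Omega) f x = 1.

(** The coordinate functions and their opposites have unit energy, so the supremum is not
    taken over an empty set and is nonnegative. *)
Lemma Hdotm1_ge0 : (0 < n)%N -> (0 <= Hdotm1 Omega mu u)%E.
Proof.
move=> n0; pose j := Ordinal n0; pose w (x : E) := x ord0 j.
have [C1w pw] : C1ext Omega w /\ forall i x, partial i w x = (j == i)%:R by exact: C1ext_coord.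
have cw : {within closure Omega, continuous w}.
  by apply: continuous_subspaceT => x; exact: coord_continuous.
have Iw : I (grad2 w) = 1.
  rewrite -If1; apply: (bm_eq leb) => x _; rewrite /grad2 /dot (bigD1 j) //= !mxE !pw eqxx mulr1.
  rewrite big1 ?addr0 ?mul1r // => i ij; by rewrite mxE pw eq_sym (negbTE ij) mul0r.
have bw : bmfun Omega w by apply: (ext_bm oO bO); case: C1w.
have buw : bmfun Omega (fun x => u x * w x * f x) by apply: bmfunM => //; exact: bmfunM.
have [C1nw Inw] := energyZ (-1) C1w.
rewrite sqrrN expr1n mul1r Iw in Inw.
have cnw : {within closure Omega, continuous (fun x => -1 * w x)}.
  by move=> x; apply: cvgM; [exact: cvg_cst|exact: cw].
have [h|h] := leP 0 (I (fun x => u x * w x)).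
  by apply: le_trans (Hdotm1_ge cw C1w Iw); rewrite lee_fin.
apply: le_trans (Hdotm1_ge cnw C1nw Inw); rewrite lee_fin.
have -> : I (fun x => u x * (-1 * w x)) = -1 * I (fun x => u x * w x).
  by rewrite -(bm_Z mO fO _ buw); apply: (bm_eq leb) => x _; ring.
by rewrite mulN1r oppr_ge0 ltW.
Qed.

(** Test with psi divided by the square root of its energy, unless the energy is 0. *)
Lemma Hdotm1_lower (psi : E -> R) b : (0 < n)%N ->
  {within closure Omega, continuous psi} -> C1ext Omega psi -> b <= 1 ->
  b * I (grad2 psi) <= I (fun x => u x * psi x) ->
  ((Num.sqrt (I (grad2 psi)) * b)%:E <= Hdotm1 Omega mu u)%E.
Proof.
move=> n0 cpsi C1psi b1 h.
have g0 : 0 <= I (grad2 psi) by apply: bm_ge0 => x Ox; rewrite mulr_ge0 ?dot_ge0 // ltW // f0.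
have [A AE] : exists A, A = Num.sqrt (I (grad2 psi)) by eexists.
have A2 : A ^+ 2 = I (grad2 psi) by rewrite AE sqr_sqrtr.
have A0 : 0 <= A by rewrite AE sqrtr_ge0.
rewrite -AE; have [Az|Az] := eqVneq A 0; first by rewrite Az mul0r; exact: Hdotm1_ge0.
have [C1a Ia] := energyZ A^-1 C1psi.
have ca : {within closure Omega, continuous (fun x => A^-1 * psi x)}.
  by move=> x; apply: cvgM; [exact: cvg_cst|exact: cpsi].
have bpsi : bmfun Omega psi by apply: (ext_bm oO bO); case: C1psi.
have bup : bmfun Omega (fun x => u x * psi x * f x) by apply: bmfunM => //; exact: bmfunM.
rewrite -A2 exprVn mulVf ?expf_neq0 // in Ia.
apply: le_trans (Hdotm1_ge ca C1a Ia); rewrite lee_fin.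
have -> : I (fun x => u x * (A^-1 * psi x)) = A^-1 * I (fun x => u x * psi x).
  by rewrite -(bm_Z mO fO _ bup); apply: (bm_eq leb) => x _; ring.
rewrite ler_pdivlMl ?lt_neqAle 1?eq_sym ?Az //.
by apply: le_trans h; rewrite -A2 expr2 mulrA mulrC.
Qed.

(** A test function may be replaced by its difference with its mean: this changes neither
    its energy nor its pairing with u, and makes the spectral gap applicable. *)
Lemma Hdotm1_le_normalized (lambda1 Lam a : R) : 0 < lambda1 -> lambda1^-1 <= Lam ->
  (forall w, C1ext Omega w -> weighted_mean Omega f w = 0 ->
    lambda1 * weighted_norm2 Omega f w <= weighted_dirichlet Omega f w w) ->
  I u = 0 ->
  (forall w, C1ext Omega w -> I (grad2 w) <= 1 -> I (fun x => w x ^+ 2) <= Lam ->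
    I (fun x => u x * w x) <= a) ->
  (Hdotm1 Omega mu u <= a%:E)%E.
Proof.
move=> l0 lL gap Iu h; apply: Hdotm1_le => w C1w Iw.
have [m mE] : exists m, m = I w by eexists.
have bw : bmfun Omega w by apply: (ext_bm oO bO); case: C1w.
have bwf : bmfun Omega (fun x => w x * f x) by exact: bmfunM.
have buw : bmfun Omega (fun x => u x * w x * f x) by apply: bmfunM => //; exact: bmfunM.
have buf : bmfun Omega (fun x => u x * f x) by exact: bmfunM.
have [cm pm] := C1ext_cst Omega (- m).
have [C1v pv] := C1ext_D C1w cm.
have Iv : I (grad2 (fun x => w x + - m)) = 1.
  rewrite -Iw; apply: (bm_eq leb) => x Ox; congr (_ * _); rewrite /grad2 /dot.
  by apply: eq_bigr => i _; rewrite !mxE pv // pm addr0.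
have mv : weighted_mean Omega f (fun x => w x + - m) = 0.
  rewrite /weighted_mean -[RHS](subrr m) [X in _ = X - _]mE -[X in _ = _ - X]mulr1 -If1.
  rewrite -(bm_Z mO fO _ bf) -(bm_B mO fO) //; last by apply: bmfunM => //; exact: bmfun_cst.
  by apply: (bm_eq leb) => x _; rewrite mulrBl.
have -> : I (fun x => u x * w x) = I (fun x => u x * (w x + - m)).
  rewrite -[LHS]subr0 -[X in _ - X](mulr0 m) -Iu -(bm_Z mO fO _ buf) -(bm_B mO fO) //.
    by apply: (bm_eq leb) => x _; ring.
  by apply: bmfunM => //; exact: bmfun_cst.
apply: h => //; first by rewrite Iv.
have := gap _ C1v mv; rewrite -[X in _ <= X -> _]/(I (grad2 _)) Iv -ler_pdivlMl // mulr1 => hn.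
exact: le_trans hn lL.
Qed.

End dual_norm.

(** * The constant *)

Section constants.
Variables (R : realType) (n : nat).

(** The constant of dual_norm_upper, for C1 = jacobian_constant and for the threshold
    B eps^2 with B = 4 KF K1^2 + 1 on the density. *)
Definition dual_constant (KF K1 K2 Ku V Lam : R) : R :=
  let C1 := jacobian_constant n K2 Ku in
  2^-1 + (K1 + 1) * (2 * (n%:R * (K2 * n%:R))) / 2 + C1 * K1 + KF * K1 ^+ 2 * (K1 ^+ 2 * V) +
  (4 * C1 * (1 + Ku) + Ku) * ((4 * (4 * (KF * K1 ^+ 2) + 1) * V + Lam) / 2).

(** When eps times this is at most 1, all the conditions on eps met above hold. *)
Definition smallness (K2 Ku : R) : R :=
  1 + 4 * jacobian_constant n K2 Ku + 2 * (n%:R * (K2 * n%:R)) + 2 * K2.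

(** The last term takes care of the values of eps larger than 1 / smallness. *)
Definition linearization_constant (KF K1 K2 Ku V Lam : R) : R :=
  dual_constant KF K1 K2 Ku V Lam + 2 * (K1 * K2) + smallness K2 Ku * (K1 + (Ku ^+ 2 + Lam) / 2).

Lemma jacobian_constant_ge0 (K2 Ku : R) : 0 <= K2 -> 0 <= Ku -> 0 <= jacobian_constant n K2 Ku.
Proof.
move=> K20 Ku0; rewrite /jacobian_constant.
have h : 0 <= (n`!)%:R * (n%:R * (1 + K2) ^+ n * K2) by rewrite !mulr_ge0 // exprn_ge0 // addr_ge0.
by rewrite addr_ge0 // mulr_ge0 // addr_ge0.
Qed.

Lemma smallness_ge0 (K2 Ku : R) : 0 <= K2 -> 0 <= Ku -> 0 <= smallness K2 Ku.
Proof.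
move=> K20 Ku0; have := jacobian_constant_ge0 K20 Ku0; rewrite /smallness => h.
by rewrite !addr_ge0 // !mulr_ge0.
Qed.

Lemma dual_constant_ge0 (KF K1 K2 Ku V Lam : R) : 0 <= KF -> 0 <= K1 -> 0 <= K2 -> 0 <= Ku ->
  0 <= V -> 0 <= Lam -> 0 <= dual_constant KF K1 K2 Ku V Lam.
Proof.
move=> h1 h2 h3 h4 h5 h6; rewrite /dual_constant /=.
have := jacobian_constant_ge0 h3 h4; move: (jacobian_constant _ _ _) => C1 C10.
have q0 : 0 <= KF * K1 ^+ 2 by rewrite mulr_ge0 ?sqr_ge0.
have n0 : 0 <= n%:R * (K2 * n%:R) by rewrite !mulr_ge0.
apply: addr_ge0; last first.
  apply: mulr_ge0; first by apply: addr_ge0 => //; apply: mulr_ge0; [lra|lra].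
  by apply: divr_ge0 => //; apply: addr_ge0 => //; apply: mulr_ge0 => //; lra.
apply: addr_ge0; last by rewrite mulr_ge0 // mulr_ge0 ?sqr_ge0.
apply: addr_ge0; last exact: mulr_ge0.
apply: addr_ge0; first by rewrite invr_ge0.
by apply: divr_ge0 => //; apply: mulr_ge0; [lra|rewrite mulr_ge0].
Qed.

Lemma small_eps_arith (A W H e K1 K2 C : R) : 0 < e -> 0 <= A <= K1 -> 0 <= K2 -> 0 <= C ->
  A * (e * (1 - 2 * (e * K2))) <= W <= e * A -> A * (1 - e * K2) <= H <= A + e * C ->
  `|W - e * H| <= (C + 2 * (K1 * K2)) * e ^+ 2.
Proof.
move=> e0 /andP[A0 AK] K20 C0 /andP[W1 W2] /andP[H1 H2].
have g1 : e * H <= e * (A + e * C) by rewrite ler_wpM2l // ltW.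
have g2 : e * (A * (1 - e * K2)) <= e * H by rewrite ler_wpM2l // ltW.
have g3 : e ^+ 2 * (A * K2) <= e ^+ 2 * (K1 * K2).
  by rewrite ler_wpM2l ?sqr_ge0 // ler_wpM2r.
have g4 : 0 <= e ^+ 2 * C by rewrite mulr_ge0 ?sqr_ge0.
have g5 : 0 <= e ^+ 2 * (A * K2) by rewrite mulr_ge0 ?sqr_ge0 // mulr_ge0.
rewrite ler_norml; apply/andP; split; nra.
Qed.

Lemma large_eps_arith (A W H e K1 M Q : R) : 0 < e -> 0 <= A <= K1 -> 0 <= Q -> 1 <= e * M ->
  0 <= W <= e * A -> 0 <= H <= Q -> `|W - e * H| <= M * (K1 + Q) * e ^+ 2.
Proof.
move=> e0 /andP[A0 AK] Q0 M1 /andP[W0 W1] /andP[H0 H1].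
have g0 : e * (K1 + Q) <= M * (K1 + Q) * e ^+ 2.
  have -> : M * (K1 + Q) * e ^+ 2 = (e * M) * (e * (K1 + Q)) by ring.
  by rewrite ler_peMl // mulr_ge0 ?(ltW e0) // addr_ge0 // (le_trans A0).
apply: le_trans g0; have g1 : e * H <= e * Q by rewrite ler_wpM2l // ltW.
have g2 : 0 <= e * H by rewrite mulr_ge0 // ltW.
have g3 : e * A <= e * K1 by rewrite ler_wpM2l // ltW.
have g4 : 0 <= e * A by rewrite mulr_ge0 // ltW.
have g5 : 0 <= e * Q by rewrite mulr_ge0 // ltW.
rewrite mulrDr ler_norml; apply/andP; split; lra.
Qed.

Lemma smallness_arith (e J Z K2 : R) : 0 < e -> 0 <= J -> 0 <= Z -> 0 <= K2 ->
  e * (1 + 4 * J + 2 * Z + 2 * K2) <= 1 ->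
  [/\ e <= 1, 4 * (J * e) <= 1, 2 * (e * Z) <= 1 & 2 * (e * K2) <= 1].
Proof.
move=> e0 J0 Z0 K20.
have := mulr_ge0 (ltW e0) J0; have := mulr_ge0 (ltW e0) Z0; have := mulr_ge0 (ltW e0) K20.
by move=> h1 h2 h3 h; split; nra.
Qed.

(** X is the cost of a coupling, D = A^2 and P the integral of u psi. The factor
    (1 - 2 s) / (1 + 2 s), with s = e K2, is bounded below by (1 - 2 s)^2. *)
Lemma cost_arith (X e K2 D P : R) : 0 < e -> 0 <= K2 -> 2 * (e * K2) <= 1 -> 0 <= D ->
  (1 - e * K2) * D <= P -> e * P <= e / 2 * D + ((2 * e)^-1 + K2) * X ->
  (e * (1 - 2 * (e * K2))) ^+ 2 * D <= X.
Proof.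
move=> e0 K20 s1 D0 h1 h2.
have s0 : 0 <= e * K2 by rewrite mulr_ge0 // ltW.
have h3 : e * ((1 - e * K2) * D) <= e * P by rewrite ler_wpM2l // ltW.
have h4 : 2 * e * (e * ((1 - e * K2) * D)) <= 2 * e * (e / 2 * D + ((2 * e)^-1 + K2) * X).
  by rewrite ler_wpM2l ?mulr_ge0 ?(ltW e0) //; lra.
have e4 : 2 * e * (e / 2 * D + ((2 * e)^-1 + K2) * X) = e ^+ 2 * D + (1 + 2 * (e * K2)) * X.
  by field; rewrite gt_eqF.
rewrite e4 in h4.
have h5 : e ^+ 2 * ((1 - 2 * (e * K2)) * D) <= (1 + 2 * (e * K2)) * X by nra.
have p0 : 0 < 1 + 2 * (e * K2) by lra.
rewrite -(ler_pM2l p0); apply: le_trans h5.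
have -> : (1 + 2 * (e * K2)) * ((e * (1 - 2 * (e * K2))) ^+ 2 * D) =
  e ^+ 2 * ((1 - (2 * (e * K2)) ^+ 2) * ((1 - 2 * (e * K2)) * D)) by ring.
rewrite ler_wpM2l ?sqr_ge0 // ler_piMl //; last by rewrite lerBlDr lerDl sqr_ge0.
by rewrite mulr_ge0 //; lra.
Qed.

End constants.

(** * The linearization estimate *)

Section linearization.
Variables (R : realType) (n : nat).
Hypothesis n0 : (0 < n)%N.
Local Notation E := 'rV[R]_n.
Local Notation leb := (lebesgue_rV R n).
Implicit Types (x y : E) (h w : E -> R).
Variables (Omega : set E) (eps : R) (mu nu : probability E R).
Variables (f g u psi phi : E -> R) (lambda1 : R).
Variables (KF K1 K2 Ku V Lam : R).
Hypotheses (oO : open Omega) (bO : bounded_set Omega).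
Hypothesis cO : convex_set (Omega : set (convex_lmodType E)).
Hypothesis eps0 : 0 < eps.
Hypotheses (sf : smooth_closure Omega f) (sg : smooth_closure Omega g).
Hypothesis f0 : forall x, closure Omega x -> 0 < f x.
Hypotheses (df : has_density Omega mu f) (dg : has_density Omega nu g).
Hypothesis su : smooth_closure Omega u.
Hypothesis gE : forall x, closure Omega x -> g x = (1 + eps * u x) * f x.
Hypothesis spsi : smooth_closure Omega psi.
Hypothesis phiE : forall x, phi x = enorm x ^+ 2 / 2 + eps * psi x.
Hypothesis push_phi : pushes_forward Omega mu nu (grad phi).
Hypothesis ma : forall x, Omega x -> f x = g (grad phi x) * \det (hessian phi x).
Hypothesis lambda1_eig : smallest_positive_eigenvalue Omega f lambda1.
Hypothesis aeF : ae_upper_bound Omega (fun x => opnorm (hessian f x)) KF.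
Hypothesis ae1 : ae_upper_bound Omega (fun x => enorm (grad psi x)) K1.
Hypothesis ae2 : ae_upper_bound Omega (fun x => opnorm (hessian psi x)) K2.
Hypothesis aeu : ae_upper_bound Omega (fun x => `|u x|) Ku.
Hypothesis hV : (leb Omega <= V%:E)%E.
Hypothesis hLam : lambda1^-1 <= Lam.

Local Notation T := (displaced psi eps).
Local Notation S := (stays Omega T).
Local Notation I h := (\int[leb]_(x in Omega) (h x * f x)).

Let mO : measurable Omega. Proof. exact: open_measurable_rV. Qed.
Let fO : (leb Omega < +oo)%E. Proof. exact: bounded_finite_measure. Qed.
Let C1f : C1ext Omega f. Proof. exact: smooth_C1. Qed.
Let C1psi : C1ext Omega psi. Proof. exact: smooth_C1. Qed.
Let bC h : C1ext Omega h -> bmfun Omega h.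
Proof. by move=> [eh _]; exact: (ext_bm oO bO). Qed.
Let bf : bmfun Omega f. Proof. exact: bC. Qed.
Let bu : bmfun Omega u. Proof. exact/bC/smooth_C1. Qed.
Let bg : bmfun Omega g. Proof. exact/bC/smooth_C1. Qed.
Let bpsi : bmfun Omega psi. Proof. exact: bC. Qed.
Let bg2 : bmfun Omega (grad2 psi). Proof. by apply: (ext_bm oO bO); exact: ext_grad2. Qed.
Let sub x : Omega x -> closure Omega x. Proof. exact: subset_closure. Qed.
Let fpos x : Omega x -> 0 < f x. Proof. by move=> /sub; exact: f0. Qed.
Let If1 : \int[leb]_(x in Omega) f x = 1. Proof. exact: (density_total oO bO df bf).2. Qed.

Let nonempty : exists x, Omega x.
Proof.
apply/set0P/negP => /eqP O0; move: If1; rewrite O0 Rintegral_set0 => /eqP.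
by rewrite eq_sym oner_eq0.
Qed.

Let ae_ge0 h K : ae_upper_bound Omega h K -> (forall x, 0 <= h x) -> 0 <= K.
Proof.
move=> hK h0; have [x Ox] := nonempty.
apply: (ae_everywhere oO (h := fun=> 0) hK) Ox => [y _ hy|y _]; first exact: le_trans hy.
exact: cst_continuous.
Qed.

Let opnorm_ge0 (M : 'M[R]_n) : 0 <= opnorm M.
Proof.
have e0 : enorm (0 : E) = 0 by rewrite /enorm /dot big1 ?sqrtr0 // => i _; rewrite mxE mul0r.
by have := @opnorm_ub R n M 0; rewrite mul0mx e0; apply.
Qed.

Let KF0 : 0 <= KF. Proof. exact: ae_ge0 aeF (fun x => opnorm_ge0 _). Qed.
Let K10 : 0 <= K1. Proof. exact: ae_ge0 ae1 (fun x => enorm_ge0 _). Qed.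
Let K20 : 0 <= K2. Proof. exact: ae_ge0 ae2 (fun x => opnorm_ge0 _). Qed.
Let Ku0 : 0 <= Ku. Proof. exact: ae_ge0 aeu (fun x => normr_ge0 _). Qed.
Let l0 : 0 < lambda1. Proof. by case: lambda1_eig. Qed.
Let Lam0 : 0 <= Lam. Proof. by apply: le_trans hLam; rewrite invr_ge0 ltW. Qed.
Let hV' : fine (leb Omega) <= V.
Proof. by rewrite -lee_fin fineK // ge0_fin_numE. Qed.
Let V0 : 0 <= V. Proof. exact: le_trans (fine_ge0 (measure_ge0 _ _)) hV'. Qed.

Let hK1 x : Omega x -> grad2 psi x <= K1 ^+ 2.
Proof.
apply: (ae_everywhere oO (h := grad2 psi) ae1) => {}x Ox.
  by move=> h; rewrite /grad2 -enorm_sqr ler_pXn2r ?nnegrE ?enorm_ge0.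
by apply: (ext_cont oO bO) => //; exact: ext_grad2.
Qed.

Let hKu x : Omega x -> `|u x| <= Ku.
Proof.
apply: (ae_everywhere oO (h := fun x => `|u x|) aeu) => // {}x Ox.
apply: continuous_comp; last exact: norm_continuous.
by apply: (ext_cont oO bO) => //; case: (smooth_C1 su).
Qed.

Let push : pushes_forward Omega mu nu T.
Proof.
move=> A mA; rewrite push_phi //; congr (mu _); apply/seteqP.
by split => x [Ox Ax]; split => //; move: Ax; rewrite /= (grad_potential spsi phiE).
Qed.

Let mT : measurable_fun Omega T. Proof. exact: measurable_displaced. Qed.

Let full h : bmfun Omega h -> \int[leb]_(x in S) (h x * f x) = I h.
Proof. by apply: (stays_full oO bO df bf dg bg) => // x /fpos /ltW. Qed.

Let moved h : bmfun Omega h ->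
  I (fun x => h x * (1 + eps * u x)) = \int[leb]_(x in S) (h (T x) * f x).
Proof.
move=> bh; rewrite -(push_integral oO bO df bf dg bg mT push bh).
by apply: (bm_eq leb) => x Ox; rewrite (gE (sub Ox)) mulrA.
Qed.

Let taylor_psi x y : Omega x -> Omega y ->
  `|psi y - psi x - dot (grad psi x) (y - x)| <= K2 * dot (y - x) (y - x).
Proof. exact: (taylor_bound oO bO cO spsi ae2). Qed.

Let A := Num.sqrt (I (grad2 psi)).
Let A0 : 0 <= A. Proof. exact: sqrtr_ge0. Qed.
Let A2 : A ^+ 2 = I (grad2 psi). Proof. exact: energy_sqr. Qed.
Let AK : A <= K1. Proof. exact: (energy_le oO bO C1f fpos If1 C1psi). Qed.

Let lower : (1 - eps * K2) * I (grad2 psi) <= I (fun x => u x * psi x).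
Proof. exact: (energy_lower oO bO C1f fpos C1psi eps0 bu full moved taylor_psi). Qed.

Let Iu : I u = 0.
Proof.
have := increment_integral oO bO C1f C1psi bu full moved (bmfun_cst Omega 1).
have -> : \int[leb]_(x in S) ((1 - 1) * f x) = 0.
  by rewrite subrr; under eq_Rintegral do rewrite mul0r; rewrite Rintegral_cst ?mul0r //; exact: measurable_stays.
under [X in _ = _ * X]eq_Rintegral do rewrite mulr1.
by move/esym/eqP; rewrite mulf_eq0 gt_eqF //= => /eqP.
Qed.

Let gap : forall w, C1ext Omega w -> weighted_mean Omega f w = 0 ->
  lambda1 * weighted_norm2 Omega f w <= weighted_dirichlet Omega f w w.
Proof.
have [cf _] := sf 0%N; case: lambda1_eig => _ _ hl.
exact: (spectral_gap oO bO cO cf C1f f0 If1 l0 hl).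
Qed.

Lemma W2_le : (W2 Omega mu nu <= (eps * A)%:E)%E.
Proof.
apply: (W2_upper oO bO df bf dg bg mT push); first by rewrite mulr_ge0 // ltW.
have b1 : bmfun S (fun x => grad2 psi x * f x).
  by apply: (bmfun_stays oO) => //; exact: bmfunM.
have mS : measurable S by exact: measurable_stays.
rewrite exprMn A2 -full // -(bm_Z mS (stays_finite oO bO mT) _ b1) le_eqVlt; apply/orP; left; apply/eqP.
apply: (bm_eq leb) => x _; rewrite -[in LHS](opprB (T x)) displacedB enorm_sqr -scaleN1r scalerA.
by rewrite dotZl dotZr /grad2; ring.
Qed.

(** The factor 1 - 2 eps K2 comes from the second order terms of psi. *)
Lemma W2_ge : 2 * (eps * K2) <= 1 -> ((A * (eps * (1 - 2 * (eps * K2))))%:E <= W2 Omega mu nu)%E.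
Proof.
move=> s1; apply: (W2_lower oO bO).
  by rewrite mulr_ge0 // mulr_ge0 ?(ltW eps0) // subr_ge0.
move=> pi cpi; rewrite exprMn mulrC A2.
have D0 : 0 <= I (grad2 psi) by rewrite -A2 sqr_ge0.
have mu1 := (density_total oO bO df bf).1; have nu1 := (density_total oO bO dg bg).1.
apply: (cost_arith eps0 K20 s1 D0 lower).
have := coupling_cost_lower oO bO mu1 nu1 cpi eps0 K20 bpsi bg2 taylor_psi.
rewrite (density_integral oO bO df bf bpsi) (density_integral oO bO df bf bg2) (density_integral oO bO dg bg bpsi).
suff -> : \int[leb]_(x in Omega) (psi x * g x) - I psi = eps * I (fun x => u x * psi x) by [].
have b1 : bmfun Omega (fun x => u x * psi x * f x) by apply: bmfunM => //; exact: bmfunM.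
rewrite -(bm_Z mO fO _ b1) -(bm_B mO fO); [|exact: bmfunM|exact: bmfunM].
by apply: (bm_eq leb) => x Ox; rewrite (gE (sub Ox)); ring.
Qed.

(** Valid for all eps: u w <= (u^2 + w^2) / 2, and the spectral gap. *)
Lemma Hdotm1_bound : (Hdotm1 Omega mu u <= ((Ku ^+ 2 + Lam) / 2)%:E)%E.
Proof.
apply: (Hdotm1_le_normalized oO bO df C1f fpos bu If1 l0 hLam gap Iu) => w C1w Iw Iw2.
have bw := bC C1w.
have b1 : bmfun Omega (fun x => w x ^+ 2 * f x) by apply: bmfunM => //; exact: bmfunX.
have c1 a (h : E -> R) : bmfun Omega h -> bmfun Omega (fun x => a * h x).
  by move=> bh; apply: bmfunM => //; exact: bmfun_cst.
apply: le_trans (_ : \int[leb]_(x in Omega) (Ku ^+ 2 / 2 * f x + 2^-1 * (w x ^+ 2 * f x)) <= _).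
  apply: (bm_le mO fO).
  - by apply: bmfunM => //; exact: bmfunM.
  - by apply: bmfunD; exact: c1.
  move=> x Ox; have uK : u x ^+ 2 <= Ku ^+ 2.
    by rewrite -real_normK ?num_real // ler_pXn2r ?nnegrE // hKu.
  have -> : Ku ^+ 2 / 2 * f x + 2^-1 * (w x ^+ 2 * f x) = (Ku ^+ 2 + w x ^+ 2) / 2 * f x by ring.
  rewrite ler_wpM2r ?(ltW (fpos Ox)) //; have := sqr_ge0 (u x - w x).
  move: uK; move: (u x) (w x) => a b uK h; nra.
rewrite (bm_D mO fO (c1 _ _ bf) (c1 _ _ b1)) (bm_Z mO fO _ bf) (bm_Z mO fO _ b1) If1 mulr1.
by rewrite mulrDl lerD2l mulrC ler_wpM2r.
Qed.

Lemma Hdotm1_near : eps <= 1 -> 4 * (jacobian_constant n K2 Ku * eps) <= 1 ->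
  2 * (n%:R * (eps * (K2 * n%:R))) <= 1 ->
  (Hdotm1 Omega mu u <= (A + eps * dual_constant n KF K1 K2 Ku V Lam)%:E)%E.
Proof.
move=> e1 s1 s2.
apply: (Hdotm1_le_normalized oO bO df C1f fpos bu If1 l0 hLam gap Iu) => w C1w Iw Iw2.
have C10 : 0 <= jacobian_constant n K2 Ku by exact: jacobian_constant_ge0.
have ma1 x : S x -> `|f x - f (T x)| <= jacobian_constant n K2 Ku * eps * f (T x).
  move=> [Ox OTx]; apply: (monge_ampere_comparable oO spsi phiE K20 Ku0 _ Ox OTx _ _ _ _ (ma Ox)).
  - by rewrite eps0.
  - exact: fpos.
  - by move=> i j; exact: (hessian_entry_le oO bO spsi ae2).
  - exact: hKu.
  - exact/gE/sub.
have B0 : 0 < 4 * (KF * K1 ^+ 2) + 1 by rewrite ltr_wpDl // mulr_ge0 // mulr_ge0 ?sqr_ge0.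
apply: (dual_norm_upper oO bO cO C1f fpos If1 C1psi eps0 bu full moved C10 s1 e1 ma1 hKu Ku0 hV' C1w Iw2 B0
  K10 K20 KF0 _ _ hK1 s2 n0 Iw) => //.
- by move=> x y; exact: (taylor_bound oO bO cO sf aeF).
- by move=> x y v; exact: (grad_lipschitz oO bO cO spsi ae2).
- by rewrite lerDl.
Qed.

(** If eps * smallness <= 1, both quantities are eps A + O(eps^2); otherwise both are
    O(eps), and 1 <= eps * smallness. *)
Theorem W2_linearization :
  (`| W2 Omega mu nu - eps%:E * Hdotm1 Omega mu u | <=
     (linearization_constant n KF K1 K2 Ku V Lam * eps ^+ 2)%:E)%E.
Proof.
have W0 : (0 <= W2 Omega mu nu)%E by exact: sqrte_ge0.
have H0 : (0 <= Hdotm1 Omega mu u)%E by exact: (Hdotm1_ge0 oO bO df C1f fpos bu If1).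
have WE := W2_le; have HE := Hdotm1_bound.
have fW : W2 Omega mu nu \is a fin_num by rewrite ge0_fin_numE //; apply: le_lt_trans WE _; exact: ltry.
have fH : Hdotm1 Omega mu u \is a fin_num by rewrite ge0_fin_numE //; apply: le_lt_trans HE _; exact: ltry.
have W_ge := W2_ge; have H_le := Hdotm1_near.
have H_ge := Hdotm1_lower oO bO df C1f fpos bu If1 n0 (proj1 (spsi 0%N)) C1psi _ lower.
move: W0 H0 WE HE W_ge H_le H_ge; rewrite -(fineK fW) -(fineK fH).
move: (fine (W2 _ _ _)) (fine (Hdotm1 _ _ _)) => W H.
rewrite !lee_fin => W0 H0 WE HE W_ge H_le H_ge.
rewrite /linearization_constant.
have Q0 : 0 <= (Ku ^+ 2 + Lam) / 2 by rewrite divr_ge0 // addr_ge0 // sqr_ge0.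
have A01 : 0 <= A <= K1 by rewrite A0 AK.
have D0 := dual_constant_ge0 n KF0 K10 K20 Ku0 V0 Lam0.
have K12 : 0 <= 2 * (K1 * K2) by rewrite !mulr_ge0.
have [eM|eM] := leP (eps * smallness n K2 Ku) 1; last first.
  apply: le_trans (large_eps_arith eps0 A01 Q0 (ltW eM) _ _) _; rewrite ?W0 ?H0 //.
  rewrite ler_wpM2r ?sqr_ge0 // lerDr; exact: addr_ge0.
have [e1 s1 s2 s3] := smallness_arith eps0 (jacobian_constant_ge0 n K20 Ku0)
  (mulr_ge0 (ler0n _ _) (mulr_ge0 K20 (ler0n _ _))) K20 eM.
apply: le_trans (small_eps_arith eps0 A01 K20 D0 _ _) _.
- by rewrite WE W_ge.
- rewrite H_ge /=; last by rewrite lerBlDr lerDl mulr_ge0 // ltW.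
  by apply: H_le => //; move: s2; rewrite (mulrCA eps).
rewrite ler_wpM2r ?sqr_ge0 // lerDl mulr_ge0 ?smallness_ge0 //.
by rewrite addr_ge0.
Qed.

End linearization.

Unset Implicit Arguments.

Theorem proposition3p5 (R : realType) (N : nat) (hN : (0 < N)%N) :
  exists C : R -> R -> R -> R -> R -> R -> R -> R -> R,
  forall (Omega : set 'rV[R]_N) (eps : R) (mu nu : probability 'rV[R]_N R)
    (f g u psi phi Psi : 'rV[R]_N -> R) (lambda1 : R)
    (Kgf KHf Kgpsi KHpsi Ku Kgu KOmega Klambda : R),
  open Omega -> bounded_set Omega ->
  convex_set (Omega : set (convex_lmodType 'rV[R]_N)) ->
  0 < eps ->
  smooth_closure Omega f -> smooth_closure Omega g ->
  (forall x, closure Omega x -> 0 < f x) ->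
  (forall x, closure Omega x -> 0 < g x) ->
  has_density Omega mu f -> has_density Omega nu g ->
  smooth_closure Omega u ->
  (forall x, closure Omega x -> g x = (1 + eps * u x) * f x) ->
  smooth_closure Omega psi -> neumann_condition Omega psi ->
  (forall x, phi x = enorm x ^+ 2 / 2 + eps * psi x) ->
  convex_function (Omega : set (convex_lmodType 'rV[R]_N)) phi ->
  pushes_forward Omega mu nu (grad phi) ->
  (forall x, Omega x -> f x = g (grad phi x) * \det (hessian phi x)) ->
  neumann_solution Omega f Psi u ->
  smallest_positive_eigenvalue Omega f lambda1 ->
  ae_upper_bound Omega (fun x => enorm (grad f x)) Kgf ->
  ae_upper_bound Omega (fun x => opnorm (hessian f x)) KHf ->
  ae_upper_bound Omega (fun x => enorm (grad psi x)) Kgpsi ->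
  ae_upper_bound Omega (fun x => opnorm (hessian psi x)) KHpsi ->
  ae_upper_bound Omega (fun x => `|u x|) Ku ->
  ae_upper_bound Omega (fun x => enorm (grad u x)) Kgu ->
  (lebesgue_rV R N Omega <= KOmega%:E)%E ->
  lambda1^-1 <= Klambda ->
  (`| W2 Omega mu nu - eps%:E * Hdotm1 Omega mu u | <=
     (C Kgf KHf Kgpsi KHpsi Ku Kgu KOmega Klambda * eps ^+ 2)%:E)%E.
Proof.
exists (fun _ KHf Kgpsi KHpsi Ku _ KOmega Klambda =>
  linearization_constant N KHf Kgpsi KHpsi Ku KOmega Klambda).
move=> Omega eps mu nu f g u psi phi Psi lambda1 Kgf KHf Kgpsi KHpsi Ku Kgu KOmega Klambda.
move=> oO bO cO eps0 sf sg f0 g0 df dg su gE spsi _ phiE _ push ma _ eig _ aeF ae1 ae2 aeu _ hV hL.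
exact: (W2_linearization hN oO bO cO eps0 sf sg f0 df dg su gE spsi phiE push ma eig aeF ae1 ae2 aeu hV hL).
Qed.
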